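(* Let $G$ be a connected leafless graph of Betti number $g \ge 2$. Then \[ \# \operatorname{Aut}(G) \le \begin{cases}2^g g! & \text{if } g \ge 3,\\ 12 & \text{if } g = 2.\end{cases} \] Furthermore, the inequality becomes an equality if and only if $G$ is one of the following: \begin{itemize} \item[(A)] $G$ is a graph obtained from $G_{\mathrm{banana}, g}$ by subdividing all $g + 1$ edges into the same number ($\ge 1$) of edges, with $g \in \{2,3\}$. \item[(B)] $G$ is a graph obtained from $G_{\mathrm{bouquet}, g}$ by subdividing all $g$ loops into the same number ($\ge 2$) of edges, with $g \ge 3$. \item[(C)] $G$ is a graph obtained from $G_{\mathrm{lollipop}, g}$ by subdividing all $g$ loops into the same number ($\ge 2$) of edges and all $g$ bridges into a same number ($\ge 1$) of edges, with $g \ge 3$. \end{itemize}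
   Context: A graph $G=(V_G,E_G,\varepsilon_G)$ is an undirected finite graph allowing multiple edges and loops: $V_G$ is the finite set of vertices, $E_G$ the finite set of edges, and $\varepsilon_G : E_G \to 2^{V_G}$ sends an edge to the set of its end vertices, so $\#\varepsilon_G(e) \in \{1,2\}$ for every edge $e$; $e$ is a loop if $\#\varepsilon_G(e)=1$. The degree of a vertex is the number of edges incident to it, a loop being counted twice; a leaf is a vertex of degree one, and $G$ is leafless if it has no leaves. A bridge is an edge whose deletion increases the number of connected components. The Betti number of a graph $G$ with $k$ connected components is $\# E_G - \# V_G + k$. An automorphism $f=(f_V,f_E)$ of $G$ is a pair of bijections $f_V:V_G\to V_G$ and $f_E:E_G\to E_G$ with $f_V\circ\varepsilon_G=\varepsilon_G\circ f_E$ (where $f_V$ acts on subsets of $V_G$ elementwise); $\operatorname{Aut}(G)$ is the group of all automorphisms of $G$. (In particular, a loop has no nontrivial ''flip'': $\#\operatorname{Aut}(G_{\mathrm{bouquet},1})=1$.) Subdividing an edge (or loop) into $n$ edges means replacing it by a path (or cycle) of $n$ edges, with $n-1$ new vertices of degree two. Graphs are considered up to isomorphism. $G_{\mathrm{banana}, g}$ ($g \ge 1$) is the multigraph with exactly two vertices and $g+1$ multiple edges between them (and no other edges). $G_{\mathrm{bouquet}, g}$ ($g \ge 1$) is the graph with exactly one vertex and $g$ loops incident to it. $G_{\mathrm{lollipop}, g}$ ($g \ge 2$) is the graph obtained from $G_{\mathrm{bouquet}, g}$ by replacing the unique vertex with the star $S_g$ with $g$ leaves, i.e. the star with a central vertex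 joined by one edge (a bridge) to each of $g$ further vertices, with exactly one loop attached at each of these $g$ further vertices. *)

(* Defs.v *)
From HB Require Import structures.
From mathcomp Require Import all_boot all_order all_algebra all_fingroup.

Set Implicit Arguments.
Unset Strict Implicit.
Unset Printing Implicit Defensive.

Record mgraph := MGraph {
  vertex : finType;
  edge : finType;
  ends : edge -> {set vertex};
  card_ends : forall e, #|ends e| \in [:: 1; 2]
}.

Arguments ends {m} e.

Lemma card_set2_in12 (T : finType) (x y : T) : #|[set x; y]| \in [:: 1; 2].
Proof. by rewrite cards2; case: (x != y). Qed.

Definition mgraph_of_ends (V E : finType) (s t : E -> V) : mgraph :=
  @MGraph V E (fun e => [set s e; t e]) (fun e => card_set2_in12 (s e) (t e)).

Definition is_loop (G : mgraph) (e : edge G) : bool := #|ends e| == 1.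

Definition degree (G : mgraph) (v : vertex G) : nat :=
  \sum_(e : edge G | v \in ends e) (if is_loop e then 2 else 1).

Definition leafless (G : mgraph) : Prop := forall v : vertex G, degree v != 1.

Definition adj (G : mgraph) : rel (vertex G) :=
  fun x y => [exists e : edge G, ends e == [set x; y]].

Definition n_components (G : mgraph) : nat := n_comp (@adj G) (vertex G).

Definition connected (G : mgraph) : Prop := n_components G = 1.

Definition betti (G : mgraph) : int :=
  (#|edge G|%:Z - #|vertex G|%:Z + (n_components G)%:Z)%R.

(* As edges carry no orientation, a loop has no flip: the identity is the only
   automorphism of a one-vertex graph with a single loop. *)
Definition Aut_mgraph (G : mgraph) : {set {perm vertex G} * {perm edge G}} :=
  [set f : {perm vertex G} * {perm edge G} |
    [forall e, f.1 @: ends e == ends (f.2 e)]].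

Lemma Aut_mgraph_group_set (G : mgraph) : group_set (Aut_mgraph G).
Proof.
apply/group_setP; split=> [|f h].
  rewrite inE; apply/forallP => e /=; rewrite perm1.
  by rewrite (eq_imset (g := id)) ?imset_id // => x; rewrite perm1.
rewrite !inE => /forallP fG /forallP hG; apply/forallP => e /=.
rewrite permM -(eqP (hG _)) -(eqP (fG _)) -imset_comp.
by apply/eqP/eq_imset => x; rewrite permM.
Qed.

Canonical Aut_mgraph_group (G : mgraph) := Group (Aut_mgraph_group_set G).

Definition isomorphic (G H : mgraph) : Prop :=
  exists (fV : vertex G -> vertex H) (fE : edge G -> edge H),
    [/\ bijective fV, bijective fE
      & forall e : edge G, fV @: ends e = ends (fE e)].

Section Subdivision.
Variables (V E : finType) (s t : E -> V) (n : E -> nat).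

(* The k-th vertex (0 <= k <= n e) on the path of length n e that replaces e:
   the old vertex s e for k = 0, the (k - 1)-st new vertex for 0 < k < n e, and
   the old vertex t e for k = n e, where insub fails. *)
Definition subdiv_vertex (e : E) (k : nat) : V + {e : E & 'I_(n e).-1} :=
  if k is j.+1 then
    if (insub j : option 'I_(n e).-1) is Some i then
      inr (Tagged (fun e => 'I_(n e).-1) i)
    else inl (t e)
  else inl (s e).

Definition subdiv : mgraph :=
  @mgraph_of_ends (V + {e : E & 'I_(n e).-1})%type {e : E & 'I_(n e)}
    (fun p => subdiv_vertex (tag p) (tagged p))
    (fun p => subdiv_vertex (tag p) (tagged p).+1).

End Subdivision.

(* G is, up to isomorphism, obtained from H by subdividing each edge e into n e
   edges.  The functions s and t orient the edges of H, which matters only for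
   numbering the new vertices. *)
Definition is_subdivision (H : mgraph) (n : edge H -> nat) (G : mgraph) : Prop :=
  (forall e, 0 < n e) /\
  exists s t : edge H -> vertex H,
    (forall e, ends e = [set s e; t e]) /\ isomorphic G (subdiv s t n).

Definition banana (g : nat) : mgraph :=
  @mgraph_of_ends bool 'I_g.+1 (fun=> false) (fun=> true).

Definition bouquet (g : nat) : mgraph :=
  @mgraph_of_ends unit 'I_g (fun=> tt) (fun=> tt).

(* None is the center of the star and Some i its i-th leaf; the edge inl i is
   the i-th bridge and inr i the i-th loop. *)
Definition lollipop (g : nat) : mgraph :=
  @mgraph_of_ends (option 'I_g) ('I_g + 'I_g)%type
    (fun e => match e with inl _ => None | inr i => Some i end)
    (fun e => match e with inl i | inr i => Some i end).

Definition subdivided_banana (g : nat) (G : mgraph) : Prop :=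
  exists2 n, 1 <= n & is_subdivision (H := banana g) (fun=> n) G.

Definition subdivided_bouquet (g : nat) (G : mgraph) : Prop :=
  exists2 n, 2 <= n & is_subdivision (H := bouquet g) (fun=> n) G.

Definition subdivided_lollipop (g : nat) (G : mgraph) : Prop :=
  exists l b, [/\ 2 <= l, 1 <= b
    & is_subdivision (H := lollipop g)
        (fun e => match e with inl _ => b | inr _ => l end) G].

(* Main.v *)
Require Import Defs.
From HB Require Import structures.
From mathcomp Require Import all_boot all_order all_algebra all_fingroup.
From mathcomp Require Import zify.

(** A graph is turned into its incidence multigraph, whose nodes are the vertices
    and the edges; a loop is joined twice to its vertex.  Automorphisms become
    permutations of the nodes that preserve multiplicities, the connected subsets
    of nodes stand for the connected subgraphs, and the rank of such a set W is
    its Betti number e(W) - #W + 1.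

    The engine is [pinned_bound].  Let a group act on a connected set W of rank r
    and fix every point of a nonempty S that contains all leaves of W; then it
    induces at most 2^r r! permutations of W.  Fix v in S and let C be a component
    of W minus v, joined to v by a edges.  It accounts for r1 = a + rk C - 1 of the
    rank.  The orbit of C has m elements with m r1 <= r (or C meets S and m = 1);
    its stabiliser permutes at most a neighbours of v in C; once these are fixed,
    induction applies to C, pinned at them, and to the complement of C.  The
    product of the bounds is small enough because a! 2^c c! <= 2^r1 r1! and
    m r1! s! <= (r1 + s)!.

    Among the vertices of degree at least 3 choose v with the smallest orbit, of
    size n.

    If n = 1 then [pinned_bound] applies to the whole graph with S = {v}.  When the
    bound is attained for g >= 3 all these inequalities are tight ([fixed_eq]): the
    complement of v consists of g components that contribute 1 each to the rank and
    are all images of one of them, and some nontrivial automorphism moves only nodes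
    of that one.  This component is a path from v to v, or a path from v to a vertex
    w together with a path from w to w, and the path that closes up has at least two
    edges because a single loop has no flip; this gives the bouquets and the
    lollipops.

    If n >= 2, all other members of the orbit lie in one component M of the
    complement of v.  With p = rk of the complement of M, c = rk M and a edges
    between v and M we have p + c + a = g + 1, and the group has order at most
    n 2^p p! a! 2^c c!.  The translates of the complement of M are disjoint, so
    counting degrees gives n (2p + a - 2) <= 2 (g - 1), and counting ranks gives
    n p <= g.  Arithmetic then leaves three ways to attain the bound.
    - n = 2, p = c = 0, a = g + 1 and g is 2 or 3.  The two branch vertices are
      joined by g + 1 paths that are permuted transitively: a subdivided banana.
    - a = p = 1 and n = g >= 3.  The degrees leave a nonempty set of at most g - 2
      further branch vertices, which contradicts the choice of v.
    - g = 3 and four branch vertices of degree 3, with all permutations of the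
      three edges at each of them.  Then any two of the four are joined by one
      path, so an automorphism that fixes one of the four and the edges at it is
      trivial ([cubic_faithful]); but equality requires a nontrivial one.

    Conversely, a subdivision is described by families of paths ([param]).  A
    permutation of the paths, possibly with reversals, gives another such
    description of the same graph, and two descriptions differ by an
    automorphism; counting them ([aut_lower]) shows that the listed graphs attain
    the bound. *)

Set Implicit Arguments.
Unset Strict Implicit.
Unset Printing Implicit Defensive.

Local Open Scope group_scope.
Local Open Scope nat_scope.

(** * Multigraphs, cuts and the rank of a connected set *)

Section Multigraph.
Variables (T : finType) (mu : T -> T -> nat).
Hypothesis mu_sym : forall x y, mu x y = mu y x.
Hypothesis mu_irr : forall x, mu x x = 0.

Implicit Types (A B C R U W : {set T}) (x y z v : T) (f : {perm T}).

(** [cut A A] counts every edge inside A twice, once from each end. *)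
Definition cut A B := \sum_(x in A) \sum_(y in B) mu x y.

Lemma cutC A B : cut A B = cut B A.
Proof.
rewrite /cut exchange_big /=; apply: eq_bigr => y _; apply: eq_bigr => x _.
exact: mu_sym.
Qed.

Lemma cutUl A B C : [disjoint A & B] -> cut (A :|: B) C = cut A C + cut B C.
Proof. by move=> dAB; rewrite /cut -bigU //; apply: eq_bigl => x; rewrite inE. Qed.

Lemma cutUr A B C : [disjoint A & B] -> cut C (A :|: B) = cut C A + cut C B.
Proof. by move=> dAB; rewrite cutC cutUl // !(cutC C). Qed.

Lemma cutUU A B : [disjoint A & B] ->
  cut (A :|: B) (A :|: B) = cut A A + cut B B + (cut A B).*2.
Proof.
by move=> dAB; rewrite cutUl // !cutUr // (cutC B A) -addnn; lia.
Qed.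

Lemma cut1l x B : cut [set x] B = \sum_(y in B) mu x y.
Proof. by rewrite /cut big_set1. Qed.

Lemma cut11 x y : cut [set x] [set y] = mu x y.
Proof. by rewrite cut1l big_set1. Qed.

Lemma cut0P A B : reflect (forall x y, x \in A -> y \in B -> mu x y = 0)
                          (cut A B == 0).
Proof.
rewrite sum_nat_eq0; apply: (iffP forall_inP) => [h x y xA yB|h x xA].
  by move: (h x xA); rewrite sum_nat_eq0 => /forall_inP /(_ y yB) /eqP.
by rewrite sum_nat_eq0; apply/forall_inP => y yB; rewrite (h x y).
Qed.

Lemma cut_gt0 A B x y : x \in A -> y \in B -> 0 < mu x y -> 0 < cut A B.
Proof.
move=> xA yB h; rewrite lt0n; apply/negP => /cut0P /(_ x y xA yB) e.
by rewrite e in h.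
Qed.

Lemma cut_even A : ~~ odd (cut A A).
Proof.
have [n] := ubnP #|A|; elim: n A => // n IH A.
have [->|[x xA]] := set_0Vmem A; first by rewrite /cut big_set0.
rewrite -(setD1K xA) cardsU1 !inE eqxx /= => /ltnSE An.
rewrite cutUU ?disjoints1 ?inE ?eqxx // cut11 mu_irr add0n oddD odd_double addbF.
exact: IH.
Qed.
Definition closed_in W A :=
  forall x y, x \in A -> x \in W -> y \in W -> 0 < mu x y -> y \in A.

(** Stated as an induction principle, so that connectedness can be used without
    paths and is inherited by complements of components. *)
Definition conn W :=
  forall A x, x \in A -> x \in W -> closed_in W A -> W \subset A.

(** Components are handled through this property rather than through
    [component]: it is invariant under automorphisms, and two components that
    meet are equal. *)
Definition is_comp U C :=
  [/\ C != set0, C \subset U, conn C & closed_in U C].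

Definition component U x :=
  [set y | connect [rel y z | [&& y \in U, z \in U & 0 < mu y z]] x y].

Lemma mem_component U x : x \in component U x.
Proof. by rewrite inE connect0. Qed.

Lemma component_is_comp U x : x \in U -> is_comp U (component U x).
Proof.
move=> xU; pose r := [rel y z | [&& y \in U, z \in U & 0 < mu y z]].
have sr : connect_sym r.
  by apply: sym_connect_sym => y z /=; rewrite mu_sym; case: (y \in U); case: (z \in U).
have CU : component U x \subset U.
  apply/subsetP => y; rewrite inE => /connectP[p + ->] {y}.
  elim/last_ind: p => [|p z _] //=; rewrite rcons_path last_rcons => /andP[_].
  by case/and3P.
have step y z : y \in component U x -> r y z -> z \in component U x.
  by move=> + yz; rewrite !in_set => xy; apply: (connect_trans xy); apply: connect1.
split => //.
- by apply/set0Pn; exists x; apply: mem_component.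
- move=> A y yA yC clA; apply/subsetP => z zC.
  have: connect r y z.
    by rewrite !inE in yC zC; apply: connect_trans zC; rewrite sr.
  case/connectP => p; elim: p y yA yC => [|w p IH] y yA yC /=; first by move=> _ ->.
  case/andP => yw pth zl; have wC := step y w yC yw.
  by apply: (IH w) => //; apply: (clA y) => //; case/and3P: yw.
by move=> y z yC yU zU yz; apply: (step y) => //; rewrite /r /= yU zU.
Qed.

Lemma is_comp_ex U x : x \in U -> exists2 C, is_comp U C & x \in C.
Proof.
by move=> xU; exists (component U x); [apply: component_is_comp|apply: mem_component].
Qed.

Lemma is_comp_eq U C C' x : is_comp U C -> is_comp U C' ->
  x \in C -> x \in C' -> C = C'.
Proof.
move=> [_ CU cC clC] [_ CU' cC' clC'] xC xC'; apply/eqP; rewrite eqEsubset.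
apply/andP; split.
  by apply: (cC _ x) => // y z yC' yC zC; apply: clC' => //; apply: (subsetP CU).
by apply: (cC' _ x) => // y z yC' yC zC; apply: clC => //; apply: (subsetP CU').
Qed.
(** With [rk] below this says that the ranks of the blocks of a partition of a
    connected set into connected blocks add up to at most its rank: contracting
    the blocks leaves a connected graph, which has at least as many edges as a
    spanning tree. For the partition into points it is the inequality between
    edges and vertices of a connected graph. The proof adds one block at a time,
    each time along an edge that leaves the union of the previous ones. *)
Lemma cut_blocks W (h : T -> T) : W != set0 -> conn W ->
  \sum_(i in h @: W) (cut (W :&: h @^-1: [set i]) (W :&: h @^-1: [set i]) + 2)
    <= cut W W + 2.
Proof.
move=> W0 cW.
pose F i := W :&: h @^-1: [set i].
pose U (J : {set T}) := W :&: h @^-1: J.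
suff H k : k < #|h @: W| -> exists J : {set T},
    [/\ J \subset h @: W, #|J| = k.+1 &
     \sum_(i in J) (cut (F i) (F i) + 2) <= cut (U J) (U J) + 2].
  have h0 : 0 < #|h @: W| by rewrite card_gt0 imset_eq0.
  have [|J [JW Jc cJ]] := H #|h @: W|.-1; first by rewrite prednK.
  have JE : J = h @: W by apply/eqP; rewrite eqEcard JW Jc prednK ?leqnn.
  have UW : U J = W by apply/setIidPl/subsetP => x xW; rewrite inE JE imset_f.
  by move: cJ; rewrite UW JE.
elim: k => [|k IH] kW.
  case/set0Pn: W0 => x xW; exists [set h x].
  by split; rewrite ?cards1 ?big_set1 // sub1set imset_f.
have [J [JW Jc cJ]] := IH (ltnW kW).
have [x xW hxJ] : exists2 x, x \in W & h x \in J.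
  have /card_gt0P[i iJ]: 0 < #|J| by rewrite Jc.
  by have /imsetP[x xW E] := subsetP JW _ iJ; exists x; rewrite // -E.
(* As W is connected, some edge leaves the union of the blocks already taken. *)
have [x0 [y0 [x0W y0W x0J y0J xy]]] : exists x y,
   [/\ x \in W, y \in W, h x \in J, h y \notin J & 0 < mu x y].
  pose P := [exists x in W, exists y in W, [&& h x \in J, h y \notin J & 0 < mu x y]].
  case: (boolP P) => [/exists_inP[a aW /exists_inP[b bW /and3P[]]]|].
    by exists a, b.
  move=> /exists_inPn nP; exfalso.
  have WA : W \subset h @^-1: J.
    apply: (cW _ x); rewrite ?inE // => a b; rewrite !inE => aJ aW bW ab.
    move: (nP a aW) => /exists_inPn /(_ b bW); rewrite aJ ab andbT /=.
    by rewrite negbK.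
  suff: h @: W \subset J by move/subset_leq_card; rewrite Jc; lia.
  by apply/subsetP => i /imsetP[a aW ->]; move: (subsetP WA _ aW); rewrite inE.
exists (h y0 |: J); split; first by rewrite subUset sub1set imset_f.
  by rewrite cardsU1 y0J Jc.
rewrite big_setU1 //=.
have -> : U (h y0 |: J) = U J :|: F (h y0).
  by apply/setP => z; rewrite !inE -andb_orr orbC.
have dUF : [disjoint U J & F (h y0)].
  apply/pred0P => z; rewrite !inE /=; apply/negP => /andP[/andP[_ zJ]].
  by case/andP => _ /eqP E; rewrite -E zJ in y0J.
rewrite cutUU //.
have : 0 < cut (U J) (F (h y0)) by apply: (@cut_gt0 _ _ x0 y0); rewrite ?inE ?x0W ?y0W /=.
by lia.
Qed.

(** The Betti number of a connected set; [rkE] is the defining relation freed of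
    the halving and the truncated subtraction. *)
Definition rk W := ((cut W W)./2).+1 - #|W|.

Lemma conn_card W : W != set0 -> conn W -> #|W|.*2 <= cut W W + 2.
Proof.
move=> W0 cW; have := cut_blocks id W0 cW; rewrite imset_id.
rewrite (eq_bigr (fun=> 2)); first by rewrite sum_nat_const; lia.
move=> i iW; have -> : W :&: id @^-1: [set i] = [set i].
  by apply/setP => z; rewrite !inE; case: eqP => [->|]; rewrite ?iW ?andbF.
by rewrite cut11 mu_irr.
Qed.

Lemma rkE W : W != set0 -> conn W -> cut W W + 2 = (#|W| + rk W).*2.
Proof.
move=> W0 cW; have := conn_card W0 cW; have := cut_even W; rewrite /rk.
by have := odd_double_half (cut W W); case: odd => //=; lia.
Qed.
Section Split.
Variables (W C : {set T}) (v : T).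
Hypotheses (vW : v \in W) (cW : conn W) (compC : is_comp (W :\ v) C).

Let CW : C \subset W.
Proof. by case: compC => _ CU _ _; apply: subset_trans CU (subsetDl _ _). Qed.

Lemma comp_splitE : W = (W :\: C) :|: C.
Proof. by rewrite setUC -{1}(setIidPr CW) setID. Qed.

Lemma comp_split_disj : [disjoint W :\: C & C].
Proof. by rewrite -setI_eq0 setIDAC setDIl setDv setI0. Qed.

Lemma comp_notin : v \notin C.
Proof. by case: compC => _ /subsetP CU _ _; apply/negP => /CU; rewrite !inE eqxx. Qed.

Lemma comp_nbr x y : x \in C -> y \in W -> 0 < mu x y -> y \in v |: C.
Proof.
case: compC => _ CU _ clC xC yW xy; rewrite !inE; case: eqP => //= /eqP yv.
by apply: (clC x) => //; [apply: (subsetP CU)|rewrite !inE yv].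
Qed.

Lemma comp_rest_in : v \in W :\: C.
Proof. by rewrite !inE comp_notin vW. Qed.

(** A walk that leaves C does so through v. *)
Lemma comp_rest_conn : conn (W :\: C).
Proof.
suff H (A : {set T}) : v \in A -> closed_in (W :\: C) A -> W :\: C \subset A.
  move=> A x xA xR clA.
  case: (boolP (v \in A)) => [vA|vA]; first exact: H.
  exfalso; have /subsetP /(_ x xR) : W :\: C \subset ~: A.
    apply: H; rewrite ?inE // => a b; rewrite !inE => aA aR bR ab.
    apply/negP => bA; case/negP: aA.
    by apply: (clA b) => //; rewrite ?inE // mu_sym.
  by rewrite inE xA.
move=> vA clA; pose B := (A :\: C) :|: C.
have WB : W \subset B.
  apply: (@cW B v) => //; first by rewrite !inE comp_notin vA.
  move=> a b aB aW bW ab; rewrite !inE; have [//|bC /=] := boolP (b \in C).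
  have [aC|aC] := boolP (a \in C).
    by have := comp_nbr aC bW ab; rewrite !inE (negbTE bC) !orbF => /eqP ->.
  rewrite !inE (negbTE aC) /= orbF in aB.
  by rewrite orbF; apply: (clA a); rewrite ?inE ?aC ?bC.
apply/subsetP => x; rewrite !inE => /andP[xC xW].
by move/(subsetP WB): xW; rewrite !inE (negbTE xC) orbF.
Qed.

Lemma comp_cut_rest : cut (W :\: C) C = cut [set v] C.
Proof.
have E : W :\: C = [set v] :|: (W :\: C :\ v) by rewrite setD1K // comp_rest_in.
rewrite E cutUl ?disjoints1 ?inE ?eqxx //.
suff /eqP -> : cut (W :\: C :\ v) C == 0 by rewrite addn0.
apply/cut0P => x y; rewrite !inE => /and3P[xv xC xW] yC.
apply/eqP; rewrite -leqn0 leqNgt; apply/negP; rewrite mu_sym => h.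
by have := comp_nbr yC xW h; rewrite !inE (negbTE xv) (negbTE xC).
Qed.

Lemma comp_cut_gt0 : 0 < cut [set v] C.
Proof.
rewrite lt0n; apply/negP => /cut0P h0.
case: compC => /set0Pn[x xC] CU cC clC.
have /subsetP /(_ v vW) : W \subset C.
  apply: (@cW _ x) => // [|a b aC aW bW ab]; first exact: (subsetP CW).
  have := comp_nbr aC bW ab; rewrite !inE; case: eqP => //= E.
  by move: ab; rewrite mu_sym E h0 ?inE.
by rewrite (negbTE comp_notin).
Qed.

(** Cutting off C destroys the edges of C and its edges to v. *)
Lemma comp_rk : rk W + 1 = rk (W :\: C) + rk C + cut [set v] C.
Proof.
have [C0 CU cC _] := compC.
have dRC := comp_split_disj; have E := comp_splitE.
have eW := rkE (_ : W != set0) cW; have eC := rkE C0 cC.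
have eR := rkE (_ : W :\: C != set0) comp_rest_conn.
have cd : #|W| = #|W :\: C| + #|C| by rewrite {1}E cardsU disjoint_setI0 // cards0 subn0.
have := cutUU dRC; rewrite -E comp_cut_rest.
move: eW eR; have -> : W != set0 by apply/set0Pn; exists v.
have -> : W :\: C != set0 by apply/set0Pn; exists v; apply: comp_rest_in.
by move=> /(_ isT) eW /(_ isT) eR; have := comp_cut_gt0; lia.
Qed.

Lemma comp_rest_lt : #|W :\: C| < #|W|.
Proof.
have [C0 _ _ _] := compC.
by rewrite cardsD (setIidPr CW) ltn_subrL !card_gt0 C0; apply/set0Pn; exists v.
Qed.

Lemma comp_lt : #|C| < #|W|.
Proof.
apply: proper_card; rewrite properE CW; apply/negP => /subsetP /(_ v vW).
by rewrite (negbTE comp_notin).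
Qed.
Lemma comp_other C' : is_comp (W :\ v) C' -> C' != C -> is_comp ((W :\: C) :\ v) C'.
Proof.
move=> h' ne; have [C'0 C'U cC' clC'] := h'; split => //.
  apply/subsetP => x xC'; move: (subsetP C'U x xC'); rewrite !inE => /andP[-> ->].
  rewrite andbT /=; apply/negP => xC; case/eqP: ne; exact: (is_comp_eq h' compC xC' xC).
by move=> a b aC'; rewrite !inE => /and3P[av _ aW] /and3P[bv _ bW]; apply: clC' => //;
  rewrite !inE ?av ?bv.
Qed.

Lemma deg_comp x : x \in C -> cut [set x] W = cut [set x] C + mu v x.
Proof.
move=> xC; rewrite {1}comp_splitE cutUr ?comp_split_disj // addnC; congr (_ + _).
have E : W :\: C = [set v] :|: (W :\: C :\ v) by rewrite setD1K // comp_rest_in.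
rewrite E cutUr ?disjoints1 ?inE ?eqxx // cut11 mu_sym.
suff /eqP -> : cut [set x] (W :\: C :\ v) == 0 by rewrite addn0.
apply/cut0P => y z; rewrite !inE => /eqP -> /and3P[zv zC zW].
apply/eqP; rewrite -leqn0 leqNgt; apply/negP => h.
by have := comp_nbr xC zW h; rewrite !inE (negbTE zv) (negbTE zC).
Qed.

Lemma deg_rest x : x \in W :\: C -> x != v -> cut [set x] W = cut [set x] (W :\: C).
Proof.
rewrite inE => /andP[xC xW] xv; rewrite {1}comp_splitE cutUr ?comp_split_disj //.
suff /eqP -> : cut [set x] C == 0 by rewrite addn0.
apply/cut0P => y z; rewrite !inE => /eqP -> zC.
apply/eqP; rewrite -leqn0 leqNgt; apply/negP; rewrite mu_sym => h.
by have := comp_nbr zC xW h; rewrite !inE (negbTE xv) (negbTE xC).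
Qed.

Lemma deg_root : cut [set v] W = cut [set v] (W :\: C) + cut [set v] C.
Proof. by rewrite {1}comp_splitE cutUr ?comp_split_disj. Qed.

End Split.

(** Distinct components contribute independently to the rank; they are removed
    one after the other by [comp_rk]. *)
Lemma sum_comp_rk W v (P : {set {set T}}) : v \in W -> conn W ->
  (forall C, C \in P -> is_comp (W :\ v) C) ->
  \sum_(C in P) (cut [set v] C + rk C - 1) <= rk W.
Proof.
have [n] := ubnP #|W|; elim: n W P => // n IH W P Wn vW cW hP.
have [->|[C CP]] := set_0Vmem P; first by rewrite big_set0.
have hC := hP C CP; have E := comp_rk vW cW hC; have pos := comp_cut_gt0 vW cW hC.
have -> : rk W = (cut [set v] C + rk C - 1) + rk (W :\: C) by lia.
rewrite (big_setD1 C CP) /= leq_add2l.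
apply: IH.
- by apply: leq_trans (comp_rest_lt vW hC) _.
- exact: comp_rest_in vW hC.
- exact: comp_rest_conn vW cW hC.
by move=> C'; rewrite !inE => /andP[ne /hP h']; apply: comp_other.
Qed.

End Multigraph.

(** * Orders of signed permutation groups *)

(** The order of the group of signed permutations of n letters. *)
Definition bsize n := 2 ^ n * n`!.

Lemma bsize_gt0 n : 0 < bsize n.
Proof. by rewrite muln_gt0 expn_gt0 fact_gt0. Qed.

Lemma leq_exp2_pred a : 0 < a -> a <= 2 ^ a.-1.
Proof. by case: a => // a _; exact: ltn_expl. Qed.

Lemma fact_mul_le m n : m`! * n`! <= (m + n)`!.
Proof.
have h := bin_fact (leq_addr n m); rewrite addKn in h; rewrite -h.
by rewrite leq_pmull // bin_gt0 leq_addr.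
Qed.

(** Fixing the a neighbours of a cut vertex costs no more than the rank that the
    a edges account for, because a <= 2^(a-1). *)
Lemma fact_bsize_le a c : 0 < a -> a`! * bsize c <= bsize (a + c - 1).
Proof.
case: a => // a _; rewrite /bsize addSn subn1 /= factS expnD.
have := leq_exp2_pred (ltn0Sn a); have := fact_mul_le a c => /=.
move: (a`!) (c`!) ((a + c)`!) => p q r h1 h2.
have -> : a.+1 * p * (2 ^ c * q) = 2 ^ c * (a.+1 * (p * q)) by lia.
have -> : 2 ^ a * 2 ^ c * r = 2 ^ c * (2 ^ a * r) by lia.
by rewrite leq_mul2l leq_mul ?orbT.
Qed.

(** The binomial coefficient of r + s and r is (r + s) / r times another
    binomial coefficient, hence at least m. *)
Lemma orbit_bsize_le m r s : 0 < r -> m * r <= r + s ->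
  m * (bsize r * bsize s) <= bsize (r + s).
Proof.
case: r => // r _ h; rewrite /bsize expnD.
have h2 : m * (r.+1`! * s`!) <= (r.+1 + s)`!.
  have := bin_fact (leq_addr s r.+1); rewrite addKn => <-.
  rewrite leq_mul2r; apply/orP; right.
  rewrite -(leq_pmul2r (ltn0Sn r)); apply: leq_trans h _.
  rewrite mulnC -mul_bin_diag leq_pmulr // bin_gt0.
  by rewrite addSn /= leq_addr.
move: h2; move: (r.+1`!) (s`!) ((r.+1 + s)`!) (2 ^ r.+1) (2 ^ s) => p q u a b h2.
have -> : m * (a * p * (b * q)) = a * b * (m * (p * q)) by lia.
by rewrite leq_mul2l h2 orbT.
Qed.

(** * Automorphisms that fix all leaves *)

Section Groups.
Variables (T : finType) (mu : T -> T -> nat).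
Hypothesis mu_sym : forall x y, mu x y = mu y x.
Hypothesis mu_irr : forall x, mu x x = 0.

Implicit Types (A B C R S U W N : {set T}) (x y z v : T) (f : {perm T}).
Implicit Types K : {group {perm T}}.

Local Notation cut := (cut mu).
Local Notation rk := (rk mu).
Local Notation conn := (conn mu).
Local Notation is_comp := (is_comp mu).

Definition automorph f := forall x y, mu (f x) (f y) = mu x y.

Lemma cut_aut f A B : automorph f -> cut (f @: A) (f @: B) = cut A B.
Proof.
move=> af; rewrite /cut big_imset /=; last by move=> ? ? _ _; apply: perm_inj.
apply: eq_bigr => x _; rewrite big_imset /=; last by move=> ? ? _ _; apply: perm_inj.
by apply: eq_bigr => y _.
Qed.

Lemma rk_aut f A : automorph f -> rk (f @: A) = rk A.
Proof. by move=> af; rewrite /rk cut_aut // card_imset //; apply: perm_inj. Qed.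

Lemma is_comp_aut f U C : automorph f -> is_comp U C -> is_comp (f @: U) (f @: C).
Proof.
move=> af [C0 CU cC clC]; split.
- by rewrite imset_eq0.
- exact: imsetS.
- move=> A y yA /imsetP[x xC yx] clA.
  suff /subsetP h : C \subset f @^-1: A.
    by apply/subsetP => _ /imsetP[z /h + ->]; rewrite inE.
  apply: (cC _ x) => //; first by rewrite inE -yx.
  move=> a b; rewrite !inE => aA aC bC ab.
  by apply: (clA (f a)); rewrite ?mem_imset ?af //; apply: perm_inj.
move=> _ _ /imsetP[x xC ->] /imsetP[x' x'U E] /imsetP[y yU ->].
by rewrite af => xy; apply: imset_f; apply: (clC x) => //; apply: (subsetP CU).
Qed.

Lemma fixP K W f : reflect (f \in K /\ forall x, x \in W -> f x = x)
                           (f \in 'C_K(W | 'P)).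
Proof.
rewrite inE; apply: (iffP andP) => [[fK /astabP h]|[fK h]]; split => //.
by apply/astabP.
Qed.

Lemma fix_sub K W : 'C_K(W | 'P) \subset K. Proof. exact: subsetIl. Qed.

Lemma stab_setP K C f : reflect (f \in K /\ f @: C = C) (f \in 'C_K[C | 'P^*]).
Proof.
rewrite inE; apply: (iffP andP) => [[fK /astab1P h]|[fK h]]; split => //.
by apply/astab1P.
Qed.

Lemma stab_ptP K v f : reflect (f \in K /\ f v = v) (f \in 'C_K[v | 'P]).
Proof.
rewrite inE; apply: (iffP andP) => [[fK /astab1P h]|[fK h]]; split => //.
by apply/astab1P.
Qed.

Lemma orbit_setP K C A : reflect (exists2 f, f \in K & A = f @: C) (A \in orbit 'P^* K C).
Proof. by apply: (iffP imsetP) => -[f fK ->]; exists f. Qed.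

Lemma orbit_ptP K v u : reflect (exists2 f, f \in K & u = f v) (u \in orbit 'P K v).
Proof. by apply: (iffP imsetP) => -[f fK ->]; exists f. Qed.
Section Index.
Variables (K : {group {perm T}}) (N : {set T}).
Hypothesis KN : forall f, f \in K -> f @: N = N.

Let KnN : K \subset 'N(N | 'P).
Proof.
apply/subsetP => f fK; apply/astabsP => x /=.
by rewrite /aperm -{1}(KN fK) mem_imset //; apply: perm_inj.
Qed.

(** Restriction to N is a homomorphism whose kernel is the pointwise
    stabiliser. *)
Lemma fix_index_eq :
  #|K| = #|restr_perm N @* K| * #|'C_K(N | 'P)|.
Proof.
rewrite card_morphim ker_restr_perm (setIidPr KnN) -indexgI mulnC Lagrange //.
exact: subsetIl.
Qed.

Let im_Sym : restr_perm N @* K \subset Sym N.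
Proof.
by apply/subsetP => _ /morphimP[f _ _ ->]; rewrite inE restr_perm_on.
Qed.

Lemma fix_index : #|K| <= #|N|`! * #|'C_K(N | 'P)|.
Proof.
by rewrite fix_index_eq leq_mul2r -card_Sym subset_leq_card ?orbT.
Qed.

(** If the index is as large as possible, restriction to N is onto the symmetric
    group of N and so reaches all transpositions. *)
Lemma fix_index_full : #|N|`! * #|'C_K(N | 'P)| <= #|K| ->
  forall x y, x \in N -> y \in N -> exists f, [/\ f \in K, f x = y, f y = x &
     forall z, z \in N -> z != x -> z != y -> f z = z].
Proof.
rewrite fix_index_eq leq_mul2r; case/orP => [|h x y xN yN].
  by rewrite eqn0Ngt cardG_gt0.
have E : restr_perm N @* K = Sym N by apply/eqP; rewrite eqEcard im_Sym card_Sym.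
have : tperm x y \in Sym N.
  rewrite inE; apply/subsetP => z; rewrite inE.
  by case: tpermP => [->|->|_ _]; rewrite ?xN ?yN // eqxx.
rewrite -E => /morphimP[f fN fK fE].
have rE z : z \in N -> f z = tperm x y z by move=> zN; rewrite fE restr_permE.
exists f; split; rewrite ?rE // ?tpermL ?tpermR //.
by move=> z zN zx zy; rewrite rE // tpermD // eq_sym.
Qed.
End Index.

(** The points of S are pinned. A point of degree at most 1 in W must be pinned:
    otherwise W could be a star, of rank 0, whose leaves can be permuted
    arbitrarily. *)
Definition pinned_at W := conn W -> forall S K,
  (forall f, f \in K -> automorph f) -> (forall f, f \in K -> f @: W = W) ->
  S != set0 -> S \subset W -> (forall f x, f \in K -> x \in S -> f x = x) ->
  (forall x, x \in W -> x \notin S -> 2 <= cut [set x] W) ->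
  #|K| <= bsize (rk W) * #|'C_K(W | 'P)|.

Definition nbrs v C := [set y in C | 0 < mu v y].

Lemma card_nbrs v C : #|nbrs v C| <= cut [set v] C.
Proof.
rewrite cut1l -sum1_card /nbrs big_mkcond [X in _ <= X]big_mkcond /=.
by apply: leq_sum => y _; rewrite inE; case: (y \in C) => //=; case: (mu v y).
Qed.

Lemma nbrs_aut f v C : automorph f -> f v = v -> f @: C = C -> f @: nbrs v C = nbrs v C.
Proof.
move=> af fv fC; apply/eqP; rewrite eqEcard card_imset ?leqnn ?andbT; last exact: perm_inj.
apply/subsetP => _ /imsetP[x xN ->]; move: xN; rewrite !inE => /andP[xC vx].
by rewrite -{1}fv af vx andbT -fC imset_f.
Qed.

Lemma nbrs_neq0 v C : 0 < cut [set v] C -> nbrs v C != set0.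
Proof.
rewrite lt0n; apply: contraNN => /eqP n0; apply/cut0P => x y.
rewrite inE => /eqP -> yC; apply/eqP; rewrite -leqn0 leqNgt; apply/negP => h.
by move/setP/(_ y): n0; rewrite !inE yC h.
Qed.

(** The action inside one component C of the complement of a fixed v. The
    neighbours of v in C can be permuted among themselves; a point of C that is
    not one of them keeps its degree, so C pinned at them satisfies the
    hypotheses of the inductive bound. *)
Lemma inside_bound W C S v K : v \in W -> conn W -> is_comp (W :\ v) C ->
  pinned_at C ->
  (forall f, f \in K -> automorph f) -> (forall f, f \in K -> f @: C = C) ->
  (forall f, f \in K -> f v = v) -> (forall f x, f \in K -> x \in S -> f x = x) ->
  (forall x, x \in C -> x \notin S -> 2 <= cut [set x] W) ->
  #|K| <= #|nbrs v C|`! * (bsize (rk C) * #|'C_K(C | 'P)|).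
Proof.
move=> vW cW hC pC aK KC Kv KS dC; have [_ _ cC _] := hC.
apply: leq_trans (fix_index (N := nbrs v C) _) _ => [f fK|].
  by apply: nbrs_aut; [apply: aK|apply: Kv|apply: KC].
rewrite leq_mul2l; apply/orP; right.
pose L := 'C_K(nbrs v C | 'P)%G; pose P := (S :&: C) :|: nbrs v C.
have LK f : f \in L -> f \in K by case/fixP.
apply: leq_trans (pC cC P L _ _ _ _ _ _) _.
- by move=> f /LK /aK.
- by move=> f /LK /KC.
- have := nbrs_neq0 (comp_cut_gt0 mu_sym vW cW hC); apply: contraNN => /eqP e.
  by rewrite -subset0 -e subsetUr.
- by rewrite subUset subsetIr; apply/subsetP => x; rewrite inE => /andP[].
- move=> f x fL; rewrite !inE => /orP[/andP[xS _]|xN].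
    by apply: KS => //; apply: LK.
  by case/fixP: fL => _; apply; rewrite inE.
- move=> x xC; rewrite !inE xC andbT /= negb_or => /andP[xS vx].
  have := dC x xC xS; rewrite (deg_comp mu_sym vW hC) //.
  by move: vx; rewrite -leqNgt leqn0 => /eqP ->; rewrite addn0.
rewrite leq_mul2l; apply/orP; right; apply: subset_leq_card.
by apply/subsetP => f /fixP[/LK fK fC]; apply/fixP.
Qed.

Section OrbitComp.
Variables (W C : {set T}) (v : T) (K : {group {perm T}}).
Hypotheses (vW : v \in W) (cW : conn W) (hC : is_comp (W :\ v) C).
Hypotheses (aK : forall f, f \in K -> automorph f) (KW : forall f, f \in K -> f @: W = W).
Hypothesis Kv : forall f, f \in K -> f v = v.

Let KWv f : f \in K -> f @: (W :\ v) = W :\ v.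
Proof.
move=> fK; apply/eqP; rewrite eqEcard card_imset ?leqnn ?andbT; last exact: perm_inj.
apply/subsetP => _ /imsetP[x xN ->]; move: xN; rewrite !inE => /andP[xv xW].
by rewrite -{1}(KW fK) imset_f // andbT -{1}(Kv fK) (inj_eq perm_inj).
Qed.

Lemma orbit_is_comp A : A \in orbit 'P^* K C -> is_comp (W :\ v) A.
Proof.
by case/orbit_setP => f fK ->; rewrite -(KWv fK); apply: is_comp_aut => //; apply: aK.
Qed.

Lemma orbit_comp_rank A : A \in orbit 'P^* K C ->
  cut [set v] A = cut [set v] C /\ rk A = rk C.
Proof.
case/orbit_setP => f fK ->; rewrite rk_aut; last exact: aK.
by rewrite -{1}(Kv fK) -imset_set1 cut_aut //; apply: aK.
Qed.

(** The members of the orbit of C have the same rank contribution. *)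
Lemma orbit_comp_sum :
  #|orbit 'P^* K C| * (cut [set v] C + rk C - 1) <= rk W.
Proof.
apply: leq_trans (sum_comp_rk mu_sym mu_irr vW cW orbit_is_comp).
rewrite (eq_bigr (fun=> cut [set v] C + rk C - 1)) ?sum_nat_const //.
by move=> A /orbit_comp_rank[-> ->].
Qed.

Lemma orbit_comp_fixed f : f \in 'C_K[C | 'P^*] -> f @: (W :\: C) = W :\: C.
Proof.
case/stab_setP => fK fC; apply/eqP.
rewrite eqEcard card_imset ?leqnn ?andbT; last exact: perm_inj.
apply/subsetP => _ /imsetP[x xN ->]; move: xN; rewrite !inE => /andP[xC xW].
by rewrite -{1}(KW fK) imset_f // andbT -fC mem_imset //; apply: perm_inj.
Qed.
End OrbitComp.
(** A tree hanging at v would have another leaf. *)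
Lemma comp_rank_gt0 W C v : v \in W -> conn W -> is_comp (W :\ v) C ->
  (forall x, x \in C -> 2 <= cut [set x] W) -> 0 < cut [set v] C + rk C - 1.
Proof.
move=> vW cW hC dC; have pos := comp_cut_gt0 mu_sym vW cW hC.
have [C0 _ cC _] := hC; have eC := rkE mu_sym mu_irr C0 cC.
have : #|C|.*2 <= cut C C + cut [set v] C.
  rewrite -mul2n mulnC -sum_nat_const cut1l /cut -big_split /=.
  by apply: leq_sum => x xC; have := dC x xC; rewrite (deg_comp mu_sym vW hC) // cut1l.
by lia.
Qed.

(** Orbit-stabiliser for one component C of the complement of a pinned v, and
    induction on both sides of v. If C contains a pinned point it is stable,
    otherwise its contribution to the rank is positive and bounds the length of
    its orbit. *)
Theorem pinned_bound W : pinned_at W.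
Proof.
have [n] := ubnP #|W|; elim: n W => // n IH W Wn cW S K aK KW S0 SW KS dW.
have [v vS] := set0Pn _ S0; have vW := subsetP SW v vS.
have Kv f : f \in K -> f v = v by move=> fK; apply: KS.
have [W1|/set0Pn[x xWv]] := eqVneq (W :\ v) set0.
  have E : 'C_K(W | 'P) = K.
    apply/eqP; rewrite eqEsubset fix_sub; apply/subsetP => f fK; apply/fixP; split=> // y yW.
    have : y \notin W :\ v by rewrite W1 inE.
    by rewrite !inE yW andbT negbK => /eqP ->; apply: Kv.
  by rewrite {1}E leq_pmull // bsize_gt0.
have [C hC xC] := is_comp_ex mu_sym xWv.
set R := W :\: C.
have rE := comp_rk mu_sym mu_irr vW cW hC; rewrite -/R in rE.
have pos := comp_cut_gt0 mu_sym vW cW hC.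
have CW : C \subset W by case: hC => _ h _ _; apply: subset_trans h (subsetDl _ _).
set r := cut [set v] C + rk C - 1.
have {rE} rE : rk W = r + rk R by rewrite /r; lia.
pose K1 := 'C_K[C | 'P^*]%G.
have K1K f : f \in K1 -> f \in K by case/stab_setP.
have K1R : #|K1| <= bsize (rk R) * #|'C_K1(R | 'P)|.
  apply: (IH R _ _ (S :&: R)).
  - exact: leq_trans (comp_rest_lt vW hC) _.
  - exact: (comp_rest_conn mu_sym vW cW hC).
  - by move=> f /K1K /aK.
  - by move=> f fK1; apply: (orbit_comp_fixed (K := K)).
  - by apply/set0Pn; exists v; rewrite inE vS (comp_rest_in vW hC).
  - exact: subsetIr.
  - by move=> f y /K1K fK; rewrite inE => /andP[yS _]; apply: KS.
  - move=> y yR; rewrite inE yR andbT => yS.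
    rewrite -(deg_rest mu_sym hC) //; last by apply: contraNneq yS => ->.
    by apply: dW => //; move: yR; rewrite inE => /andP[].
have LC : #|'C_K1(R | 'P)| <= bsize r * #|'C_K(W | 'P)|.
  pose L := 'C_K1(R | 'P)%G.
  have LK f : f \in L -> f \in K1 by case/fixP.
  apply: leq_trans (inside_bound (K := L) (S := S) vW cW hC _ _ _ _ _ _) _.
  - by apply: IH; apply: leq_trans (comp_lt vW hC) _.
  - by move=> f /LK /K1K /aK.
  - by move=> f /LK /stab_setP[].
  - by move=> f /LK /K1K /Kv.
  - by move=> f y /LK /K1K fK; apply: KS.
  - by move=> y yC; apply: dW; apply: (subsetP CW).
  rewrite mulnA; apply: leq_mul.
    apply: leq_trans (fact_bsize_le _ pos); rewrite leq_mul2r.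
    by apply/orP; right; apply: leq_fact; apply: card_nbrs.
  apply: subset_leq_card; apply/subsetP => f /fixP[fL fC].
  apply/fixP; split; first exact/K1K/LK.
  move=> y yW; have [yC|yC] := boolP (y \in C); first exact: fC.
  by case/fixP: fL => _; apply; rewrite inE yC.
have K1b : #|K1| <= bsize (rk R) * bsize r * #|'C_K(W | 'P)|.
  by apply: leq_trans K1R _; rewrite -mulnA leq_mul2l LC orbT.
have orb : #|K| = #|orbit 'P^* K C| * #|K1| by rewrite card_orbit_stab.
suff h : #|orbit 'P^* K C| * (bsize r * bsize (rk R)) <= bsize (rk W).
  rewrite orb; apply: leq_trans (leq_mul (leqnn _) K1b) _.
  by rewrite mulnA leq_mul2r (mulnC (bsize (rk R))) h orbT.
have [SC|SC] := eqVneq (S :&: C) set0.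
  rewrite rE; apply: orbit_bsize_le; last by rewrite -rE; apply: orbit_comp_sum.
  apply: comp_rank_gt0 hC _ => // y yC; apply: dW; first exact: (subsetP CW).
  by apply/negP => yS; move/setP/(_ y): SC; rewrite !inE yS yC.
have -> : #|orbit 'P^* K C| = 1.
  have [y] := set0Pn _ SC; rewrite inE => /andP[yS yC].
  rewrite -(cards1 C); congr #|pred_of_set _|; apply/setP => A; rewrite inE.
  apply/idP/eqP => [/[dup] /orbit_setP[f fK AE] /(orbit_is_comp hC aK KW Kv) hA|->].
    by apply: (is_comp_eq hA hC _ yC); rewrite AE -(KS f y fK yS) imset_f.
  exact: orbit_refl.
rewrite mul1n rE /bsize expnD; have := fact_mul_le r (rk R).
move: (r`!) ((rk R)`!) ((r + rk R)`!) (2 ^ r) (2 ^ rk R) => p q u a b h2.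
have -> : a * p * (b * q) = a * b * (p * q) by lia.
by rewrite leq_mul2l h2 orbT.
Qed.

End Groups.

(** * The arithmetic of the extremal cases *)

Definition bound g := if 3 <= g then 2 ^ g * g`! else 12.

Lemma boundE g : 3 <= g -> bound g = bsize g.
Proof. by rewrite /bound => ->. Qed.

Lemma bsize_le_bound g : 2 <= g -> bsize g <= bound g.
Proof. by case: g => [|[|[|g]]]. Qed.

Lemma bsize_eq_bound g : 2 <= g -> bsize g = bound g -> 3 <= g.
Proof. by case: g => [|[|[|g]]]. Qed.

Lemma bsizeS n : bsize n.+1 = n.+1.*2 * bsize n.
Proof. by rewrite /bsize expnS factS; lia. Qed.

Lemma bsizeM m n : bsize m * bsize n <= bsize (m + n).
Proof.
rewrite /bsize expnD; have := fact_mul_le m n.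
move: (m`!) (n`!) ((m + n)`!) (2 ^ m) (2 ^ n) => p q r a b h2.
have -> : a * p * (b * q) = a * b * (p * q) by lia.
by rewrite leq_mul2l h2 orbT.
Qed.

(** The strict form of [orbit_bsize_le]: one more factor of the binomial
    coefficient is at least 2. *)
Lemma orbit_bsize_lt m r s : 2 <= r -> 0 < s -> m * r <= r + s ->
  m * (bsize r * bsize s) < bsize (r + s).
Proof.
case: r => [|[|r]] // _; case: s => // s _ h; set R := r.+2; set S := s.+1.
have E := bin_fact (leq_addr S R); rewrite addKn in E.
have D := mul_bin_diag (R + S) r.+1.
have B2 : 2 <= 'C((R + S).-1, r.+1).
  rewrite /R /S addSn /= addSn binS; apply: (@leq_add 1 1); rewrite bin_gt0; lia.
have lt : m < 'C(R + S, R).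
  rewrite -(@ltn_pmul2r R) // (leq_ltn_trans h) // mulnC -D.
  by rewrite -[X in X < _]muln1 ltn_pmul2l.
rewrite /bsize expnD -E; move: lt; clear; clearbody R S => lt.
have : 0 < R`! * S`! * (2 ^ R * 2 ^ S) by rewrite !muln_gt0 !fact_gt0 !expn_gt0.
move: lt; move: (R`!) (S`!) (2 ^ R) (2 ^ S) 'C(_, _) => P Q a' b B lt pos.
have -> : m * (a' * P * (b * Q)) = m * (P * Q * (a' * b)) by lia.
have -> : a' * b * (B * (P * Q)) = B * (P * Q * (a' * b)) by lia.
by rewrite ltn_mul2r pos.
Qed.

Lemma fact_bsize_lt a c : 3 <= a -> a`! * bsize c < bsize (a + c - 1).
Proof.
case: a => [|[|[|a]]] // _; rewrite /bsize addSn subn1 /= factS expnD.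
have : a.+3 < 2 ^ a.+2.
  by elim: a => // a IH; rewrite expnS; lia.
have := fact_mul_le a.+2 c; have := fact_gt0 (a.+2 + c); rewrite !addSn.
move: (a.+2`!) (c`!) ((a + c).+2`!) (2 ^ a.+2) (2 ^ c) (expn_gt0 2 c) => p q r x y y0 r0 h1 h2.
have -> : a.+3 * p * (y * q) = y * (a.+3 * (p * q)) by lia.
have -> : x * y * r = y * (x * r) by lia.
rewrite ltn_pmul2l //; apply: (@leq_ltn_trans (a.+3 * r)); first by rewrite leq_mul2l h1 orbT.
by rewrite ltn_pmul2r.
Qed.

(** Here r is the contribution of one component of the complement of the fixed
    vertex, s the rank of the rest, m the length of the orbit of the component
    and l the number of automorphisms that move only this component. *)
Lemma fixed_numeric g m r s a c k l : 3 <= g -> 0 < a -> 0 < r -> g = r + s ->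
  a + c = r.+1 -> k <= a -> m * r <= g -> (s = 0 -> 3 <= a) ->
  l <= k`! * bsize c -> bsize g <= m * (bsize s * l) ->
  [/\ r = 1, m = g, 2 <= l & [/\ a = 2, c = 0 & k = 2] \/ a = 1 /\ c = 1].
Proof.
move=> g3 a0 r0 gE ac ka mr s0 lk bg.
have lr : l <= bsize r.
  apply: leq_trans lk _; apply: leq_trans (_ : a`! * bsize c <= _).
    by rewrite leq_mul2r leq_fact ?orbT.
  by have := fact_bsize_le c a0; rewrite ac subn1.
have r1 : r = 1.
  apply/eqP; apply: contraT => r1; exfalso; have r2 : 2 <= r by lia.
  move: bg; apply/negP; rewrite -ltnNge gE; case: (posnP s) => [s00|sp].
    have m1 : m <= 1 by nia.
    have lt := fact_bsize_lt c (s0 s00); rewrite ac subn1 /= in lt.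
    rewrite s00 addn0 mul1n; apply: leq_ltn_trans lt.
    apply: leq_trans (_ : l <= _); first by rewrite -[X in _ <= X]mul1n leq_mul2r m1 orbT.
    by apply: leq_trans lk _; rewrite leq_mul2r leq_fact ?orbT.
  have mr' : m * r <= r + s by rewrite -gE.
  apply: leq_ltn_trans (orbit_bsize_lt r2 sp mr').
  by rewrite leq_mul2l mulnC leq_mul2r lr !orbT.
move: bg; rewrite gE r1 add1n bsizeS mulnCA mulnC leq_pmul2l ?bsize_gt0 // => h.
have b1 : bsize 1 = 2 by []; rewrite r1 b1 in lr; rewrite r1 muln1 in mr.
have mg : m = g by nia.
split => //; [by lia|by nia|].
have [[aE cE]|[aE cE]] : a = 2 /\ c = 0 \/ a = 1 /\ c = 1 by lia.
  left; split => //; have : 2 <= k`! * bsize 0 by rewrite -cE; apply: leq_trans lk; nia.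
  by case: (k) ka => [|[|[|]]] //; rewrite aE.
by right.
Qed.

Section Numeric.
Variables n p c a g : nat.
Hypothesis a_gt0 : 0 < a.
Hypotheses (g2 : 2 <= g) (n2 : 2 <= n) (rkE : g + 1 = p + c + a).
Hypotheses (degree_count : n * (p.*2 + a) <= g.*2 - 2 + n.*2) (rank_count : n * p <= g).
Hypotheses (degree_ge3 : 3 <= p.*2 + a).
Hypothesis no_lollipop : [&& a == 1, p == 1, n == g & 3 <= g] -> False.

Let ubound := n * (bsize p * (a`! * bsize c)).

(** When p is at least 2 the binomial coefficient of g and p exceeds n; when p =
    1 it equals g, and the excluded case is n = g. *)
Lemma ubound_lt_a1 : a = 1 -> ubound < bound g.
Proof.
move=> a1; have gE : g = p + c by lia.
have p1 : 1 <= p by lia.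
rewrite /ubound a1 mul1n; case: (leqP 3 g) => [g3|g3]; last first.
  have -> : p = 1 by nia. have -> : c = 1 by nia.
  have -> : n = 2 by nia. by have -> : g = 2 by lia.
rewrite boundE //; case: (ltngtP p 1) => [|p2|pE]; first by lia.
  have c2 : 2 <= c by nia.
  have c2' : 0 < c by lia.
  by rewrite gE; apply: orbit_bsize_lt; nia.
have cE : g = c.+1 by lia.
have nc : n < c.+1.
  by rewrite ltn_neqAle; apply/andP; split; [apply/negP => /eqP nE; apply: no_lollipop;
    apply/and4P; split; apply/eqP; lia|nia].
rewrite cE bsizeS pE; have -> : bsize 1 = 2 by [].
by have := bsize_gt0 c; nia.
Qed.

Lemma ubound_lt_a2 : a = 2 -> ubound < bound g.
Proof.
move=> a2; have gE : g = (p + c).+1 by lia.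
have p1 : 1 <= p by lia.
have c1 : 1 <= c by nia.
have := @orbit_bsize_le n p c p1.
rewrite /ubound a2 gE boundE; last by lia.
rewrite bsizeS; have := bsize_gt0 (p + c); have -> : 2`! = 2 by [].
move: (bsize p) (bsize c) (bsize _) => P Q B B0 h.
have {}h : n * (P * Q) <= B by apply: h; nia.
by nia.
Qed.

(** For a = 3 the comparison reduces to 6 n < 4 (s + 1) (s + 2) with s = p + c,
    where n (2p + 1) <= 2 (s + 1). *)
Lemma ubound_lt_a3 : a = 3 -> ~~ [&& p == 0, c == 0 & n == 2] ->
  ~~ [&& p == 0, c == 1 & n == 4] -> ubound < bound g.
Proof.
move=> a3 N1 N2; have gE : g = (p + c).+2 by lia.
have := bsizeM p c; rewrite /ubound a3; have -> : 3`! = 6 by [].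
case: (leqP 3 g) => [g3|g3]; last first.
  have [-> ->] : p = 0 /\ c = 0 by lia.
  have nn : n = 2 by nia.
  by have : false by rewrite -(negbTE N1); apply/and3P; split; apply/eqP; lia.
rewrite boundE // gE !bsizeS; have := bsize_gt0 (p + c).
move: (bsize p) (bsize c) (bsize _) => P Q B B0 h.
suff {h} : n * 6 < (p + c).+2.*2 * (p + c).+1.*2.
  by move=> lt; apply: (@leq_ltn_trans (n * 6 * B)); nia.
have F : n * (p.*2.+1) <= (p + c).+1.*2 by nia.
(* The factor p.*2.+1 is at least 3 unless p = 0; then s = c, and c = 1 leaves n
   < 4. *)
case: p F N1 N2 g3 gE => [|p'] F N1 N2 g3 gE; last by nia.
case: c F N1 N2 g3 gE => [|[|c']] F N1 N2 g3 gE; try lia; nia.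
Qed.

(** With t = a - 3 and s = p + c, the bound on n by the degree count turns the
    claim into t + 3 <= 2^(t+1), which is an equality only for t = 1. *)
Lemma ubound_le_a4 : 4 <= a -> ubound <= bound g /\ (ubound = bound g ->
  [/\ a = 4, p = 0, c = 0 & n = 2]).
Proof.
move=> a4; pose t := a - 3; have t1 : 1 <= t by rewrite /t; lia.
have aE : a = t.+3 by rewrite /t; lia.
pose s := p + c; have gE : g = (s + t).+2 by rewrite /s; lia.
rewrite boundE; last by lia.
have F : n * t.+1 <= (s + t).+1.*2 by rewrite /s; nia.
have h1 := bsizeM p c; rewrite -/s in h1.
have h2 : t`! * bsize s <= 2 ^ s * (s + t)`!.
  rewrite /bsize mulnCA leq_mul2l addnC fact_mul_le orbT //.
(* The comparison of a <= 2^(a - 2) for a = t + 3; equality holds for a = 4. *)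
have t3 : t.+3 <= 2 ^ t.+1 by move: t1; case: (t) => // k _; rewrite !expnS;
  have := ltn_expl k (isT : 1 < 2); lia.
have S1 : ubound * t.+1 <= t.+3 * t.+2 * (n * t.+1) * t.+1 * (2 ^ s * (s + t)`!).
  rewrite /ubound aE !factS; move: h1 h2; move: (bsize p) (bsize c) (bsize s) (t`!) (2 ^ s *
    _) => P Q B f G h1 h2.
  have -> : n * (P * (t.+3 * (t.+2 * (t.+1 * f)) * Q)) * t.+1 = t.+3 * t.+2 * (n * t.+1) *
    t.+1 * (f * (P * Q)) by nia.
  by rewrite leq_mul2l; apply/orP; right; apply: leq_trans h2; rewrite leq_mul2l h1 orbT.
set G := 2 ^ s * (s + t)`! in S1.
have G0 : 0 < G by rewrite muln_gt0 expn_gt0 fact_gt0.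
have E2 : bsize g = 2 ^ t.+2 * ((s + t).+2 * (s + t).+1) * G.
  rewrite gE /G /bsize !factS; have -> : (s + t).+2 = s + t.+2 by lia.
  by rewrite expnD; lia.
have S2 : ubound <= t.+3 * t.+2 * (n * t.+1) * G.
  by rewrite -(leq_pmul2r (ltn0Sn t)); apply: leq_trans S1 _; nia.
rewrite E2.
have E3 : t.+3 * t.+2 * (n * t.+1) <= 2 ^ t.+1 * (s + t).+2 * (n * t.+1).
  by rewrite leq_mul2r; apply/orP; right; apply: leq_mul => //; lia.
have E4 : 2 ^ t.+1 * (s + t).+2 * (n * t.+1) <= 2 ^ t.+2 * ((s + t).+2 * (s + t).+1).
  have -> : 2 ^ t.+2 * ((s + t).+2 * (s + t).+1) =
            2 ^ t.+1 * (s + t).+2 * (s + t).+1.*2 by rewrite [2 ^ t.+2]expnS; lia.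
  by rewrite leq_mul2l F orbT.
split.
  by apply: leq_trans S2 _; rewrite leq_mul2r (leq_trans E3 E4) orbT.
move=> EE; rewrite EE leq_mul2r eqn0Ngt G0 /= in S2.
have nt0 : 0 < n * t.+1 by rewrite muln_gt0 andbT; lia.
have E5 : 2 ^ t.+1 * (s + t).+2 <= t.+3 * t.+2.
  by rewrite -(leq_pmul2r nt0); apply: leq_trans E4 S2.
have s0 : s = 0.
  have : t.+3 * (s + t).+2 <= t.+3 * t.+2 by apply: leq_trans E5; rewrite leq_mul2r t3 orbT.
  by rewrite leq_pmul2l //; lia.
have t1' : t = 1.
  rewrite s0 add0n leq_pmul2r // in E5; move: E5; rewrite !expnS.
  case: (t) t1 => // -[|k] // _; have := ltn_expl k (isT : 1 < 2); rewrite !expnS; lia.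
rewrite t1' s0 in S2 F; move: S2 F; have -> : 2 ^ 3 * ((0 + 1).+2 * (0 + 1).+1) = 48 by [].
by move=> S2 F; split; lia.
Qed.

Lemma ubound_le : ubound <= bound g.
Proof.
have [a0|[a1|[a2|[a3|a4]]]] : a = 0 \/ a = 1 \/ a = 2 \/ a = 3 \/ 4 <= a by lia.
- by lia.
- exact: ltnW (ubound_lt_a1 a1).
- exact: ltnW (ubound_lt_a2 a2).
- case: (boolP [&& p == 0, c == 0 & n == 2]) => [/and3P[/eqP p0 /eqP c0 /eqP n2']|N1].
    by rewrite /ubound a3 p0 c0 n2'; have -> : g = 2 by lia.
  case: (boolP [&& p == 0, c == 1 & n == 4]) => [/and3P[/eqP p0 /eqP c0 /eqP n2']|N2].
    by rewrite /ubound a3 p0 c0 n2'; have -> : g = 3 by lia.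
  exact: ltnW (ubound_lt_a3 a3 N1 N2).
exact: (ubound_le_a4 a4).1.
Qed.

Lemma ubound_eq : ubound = bound g ->
  [/\ p = 0, c = 0, n = 2, a = g.+1 & g \in [:: 2; 3]] \/
  [/\ p = 0, c = 1, n = 4, a = 3 & g = 3].
Proof.
move=> E.
have [a0|[a1|[a2|[a3|a4]]]] : a = 0 \/ a = 1 \/ a = 2 \/ a = 3 \/ 4 <= a by lia.
- by lia.
- by have := ubound_lt_a1 a1; rewrite E ltnn.
- by have := ubound_lt_a2 a2; rewrite E ltnn.
- case: (boolP [&& p == 0, c == 0 & n == 2]) => [/and3P[/eqP p0 /eqP c0 /eqP n2']|N1].
    by left; have -> : g = 2 by lia.
  case: (boolP [&& p == 0, c == 1 & n == 4]) => [/and3P[/eqP p0 /eqP c0 /eqP n2']|N2].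
    by right; split => //; lia.
  by have := ubound_lt_a3 a3 N1 N2; rewrite E ltnn.
have [aE pE cE nE] := (ubound_le_a4 a4).2 E.
by left; have -> : g = 3 by lia.
Qed.

End Numeric.

(** * Orbits of branch nodes *)

Section BranchOrbit.
Variables (T : finType) (mu : T -> T -> nat).
Hypothesis mu_sym : forall x y, mu x y = mu y x.
Hypothesis mu_irr : forall x, mu x x = 0.
Variables (K : {group {perm T}}) (g : nat).
Hypothesis aK : forall f, f \in K -> automorph mu f.

Local Notation cut := (cut mu).
Local Notation rk := (rk mu).
Local Notation conn := (conn mu).
Local Notation is_comp := (is_comp mu).
Local Notation TT := [set: T].
Local Notation deg x := (cut [set x] TT).

Hypothesis cT : conn TT.
Hypothesis rkT : rk TT = g.
Hypothesis g2 : 2 <= g.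
Hypothesis deg2 : forall x, 2 <= deg x.

Let T0 : TT != set0.
Proof.
apply/negP => /eqP E; have : #|TT| = 0 by rewrite E cards0.
by move: rkT; rewrite /rk => + h; rewrite h /cut E big_set0; lia.
Qed.

Lemma sum_setT (E : T -> nat) : \sum_(x in TT) E x = \sum_x E x.
Proof. by apply: eq_bigl => x; rewrite inE. Qed.

Lemma imT (f : {perm T}) : f @: TT = TT.
Proof. by apply/setP => x; rewrite inE; apply/imsetP; exists (f^-1%g x);
  rewrite ?inE ?permKV. Qed.

Lemma sum_deg : \sum_x deg x + 2 = #|T|.*2 + g.*2.
Proof.
have := rkE mu_sym mu_irr T0 cT; rewrite rkT cardsT doubleD => <-; congr (_ + _).
by rewrite /cut sum_setT; apply: eq_bigr => x _; rewrite big_set1.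
Qed.

Lemma deg_aut f x : f \in K -> deg (f x) = deg x.
Proof. by move=> fK; rewrite -imset_set1 -{1}(imT f) cut_aut //; apply: aK. Qed.

Lemma deg3_ex : exists v, 3 <= deg v.
Proof.
have [v|h] := pickP (fun v => 3 <= deg v); first by exists v.
have : \sum_x deg x <= \sum_(x : T) 2.
  by apply: leq_sum => x _; rewrite leqNgt h.
by rewrite sum_nat_const; have := sum_deg; rewrite cardT; lia.
Qed.

Lemma fixT (f : {perm T}) (H : {group {perm T}}) : f \in 'C_H(TT | 'P) -> f = 1%g.
Proof. by case/fixP => _ h; apply/permP => x; rewrite perm1 h. Qed.

Lemma card_fixT (H : {group {perm T}}) : #|'C_H(TT | 'P)| = 1.
Proof.
have -> : 'C_H(TT | 'P) = 1%G :> {set {perm T}}; last by rewrite cards1.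
by apply/eqP; rewrite eqEsubset sub1G andbT; apply/subsetP => f /fixT ->; rewrite inE.
Qed.
Lemma fixed_bound v : (forall f, f \in K -> f v = v) -> #|K| <= bsize g.
Proof.
move=> Kv; have := pinned_bound mu_sym mu_irr cT (S := [set v]) (K := K) aK.
rewrite card_fixT muln1 rkT; apply.
- by move=> f _; apply: imT.
- by apply/set0Pn; exists v; rewrite inE.
- exact: subsetT.
- by move=> f x fK; rewrite inE => /eqP ->; apply: Kv.
by move=> x _ _.
Qed.
(** Seen from w, everything that hangs at u away from w is on the side of u. *)
Lemma comp_absorb u w X A : is_comp (TT :\ u) X -> w \notin X -> w != u ->
  is_comp (TT :\ w) A -> u \in A -> u |: X \subset A.
Proof.
move=> hX wX wu hA uA; rewrite subUset sub1set uA /=.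
have uT : u \in TT by rewrite inE.
have [X0 XU cX clX] := hX; have [_ _ _ clA] := hA.
have /set0Pn[y] := nbrs_neq0 (comp_cut_gt0 mu_sym uT cT hX).
rewrite inE => /andP[yX uy].
have XW : X \subset TT :\ w.
  by apply/subsetP => z zX; rewrite !inE andbT; apply: contraNneq wX => <-.
apply: (cX _ y) => //.
  by apply: (clA u) => //; [rewrite !inE eq_sym wu|apply: (subsetP XW)].
by move=> a b aA aX bX ab; apply: (clA a) => //; apply: (subsetP XW).
Qed.
(** All leaves of the rest are at v, so its rank is at least half the number of
    its edges at v. *)
Lemma rest_deg v M : is_comp (TT :\ v) M ->
  cut [set v] (TT :\: M) <= (rk (TT :\: M)).*2.
Proof.
move=> hM; have vT : v \in TT by rewrite inE.
set P := TT :\: M; have vP : v \in P := comp_rest_in vT hM.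
have P0 : P != set0 by apply/set0Pn; exists v.
have eP := rkE mu_sym mu_irr P0 (comp_rest_conn mu_sym vT cT hM).
have : cut [set v] P + #|P :\ v|.*2 <= cut P P.
  have -> : cut P P = cut [set v] P + \sum_(x in P :\ v) cut [set x] P.
    rewrite {1}/cut (big_setD1 v) //= cut1l; congr (_ + _).
    by apply: eq_bigr => x _; rewrite cut1l.
  rewrite leq_add2l -muln2 -sum_nat_const; apply: leq_sum => x.
  rewrite !inE andbT => /andP[xv xM]; have := deg2 x.
  by rewrite (deg_rest mu_sym hM) // !inE andbT.
by have := cardsD1 v P; rewrite vP; lia.
Qed.

Section Orbit.
Variable v : T.
Let O := orbit 'P K v.
Hypothesis n2 : 2 <= #|O|.
Hypothesis dv : 3 <= deg v.
Hypothesis vmin : forall x, 3 <= deg x -> #|O| <= #|orbit 'P K x|.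

Let vO : v \in O. Proof. exact: orbit_refl. Qed.

Let KO f x : f \in K -> (f x \in O) = (x \in O).
Proof.
move=> fK; apply/orbit_ptP/orbit_ptP => -[h hK E].
  by exists (h * f^-1)%g; rewrite ?groupM ?groupV // permM -E permK.
by exists (h * f)%g; rewrite ?groupM // permM -E.
Qed.

Let main_ex : exists u A, [/\ u \in O, is_comp (TT :\ u) A & O :\ u \subset A].
Proof.
pose good := exists u A, [/\ u \in O, is_comp (TT :\ u) A & O :\ u \subset A].
suff H k : good \/ exists u A, [/\ u \in O, is_comp (TT :\ u) A & k <= #|A :&: O|].
  have [//|[u [A [uO [_ AU _ _] h]]]] := H #|O|.
  have E : A :&: O = O by apply/eqP; rewrite eqEcard subsetIr h.
  have uA : u \in A by have : u \in A :&: O; [rewrite E|rewrite inE => /andP[]].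
  by have := subsetP AU u uA; rewrite !inE eqxx.
elim: k => [|k [|[u [A [uO hA h]]]]]; last 1 first.
- have [OA|] := boolP (O :\ u \subset A); first by left; exists u, A.
  case/subsetPn => w; rewrite !inE => /andP[wu wO] wA.
  have uw : u \in TT :\ w by rewrite !inE andbT eq_sym.
  have [A' hA' uA'] := is_comp_ex mu_sym uw.
  right; exists w, A'; split => //.
  have sub := comp_absorb hA wA wu hA' uA'.
  have uA : u \notin A by apply: comp_notin hA.
  apply: (@leq_trans #|(u |: A) :&: O|); last by apply: subset_leq_card; apply: setSI.
  rewrite setIUl (setIidPl _) ?sub1set // cardsU1 inE (negbTE uA) /=.
  by rewrite ltnS.
- right; exists v; have /set0Pn[x xv] : TT :\ v != set0.
    rewrite -card_gt0; apply: leq_trans (_ : 0 < #|O :\ v|) _.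
      by have := n2; rewrite (cardsD1 v O) vO; lia.
    by apply: subset_leq_card; apply: setSD; apply: subsetT.
  by have [A hA _] := is_comp_ex mu_sym xv; exists A.
by left.
Qed.

Lemma deg_orbit u : u \in O -> deg u = deg v.
Proof. by move=> /orbit_ptP[f fK ->]; apply: deg_aut. Qed.

Lemma deg_notO : \sum_(u in ~: O) deg u + #|O| * deg v + 2 =
  #|~: O|.*2 + #|O|.*2 + g.*2.
Proof.
have E : \sum_x deg x = \sum_(u in ~: O) deg u + #|O| * deg v.
  rewrite (bigID (mem O)) /= addnC; congr (_ + _).
    by apply: eq_bigl => x; rewrite inE.
  by rewrite (eq_bigr (fun=> deg v)) ?sum_nat_const // => u /deg_orbit.
by have := sum_deg; rewrite E; have := cardsC O; lia.
Qed.

(** A component of the complement of a member u of the orbit that contains as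
    many members as possible contains all but u: by [comp_absorb], one that
    misses w is properly contained, together with u, in a component of the
    complement of w. *)
Lemma main_comp : exists M, is_comp (TT :\ v) M /\ O :\ v \subset M.
Proof.
have [u [A [/orbit_ptP[f fK uE] hA OA]]] := main_ex.
have fK' : f^-1%g \in K by rewrite groupV.
exists (f^-1%g @: A); split.
  have := is_comp_aut (aK fK') hA; congr (is_comp _ _); apply/setP => x.
  rewrite !inE andbT; apply/imsetP/idP => [[y]|xv].
    by rewrite !inE andbT => yu ->; rewrite -(inj_eq (@perm_inj _ f)) permKV -uE.
  by exists (f x); rewrite ?permK // !inE andbT uE (inj_eq perm_inj).
apply/subsetP => x; rewrite !inE => /andP[xv xO]; apply/imsetP; exists (f x); rewrite ?permK //.
by apply: (subsetP OA); rewrite !inE KO // xO uE (inj_eq perm_inj) xv.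
Qed.

Definition carry u : {perm T} := odflt 1%g [pick f in K | f v == u].

Let carryP u : u \in O -> carry u \in K /\ carry u v = u.
Proof.
move=> /orbit_ptP[f fK E]; rewrite /carry; case: pickP => [h /andP[hK /eqP] //|].
by move/(_ f); rewrite fK E eqxx.
Qed.

Section MainComponent.
Variable M : {set T}.
Hypotheses (hM : is_comp (TT :\ v) M) (OM : O :\ v \subset M).
Let P0 := TT :\: M.
Let P u := carry u @: P0.
Let a := cut [set v] M.
Let p := rk P0.
Let c := rk M.
Let n := #|O|.
Let vT : v \in TT. Proof. by rewrite inE. Qed.

Let hMu u : u \in O -> is_comp (TT :\ u) (carry u @: M) /\ O :\ u \subset carry u @: M.
Proof.
move=> uO; have [tK tv] := carryP uO; split.
  have := is_comp_aut (aK tK) hM; congr (is_comp _ _); apply/setP => x.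
  rewrite !inE andbT; apply/imsetP/idP => [[y]|xu].
    by rewrite !inE andbT => yv ->; rewrite -{2}tv (inj_eq perm_inj).
  by exists ((carry u)^-1%g x); rewrite ?permKV // !inE andbT -(inj_eq (@perm_inj _ (carry
    u))) permKV tv.
apply/subsetP => x; rewrite !inE => /andP[xu xO]; apply/imsetP; exists ((carry u)^-1%g x);
  rewrite ?permKV //.
apply: (subsetP OM); rewrite !inE KO ?groupV // xO andbT.
by rewrite -(inj_eq (@perm_inj _ (carry u))) permKV tv.
Qed.

Let PE u : P u = TT :\: carry u @: M.
Proof.
apply/setP => x; rewrite !inE andbT; apply/imsetP/idP => [[y]|xM].
  by rewrite !inE andbT => yM ->; rewrite mem_imset //; apply: perm_inj.
exists ((carry u)^-1%g x); rewrite ?permKV // !inE andbT; apply: contra xM => h.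
by apply/imsetP; exists ((carry u)^-1%g x); rewrite ?permKV.
Qed.

Let uPu u : u \in O -> u \in P u.
Proof.
move=> uO; rewrite -{1}(carryP uO).2 imset_f // !inE andbT; exact: comp_notin hM.
Qed.

(** P u collects u and what hangs at u away from the other members of the orbit.
    A point of P u and P w would, by [comp_absorb], lie on the side of u seen
    from w. *)
Let P_disj u w x : u \in O -> w \in O -> x \in P u -> x \in P w -> u = w.
Proof.
move=> uO wO; rewrite !PE !inE !andbT => xMu xMw; apply/eqP; apply: contraT => uw.
have [hu Ou] := hMu uO; have [hw Ow] := hMu wO.
have uMw : u \in carry w @: M by apply: (subsetP Ow); rewrite !inE uw.
have wMu : w \in carry u @: M by apply: (subsetP Ou); rewrite !inE eq_sym uw.
have xu : x != u by apply: contraNneq xMw => ->.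
have xTu : x \in TT :\ u by rewrite !inE xu.
have [X hX xX] := is_comp_ex mu_sym xTu.
have wX : w \notin X.
  by apply: contraNN xMu => wX; rewrite -(is_comp_eq hX hu wX wMu).
have := comp_absorb hX wX _ hw uMw; rewrite eq_sym => /(_ uw) /subsetP /(_ x).
by rewrite (negbTE xMw) !inE xX orbT => /(_ isT).
Qed.

(** The blocks for [cut_blocks]: the sets P u, and the single points outside
    them. *)
Let h x := odflt x [pick u in O | x \in P u].

Let hP u x : u \in O -> (h x == u) = (x \in P u).
Proof.
move=> uO; rewrite /h; case: pickP => [w /andP[wO xw]|nx] /=.
  by apply/eqP/idP => [<- //|xu]; apply: P_disj xw xu.
have nxu := nx u; rewrite uO /= in nxu; rewrite nxu; apply/eqP => E.
by rewrite E uPu in nxu.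
Qed.

Let hN u : u \in h @: TT -> u \notin O -> h @^-1: [set u] = [set u].
Proof.
move=> /imsetP[x _ uE] uO; apply/setP => y; rewrite !inE.
have hh z : h z \notin O -> h z = z by rewrite /h; case: pickP => [w /andP[->]|].
apply/eqP/eqP => [E|->]; first by rewrite -E hh ?E.
have ux : h x = x by apply: hh; rewrite -uE.
by rewrite uE ux.
Qed.

Let O_h : O \subset h @: TT.
Proof.
by apply/subsetP => u uO; apply/imsetP; exists u; rewrite ?inE //; apply/esym/eqP;
  rewrite hP ?uPu.
Qed.

Let rest := h @: TT :\: O.

Let sum_blocks (E : T -> nat) :
  \sum_x E x = \sum_(u in O) \sum_(x in P u) E x + \sum_(u in rest) E u.
Proof.
rewrite -sum_setT (partition_big_imset h) (big_setID O) /= (setIidPr O_h).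
congr (_ + _); apply: eq_bigr => u; first by move=> uO; apply: eq_bigl => x; rewrite inE hP.
rewrite inE => /andP[uO uh]; rewrite (big_pred1 u) // => x.
by move/setP/(_ x): (hN uh uO); rewrite !inE.
Qed.

Let cardP u : #|P u| = #|P0|. Proof. by rewrite card_imset //; apply: perm_inj. Qed.

Let vP0 : v \in P0. Proof. exact: comp_rest_in hM. Qed.
Let cP0 : conn P0. Proof. exact: (comp_rest_conn mu_sym vT cT hM). Qed.
Let eP0 : cut P0 P0 + 2 = (#|P0| + p).*2.
Proof. by apply: rkE => //; apply/set0Pn; exists v. Qed.

Let cardT : #|T| = n * #|P0| + #|rest|.
Proof.
have := sum_blocks (fun=> 1); rewrite !sum1_card => ->; congr (_ + _).
by rewrite (eq_bigr (fun=> #|P0|)) ?sum_nat_const // => u _; rewrite sum1_card cardP.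
Qed.

Let deg_P u : u \in O -> \sum_(x in P u) deg x = cut P0 P0 + a.
Proof.
move=> uO; have [tK _] := carryP uO.
rewrite big_imset /=; last by move=> ? ? _ _; apply: perm_inj.
rewrite (eq_bigr (fun x => deg x)); last by move=> x _; apply: deg_aut.
rewrite -[a](comp_cut_rest mu_sym vT hM) -cutUr ?comp_split_disj //.
rewrite -(comp_splitE hM) /cut; apply: eq_bigr => x _.
by rewrite big_set1.
Qed.

Let rank_split : g + 1 = p + c + a.
Proof. by rewrite -rkT (comp_rk mu_sym mu_irr vT cT hM). Qed.

Let a_gt0 : 0 < a. Proof. exact: (comp_cut_gt0 mu_sym vT cT hM). Qed.

Let sum_rest : n * (p.*2 + a) + \sum_(u in rest) deg u + 2 =
  n.*2 + #|rest|.*2 + g.*2.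
Proof.
have := sum_deg; rewrite sum_blocks.
rewrite (eq_bigr (fun=> cut P0 P0 + a)) ?sum_nat_const; last exact: deg_P.
rewrite cardT -/n; have : n * (cut P0 P0 + 2) = n * (#|P0| + p).*2 by rewrite eP0.
by move: (\sum_(u in rest) _) => s; lia.
Qed.

Let rest_ge (Q : {set T}) : #|Q|.*2 <= \sum_(u in Q) deg u.
Proof. by rewrite -muln2 -sum_nat_const; apply: leq_sum. Qed.

(** Sum of (degree - 2) over all nodes: each P u contributes 2p + a - 2 and no
    other node contributes a negative number. *)
Let degree_count : n * (p.*2 + a) <= g.*2 - 2 + n.*2.
Proof. by have := sum_rest; have := rest_ge rest; lia. Qed.

(** The translates P u are disjoint and have rank p, so [cut_blocks] bounds the
    sum of their ranks. *)
Let rank_count : n * p <= g.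
Proof.
have := cut_blocks mu_sym h T0 cT; rewrite (big_setID O) /= (setIidPr O_h).
rewrite (eq_bigr (fun=> cut P0 P0 + 2)); last first.
  move=> u uO; rewrite setTI; have -> : h @^-1: [set u] = P u.
    by apply/setP => x; rewrite !inE hP.
  by rewrite cut_aut //; apply: aK; have [] := carryP uO.
rewrite sum_nat_const [X in _ + X](eq_bigr (fun=> 2)); last first.
  by move=> u; rewrite inE => /andP[uO uh]; rewrite setTI hN // cut11 mu_irr.
rewrite sum_nat_const (rkE mu_sym mu_irr T0 cT) rkT cardsT cardT eP0 -/rest -/n; lia.
Qed.

Let degP0v : cut [set v] P0 <= p.*2. Proof. exact: rest_deg hM. Qed.

Let deg_v : deg v = cut [set v] P0 + a. Proof. exact: deg_root hM. Qed.

(** The degree of v is at most 2p + a. *)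
Let degree_ge3 : 3 <= p.*2 + a.
Proof. by have := degP0v; have := deg_v; lia. Qed.

(** Here v has degree 3, so its orbit accounts for g of the total excess 2g - 2
    of the degrees over 2. The remaining excess g - 2 is positive and sits at
    nodes outside the orbit; any of them has a nonempty orbit of at most g - 2 <
    n branch nodes. *)
Let no_lollipop : [&& a == 1, p == 1, n == g & 3 <= g] -> False.
Proof.
case/and4P => /eqP a1 /eqP p1 /eqP ng g3.
(* deg v = cut v P0 + a <= 2p + a = 3. *)
have dv3 : deg v = 3 by have := degP0v; have := deg_v; have := dv; lia.
have /existsP[x /andP[xO dx]] : [exists x, (x \notin O) && (3 <= deg x)].
  apply: contraT => /existsPn H.
  have : \sum_(u in ~: O) deg u <= #|~: O| * 2.
    rewrite -sum_nat_const; apply: leq_sum => u; rewrite inE => uO.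
    by have := H u; rewrite uO /= -leqNgt.
  by have := deg_notO; rewrite dv3 -/n ng; lia.
have := vmin dx; rewrite -/O -/n ng.
pose O' := orbit 'P K x.
have O'O : O' \subset ~: O.
  apply/subsetP => _ /orbit_ptP[f fK ->]; by rewrite inE KO.
have : #|O'| * 3 + #|~: O :\: O'|.*2 <= \sum_(u in ~: O) deg u.
  rewrite (big_setID O') /= (setIidPr O'O); apply: leq_add; last exact: rest_ge.
  rewrite -sum_nat_const; apply: leq_sum => _ /orbit_ptP[f fK ->].
  by rewrite deg_aut.
have := cardsD (~: O) O'; rewrite (setIidPr O'O).
have := subset_leq_card O'O; rewrite -/O'.
by have := deg_notO; rewrite dv3 -/n ng; lia.
Qed.

Let K1 := 'C_K[v | 'P]%G.
Let N := nbrs mu v M.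
Let L := 'C_K1(P0 | 'P)%G.

Let K1K f : f \in K1 -> f \in K. Proof. by case/stab_ptP. Qed.
Let K1v f : f \in K1 -> f v = v. Proof. by case/stab_ptP. Qed.
Let K1M f : f \in K1 -> f @: M = M.
Proof.
move=> fK1; have [fK fv] := stab_ptP _ _ _ fK1.
have hf : is_comp (TT :\ v) (f @: M).
  have := is_comp_aut (aK fK) hM; congr (is_comp _ _); apply/setP => x.
  rewrite !inE andbT; apply/imsetP/idP => [[y]|xv].
    by rewrite !inE andbT => yv ->; rewrite -{1}fv (inj_eq perm_inj).
  by exists (f^-1%g x); rewrite ?permKV // !inE andbT -(inj_eq (@perm_inj _ f)) permKV fv.
have [u uO uv] : exists2 u, u \in O & u != v.
  have /set0Pn[u] : O :\ v != set0.
    by rewrite -card_gt0; have := n2; rewrite (cardsD1 v O) vO; lia.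
  by rewrite !inE => /andP[]; exists u.
have uM : u \in M by apply: (subsetP OM); rewrite !inE uv.
apply: (is_comp_eq hf hM (x := u)) => //.
apply/imsetP; exists (f^-1%g u); rewrite ?permKV //.
apply: (subsetP OM); rewrite !inE KO ?groupV // uO andbT.
by rewrite -(inj_eq (@perm_inj _ f)) permKV fv.
Qed.

Let cardL : #|L| <= #|N|`! * bsize c.
Proof.
have pM : pinned_at mu M by apply: pinned_bound.
apply: leq_trans (inside_bound (K := L) (S := set0) mu_sym vT cT hM pM _ _ _ _ _) _.
- by move=> f /fixP[/K1K /aK].
- by move=> f /fixP[/K1M].
- by move=> f /fixP[/K1v].
- by move=> f x _; rewrite inE.
- by move=> x _ _.
rewrite leq_mul2l -[X in _ <= X]muln1 leq_mul2l; apply/orP; right; apply/orP; right.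
rewrite -(card_fixT K); apply: subset_leq_card; apply/subsetP => f /fixP[/fixP[fK1 fP] fM].
apply/fixP; split; first exact: K1K.
by move=> x _; have [/fM //|xM] := boolP (x \in M); apply: fP; rewrite !inE xM.
Qed.

Let cardK1 : #|K1| <= bsize p * #|L|.
Proof.
apply: (pinned_bound mu_sym mu_irr cP0 (S := [set v]) (K := K1)).
- by move=> f /K1K /aK.
- move=> f fK1; apply/eqP; rewrite eqEcard card_imset ?leqnn ?andbT; last exact: perm_inj.
  apply/subsetP => _ /imsetP[x xP ->]; move: xP; rewrite !inE !andbT; apply: contra.
  by rewrite -{1}(K1M fK1) mem_imset //; apply: perm_inj.
- by apply/set0Pn; exists v; rewrite inE.
- by rewrite sub1set.
- by move=> f x /K1v fv; rewrite inE => /eqP ->.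
by move=> x xP; rewrite inE => xv; rewrite -(deg_rest mu_sym hM xP xv).
Qed.

Let cardN : #|N| <= a. Proof. exact: card_nbrs. Qed.

Let cardK : #|K| = n * #|K1|. Proof. by rewrite -(card_orbit_stab 'P K v). Qed.

Let le1 : #|K1| <= bsize p * (#|N|`! * bsize c).
Proof. by apply: leq_trans cardK1 _; rewrite leq_mul2l cardL orbT. Qed.

Let le2 : bsize p * (#|N|`! * bsize c) <= bsize p * (a`! * bsize c).
Proof. by rewrite leq_mul2l leq_mul2r (leq_fact cardN) !orbT. Qed.

Lemma moving_bound : #|K| <= bound g.
Proof.
rewrite cardK; apply: leq_trans (ubound_le a_gt0 g2 n2 rank_split degree_count rank_count
  degree_ge3 no_lollipop).
by rewrite leq_mul2l (leq_trans le1 le2) orbT.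
Qed.

Lemma P0_rank0 : p = 0 -> M = TT :\ v.
Proof.
move=> p0; have : cut [set v] P0 == 0 by have := degP0v; rewrite p0; lia.
move=> /cut0P nv; have P1 : P0 \subset [set v].
  apply: (cP0 (x := v)) => [|//|x y]; first by rewrite inE.
  by rewrite inE => /eqP -> _ yP; rewrite (nv _ _ (set11 v) yP).
apply/eqP; rewrite eqEsubset; apply/andP; split; first by case: hM.
apply/subsetP => x; rewrite !inE andbT; apply: contraNT => xM.
by have := subsetP P1 x; rewrite !inE xM => /(_ isT).
Qed.
(** Equality forces p = 0, so nothing hangs at v, and forces the stabiliser of v
    to induce all permutations of the neighbours of v. The last case is that of
    four branch nodes of degree 3, where some automorphism fixes v and its
    neighbours. *)
Lemma moving_eq : #|K| = bound g ->
  [/\ M = TT :\ v, cut [set v] M = #|nbrs mu v M|,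
      forall x y, x \in nbrs mu v M -> y \in nbrs mu v M ->
        exists f, [/\ f \in K, f v = v, f x = y, f y = x &
          forall z, z \in nbrs mu v M -> z != x -> z != y -> f z = z]
    & [/\ rk M = 0, #|O| = 2, cut [set v] M = g.+1 & g \in [:: 2; 3]] \/
      [/\ rk M = 1, #|O| = 4, cut [set v] M = 3, g = 3 &
        exists f, [/\ f \in K, f v = v, forall x, x \in nbrs mu v M -> f x = x & f != 1%g] ]].
Proof.
move=> E.
have S : n * (bsize p * (a`! * bsize c)) = bound g.
  apply/eqP; rewrite eqn_leq (ubound_le a_gt0 g2 n2 rank_split degree_count rank_count
    degree_ge3 no_lollipop) -E cardK.
  by rewrite leq_mul2l (leq_trans le1 le2) orbT.
have K1E : #|K1| = bsize p * (a`! * bsize c).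
  by apply/eqP; rewrite -(@eqn_pmul2l n) -?cardK ?E ?S //; apply: ltnW.
have [p0 a3 cc] : [/\ p = 0, 3 <= a &
  [/\ c = 0, n = 2, a = g.+1 & g \in [:: 2; 3]] \/ [/\ c = 1, n = 4, a = 3 & g = 3]].
  case: (ubound_eq a_gt0 g2 n2 rank_split degree_count rank_count degree_ge3 no_lollipop S)
    => [[pE cE nE aE gg]|[pE cE nE aE gE]].
    by split => //; [lia|left].
  by split => //; [lia|right].
have aN : a = #|N|.
  apply/eqP; rewrite eqn_leq cardN andbT leqNgt; apply/negP => lt.
  have : #|N|`! < a`!.
    have [->|N0] := posnP #|N|; last exact: ltn_fact.
    by rewrite fact0; case: (a) a3 => [|[|[|k]]] // _; rewrite !factS; have := fact_gt0 k; lia.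
  have := le1; rewrite K1E leq_pmul2l ?bsize_gt0 // leq_pmul2r ?bsize_gt0 //; lia.
have LK : L = K1 :> {set _}.
  apply/eqP; rewrite eqEsubset fix_sub; apply/subsetP => f fK1; apply/fixP; split => // x xP.
  have : x \notin TT :\ v by rewrite -P0_rank0 //; move: xP; rewrite inE => /andP[].
  by rewrite !inE andbT negbK => /eqP ->; apply: K1v.
split; first exact: P0_rank0.
- exact: aN.
- move=> x y xN yN.
  have K1N f : f \in K1 -> f @: N = N.
    by move=> fK1; apply: nbrs_aut; [apply/aK/K1K|apply: K1v|apply: K1M].
  have CN : #|'C_K1(N | 'P)| <= bsize c.
    have := pinned_bound mu_sym mu_irr (W := M) _ (S := N) (K := 'C_K1(N | 'P)%G).
    have [_ _ cM _] := hM; move=> /(_ cM) H; apply: leq_trans (H _ _ _ _ _ _) _.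
    - by move=> f /fixP[/K1K /aK].
    - by move=> f /fixP[/K1M].
    - exact: nbrs_neq0 a_gt0.
    - by apply/subsetP => z; rewrite inE => /andP[].
    - by move=> f z /fixP[_]; apply.
    - move=> z zM; rewrite !inE zM /= -leqNgt leqn0 => /eqP vz.
      by have := deg2 z; rewrite (deg_comp mu_sym vT hM) // vz addn0.
    rewrite -[X in _ <= X]muln1 leq_mul2l; apply/orP; right.
    rewrite -(card_fixT K); apply: subset_leq_card; apply/subsetP => f /fixP[/fixP[fK1 _] fM].
    apply/fixP; split; first exact: K1K.
    move=> z _; have [zv|zv] := eqVneq z v; first by rewrite zv K1v.
    by apply: fM; rewrite P0_rank0 // !inE zv.
  have [|f [fK1 fx fy fz]] := fix_index_full K1N _ xN yN.
    by rewrite K1E p0 aN; have -> : bsize 0 = 1 by []; rewrite mul1n leq_mul2l CN orbT.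
  by exists f; split; [apply: K1K|apply: K1v| | |].
case: cc => [[c0 nE aE gg]|[c0 nE aE gg]]; [by left|right; split => //].
have [f fN f1] : exists2 f, f \in 'C_K1(N | 'P) & f != 1%g.
  have K1N f : f \in K1 -> f @: N = N.
    by move=> fK1; apply: nbrs_aut; [apply/aK/K1K|apply: K1v|apply: K1M].
  have := fix_index K1N; rewrite K1E p0 aN c0; have -> : bsize 0 = 1 by [].
  have -> : bsize 1 = 2 by [].
  rewrite mul1n leq_pmul2l ?fact_gt0 // => C2.
  have /subsetPn[f fC] : ~~ ('C_K1(N | 'P) \subset [set 1%g]).
    by apply/negP => /subset_leq_card; rewrite cards1 leqNgt C2.
  by rewrite inE => f1; exists f.
by exists f; case/fixP: fN => fK1 fN; split; [apply: K1K|apply: K1v| |].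
Qed.

End MainComponent.
End Orbit.
End BranchOrbit.

(** * Arcs, and four branch nodes of degree three *)

Section Arcs.
Variables (T : finType) (mu : T -> T -> nat).
Hypothesis mu_sym : forall x y, mu x y = mu y x.
Hypothesis mu_irr : forall x, mu x x = 0.
Local Notation cut := (cut mu).
Local Notation rk := (rk mu).
Local Notation conn := (conn mu).
Local Notation is_comp := (is_comp mu).
Local Notation TT := [set: T].
Local Notation deg x := (cut [set x] TT).
Implicit Types (A B C O S : {set T}).

(** The bound of [pinned_bound] is 1 for a tree. *)
Lemma pinned_rank0 (H : {group {perm T}}) A S : conn A -> rk A = 0 ->
  (forall f, f \in H -> automorph mu f) -> (forall f, f \in H -> f @: A = A) ->
  S != set0 -> S \subset A -> (forall f x, f \in H -> x \in S -> f x = x) ->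
  (forall x, x \in A -> x \notin S -> 2 <= cut [set x] A) ->
  forall f x, f \in H -> x \in A -> f x = x.
Proof.
move=> cA r0 aH HA S0 SA HS dA f x fH xA.
have := pinned_bound mu_sym mu_irr cA aH HA S0 SA HS dA.
rewrite r0 mul1n => h; have E : 'C_H(A | 'P) = H by apply/eqP; rewrite eqEcard fix_sub.
by move: fH; rewrite -E => /fixP[_ /(_ x xA)].
Qed.

Lemma disjD A B : [disjoint A & B :\: A].
Proof. by rewrite -setI_eq0 setDE setICA setICr setI0. Qed.

Lemma cut_setC A B : cut A TT = cut A B + cut A (~: B).
Proof. by rewrite -cutUr ?setUCr // -setI_eq0 setICr. Qed.

Lemma cut_sum_deg A : cut A TT = \sum_(x in A) deg x.
Proof. by rewrite /cut; apply: eq_bigr => x _; rewrite big_set1. Qed.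

Lemma deg2_card A : (forall x, x \in A -> deg x = 2) -> cut A TT = #|A|.*2.
Proof.
by move=> h; rewrite cut_sum_deg (eq_bigr (fun=> 2)) ?sum_nat_const ?muln2.
Qed.
Lemma comp_cutC O A : is_comp (~: O) A -> cut A (~: O) = cut A A.
Proof.
case=> _ AU _ clA.
have E : ~: O = A :|: (~: O :\: A) by rewrite -{1}(setID (~: O) A) (setIidPr AU).
rewrite {1}E cutUr ?disjD //.
suff /eqP -> : cut A (~: O :\: A) == 0 by rewrite addn0.
apply/cut0P => x y xA; rewrite inE => /andP[yA yO]; apply/eqP; rewrite -leqn0 leqNgt.
by apply: contraNN yA => h; apply: (clA x) => //; apply: (subsetP AU).
Qed.

Lemma boundary_gt0 O A : conn TT -> O != set0 -> is_comp (~: O) A -> 0 < cut A O.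
Proof.
move=> cT /set0Pn[o oO] hA; rewrite lt0n; apply/negP => /cut0P h.
have [/set0Pn[x xA] AU _ clA] := hA.
have : TT \subset A.
  apply: (cT _ x) => // y z yA _ _ yz; apply: (clA y) => //; first exact: (subsetP AU).
  by rewrite inE; apply/negP => zO; rewrite (h y z) in yz.
move/subsetP/(_ o); rewrite inE => /(_ isT) oA.
by have := subsetP AU o oA; rewrite inE oO.
Qed.

(** A component of the complement of O all of whose nodes have degree 2 is a
    path with both ends at O: its degree sum 2 #A is at least 2 (#A - 1) plus
    the number of edges to O, and that number is even and positive. *)
Lemma arc_facts O A : conn TT -> O != set0 -> is_comp (~: O) A ->
  (forall x, x \in A -> deg x = 2) -> rk A = 0 /\ cut A O = 2.
Proof.
move=> cT O0 hA d2; have := boundary_gt0 cT O0 hA.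
have := deg2_card d2; rewrite (cut_setC A O) comp_cutC //.
have [A0 _ cA _] := hA; have := rkE mu_sym mu_irr A0 cA; lia.
Qed.

Lemma leq_cut A B A' B' : A \subset A' -> B \subset B' -> cut A B <= cut A' B'.
Proof.
move=> AA BB; rewrite /cut (big_setID A) [X in _ <= X](big_setID A) /= !(setIidPr AA) setIid
  setDv big_set0 addn0.
apply: leq_trans (leq_addr _ _); apply: leq_sum => x _.
by rewrite [X in _ <= X](big_setID B) /= (setIidPr BB) leq_addr.
Qed.

Lemma cut_ge2 A B (x y z : T) : x \in B -> y \in A -> z \in A -> y != z ->
  mu y x + mu z x <= cut A B.
Proof.
move=> xB yA zA yz; apply: (@leq_trans (cut [set y; z] [set x])).
  by rewrite cutUl ?disjoints1 ?inE // !cut11.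
by apply: leq_cut; rewrite ?subUset ?sub1set ?yA.
Qed.

Lemma pos_sum_eq2 u x r : u + (x + r) = 2 -> 0 < u -> 0 < x -> [/\ u = 1, x = 1 & r = 0].
Proof. by clear; move=> *; split; lia. Qed.

Section Cubic.
Variables (K : {group {perm T}}) (O : {set T}).
Hypothesis aK : forall f, f \in K -> automorph mu f.
Hypothesis cT : conn TT.
Hypothesis O4 : #|O| = 4.
Hypothesis KO : forall f x, f \in K -> (f x \in O) = (x \in O).
Hypothesis cO : forall u, u \in O -> conn (TT :\ u).
Hypothesis dO : forall u, u \in O -> deg u = 3.
Hypothesis nO : forall u, u \in O -> #|nbrs mu u TT| = 3.
Hypothesis d2 : forall x, x \notin O -> deg x = 2.
Hypothesis Oind : forall u w, u \in O -> w \in O -> mu u w = 0.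
Hypothesis symO : forall u x y, u \in O -> x \in nbrs mu u TT -> y \in nbrs mu u TT ->
  exists f, [/\ f \in K, f u = u, f x = y, f y = x &
          forall z, z \in nbrs mu u TT -> z != x -> z != y -> f z = z].

Variable comp : T -> {set T}.
Hypothesis isc : forall y, y \notin O -> is_comp (~: O) (comp y).
Hypothesis yc : forall y, y \in comp y.

Let O0 : O != set0. Proof. by rewrite -card_gt0 O4. Qed.

Let nbr_notO u y : u \in O -> y \in nbrs mu u TT -> y \notin O.
Proof.
by move=> uO; rewrite !inE => /= uy; apply/negP => yO; rewrite Oind in uy.
Qed.

Let arc y : y \notin O -> rk (comp y) = 0 /\ cut (comp y) O = 2.
Proof.
move=> yO; apply: (arc_facts cT O0 (isc yO)) => x xA; apply: d2.
by have [_ /subsetP /(_ x xA) + _ _] := isc yO; rewrite inE.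
Qed.

Let comp_img f y : f \in K -> y \notin O -> f @: comp y = comp (f y).
Proof.
move=> fK yO; have := is_comp_aut (aK fK) (isc yO).
have -> : f @: (~: O) = ~: O.
  apply/eqP; rewrite eqEcard card_imset ?leqnn ?andbT; last exact: perm_inj.
  by apply/subsetP => _ /imsetP[x xO ->]; move: xO; rewrite !inE KO.
move=> h; apply: (is_comp_eq h (isc _) (imset_f f (yc y)) (yc _)).
by rewrite KO.
Qed.
(** x is the other end of the arc that leaves u through its neighbour y. *)
Let far u y x := [&& x \in O, x != u & 0 < cut (comp y) [set x]].

(** An arc with both ends at u would be cut off by u, whose complement is
    connected. *)
Let far_ex u y : u \in O -> y \in nbrs mu u TT -> exists x, far u y x.
Proof.
move=> uO yN; have yO := nbr_notO uO yN; have [A0 AU cA clA] := isc yO.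
apply/existsP; apply: contraT => /existsPn h.
have sub : TT :\ u \subset comp y.
  apply: (cO uO (x := y)) => //.
    by rewrite !inE andbT; apply: contraNneq yO => ->.
  move=> a b aA _ bu ab; apply: (clA a) => //; first exact: (subsetP AU).
  rewrite inE; apply/negP => bO; case/negP: (h b); rewrite /far bO.
  by move: bu; rewrite !inE andbT => -> /=; apply: (cut_gt0 aA (set11 b)).
have [w] : exists w, w \in O :\ u.
  by apply/set0Pn; rewrite -card_gt0; have := O4; rewrite (cardsD1 u) uO; lia.
rewrite !inE => /andP[wu wO].
have /(subsetP AU) : w \in comp y by apply: (subsetP sub); rewrite !inE wu.
by rewrite inE wO.
Qed.

Let cut_u u y : u \in O -> y \in nbrs mu u TT -> 0 < cut (comp y) [set u].
Proof.
move=> uO; rewrite !inE /= => uy; apply: (cut_gt0 (yc y) (set11 u)).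
by rewrite mu_sym.
Qed.

Let cut_le2 u y x : u \in O -> y \in nbrs mu u TT -> far u y x ->
  [/\ cut (comp y) [set u] = 1, cut (comp y) [set x] = 1 &
      forall w, w \in O -> w != u -> w != x -> cut (comp y) [set w] = 0].
Proof.
move=> uO yN /and3P[xO xu cx]; have cu := cut_u uO yN.
have [_ c2] := arc (nbr_notO uO yN).
have E1 : O = [set u] :|: ([set x] :|: (O :\ u :\ x)).
  by rewrite setD1K ?setD1K // !inE xu.
have D1 : [disjoint [set u] & [set x] :|: (O :\ u :\ x)].
  by rewrite disjoints1 !inE eqxx andbF orbF eq_sym.
have D2 : [disjoint [set x] & O :\ u :\ x] by rewrite disjoints1 !inE eqxx.
rewrite E1 (cutUr mu_sym _ D1) (cutUr mu_sym _ D2) in c2.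
have [e1 e2 e3] := pos_sum_eq2 c2 cu cx; split => // w wO wu wx.
apply/eqP; rewrite -leqn0 -e3.
by apply: leq_cut; rewrite // sub1set !inE wu wx.
Qed.

Let far_uniq u y x x' : u \in O -> y \in nbrs mu u TT -> far u y x -> far u y x' -> x = x'.
Proof.
move=> uO yN Ex /and3P[x'O x'u cx']; have [_ _ h] := cut_le2 uO yN Ex.
by apply/eqP; apply: contraLR cx' => xx'; rewrite h // eq_sym.
Qed.

Let far_img f u y x : f \in K -> y \notin O -> far u y x -> far (f u) (f y) (f x).
Proof.
move=> fK yO /and3P[xO xu cx]; rewrite /far KO // xO (inj_eq perm_inj) xu /=.
by rewrite -comp_img // -imset_set1 cut_aut //; apply: aK.
Qed.

Let comp_neq u y y' : u \in O -> y \in nbrs mu u TT -> y' \in nbrs mu u TT ->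
  y != y' -> [disjoint comp y & comp y'].
Proof.
move=> uO yN yN' yy'; apply/pred0P => z; apply/negP => /andP[zy zy'].
have yO := nbr_notO uO yN; have yO' := nbr_notO uO yN'.
have Ec := is_comp_eq (isc yO) (isc yO') zy zy'.
have [x Ex] := far_ex uO yN; have [c1 _ _] := cut_le2 uO yN Ex.
have y'c : y' \in comp y by rewrite Ec.
have := cut_ge2 (set11 u) (yc y) y'c yy'; rewrite c1 leqNgt.
move: yN yN'; rewrite !inE /= ![mu u _]mu_sym => h h'.
by rewrite (leq_add h h').
Qed.

(** Suppose two arcs lead from u to the same x. A transposition of the
    neighbours of u shows that the third arc does so too; then u, x and the
    three arcs are closed under adjacency and make up the whole graph, which
    leaves no room for four branch nodes. *)
Let far_inj u y y' x : u \in O -> y \in nbrs mu u TT -> y' \in nbrs mu u TT ->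
  far u y x -> far u y' x -> y = y'.
Proof.
move=> uO yN yN' Ex Ex'; apply/eqP; apply: contraT => yy'; exfalso.
have [y'' y''N [n1 n2]] : exists2 z, z \in nbrs mu u TT & z != y /\ z != y'.
  have : 0 < #|nbrs mu u TT :\ y :\ y'|.
    have := nO uO; rewrite (cardsD1 y) yN (cardsD1 y') !inE eq_sym yy' /=.
    by move: yN'; rewrite !inE /= => ->; lia.
  by case/card_gt0P => z; rewrite !inE => /and3P[z1 z2 z3]; exists z; rewrite ?inE.
have [s [sK su sy' _ sz]] := symO uO yN' y''N.
have sy : s y = y by apply: sz => //; rewrite eq_sym.
have sx : s x = x.
  have := far_img sK (nbr_notO uO yN) Ex; rewrite su sy => h.
  exact: (far_uniq uO yN h Ex).
have Ex'' : far u y'' x by have := far_img sK (nbr_notO uO yN') Ex'; rewrite su sy' sx.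
have [c1 c2 c3] := cut_le2 uO yN Ex; have [c1' c2' c3'] := cut_le2 uO yN' Ex'.
have [c1'' c2'' c3''] := cut_le2 uO y''N Ex''.
have /and3P[xO xu _] := Ex.
pose A := comp y :|: comp y' :|: comp y''.
have xA : cut [set x] A = 3.
  rewrite /A cutUr ?cutUr ?(cutC mu_sym [set x]) ?c2 ?c2' ?c2'' ?(comp_neq uO) //.
  rewrite -setI_eq0 setIUl setU_eq0 !setI_eq0 !(comp_neq uO) // eq_sym //.
have xnA z : 0 < mu x z -> z \in A.
  move=> xz; apply: contraT => zA; have := dO xO; rewrite (cut_setC _ A) xA => e.
  have : 0 < cut [set x] (~: A) by apply: (cut_gt0 (set11 x) _ xz); rewrite inE.
  by move/eqP: e; rewrite -[X in _ == X]addn0 eqn_add2l => /eqP ->.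
have uN : nbrs mu u TT = [set y; y'; y''].
  apply/esym/eqP; rewrite eqEcard nO // !subUset !sub1set yN yN' y''N /=.
  by rewrite setUC cardsU1 cards2 !inE negb_or n1 n2 yy'.
have unA z : 0 < mu u z -> z \in A.
  move=> uz; have : z \in nbrs mu u TT by rewrite !inE.
  by rewrite uN !inE => /orP[/orP[]|] /eqP ->; rewrite yc ?orbT.
have sub : TT \subset [set u; x] :|: A.
  apply: (cT (x := u)); rewrite ?inE ?eqxx // => a b aB _ _ ab.
  move: aB; rewrite inE => /orP[|aA].
    by rewrite !inE => /orP[] /eqP aE; rewrite aE in ab; [have := unA b ab|have := xnA b ab];
      rewrite !inE => ->; rewrite !orbT.
  have [bO|bO] := boolP (b \in O); last first.
    suff : b \in A by rewrite !inE => ->; rewrite !orbT.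
    have cl w : w \notin O -> a \in comp w -> b \in comp w.
      move=> wO aw; have [_ AU _ clw] := isc wO; apply: (clw a) => //; rewrite ?inE //.
      by have := subsetP AU a aw; rewrite inE.
    move: aA; rewrite /A !inE => /orP[/orP[]|] h.
    - by rewrite (cl y) // (nbr_notO uO yN).
    - by rewrite (cl y') ?orbT // (nbr_notO uO yN').
    by rewrite (cl y'') ?orbT // (nbr_notO uO y''N).
  have [->|bu] := eqVneq b u; first by rewrite !inE eqxx.
  have [->|bx] := eqVneq b x; first by rewrite !inE eqxx !orbT.
  exfalso; have h w : cut (comp w) [set b] = 0 -> a \notin comp w.
    move=> c0; apply/negP => aw; by have := cut_gt0 aw (set11 b) ab; rewrite c0.
  move: aA; rewrite !inE; have := h y (c3 b bO bu bx); have := h y' (c3' b bO bu bx).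
  by have := h y'' (c3'' b bO bu bx) => /negbTE -> /negbTE -> /negbTE ->.
have : O \subset [set u; x].
  apply/subsetP => w wO; have := subsetP sub w; rewrite inE => /(_ isT).
  rewrite inE => /orP[//|]; have h z : z \notin O -> w \notin comp z.
    move=> zO; apply/negP => wz; have [_ AU _ _] := isc zO.
    by have := subsetP AU w wz; rewrite inE wO.
  have := h _ (nbr_notO uO yN); have := h _ (nbr_notO uO yN').
  by have := h _ (nbr_notO uO y''N); rewrite !inE => /negbTE -> /negbTE -> /negbTE ->.
by move/subset_leq_card; rewrite O4 cards2; case: (_ != _).
Qed.

(** By [far_inj] the three arcs at u end at the three other members of O, so
    fixing the neighbours of u fixes O. *)
Let fix_O u f : u \in O -> f \in K -> f u = u -> (forall y, y \in nbrs mu u TT -> f y = y) ->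
  forall x, x \in O -> f x = x.
Proof.
move=> uO fK fu fN x xO; have [->//|xu] := eqVneq x u.
pose X y := odflt y [pick x | far u y x].
have XP y : y \in nbrs mu u TT -> far u y (X y).
  move=> yN; rewrite /X; case: pickP => [//|h].
  by have [z] := far_ex uO yN; rewrite h.
have inX : {in nbrs mu u TT &, injective X}.
  move=> y y' yN yN' e; have h := XP y yN; have h' := XP y' yN'.
  by rewrite -e in h'; apply: (far_inj uO yN yN' h h').
have im : X @: nbrs mu u TT = O :\ u.
  apply/eqP; rewrite eqEcard card_in_imset // nO //.
  have -> : #|O :\ u| = 3 by have := O4; rewrite (cardsD1 u) uO => -[].
  rewrite leqnn andbT.
  by apply/subsetP => _ /imsetP[y /XP /and3P[h1 h2 _] ->]; rewrite !inE h1 h2.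
have : x \in X @: nbrs mu u TT by rewrite im !inE xu.
case/imsetP => y yN ->; have h := XP y yN.
have := far_img fK (nbr_notO uO yN) h; rewrite fu fN // => h'.
exact: (far_uniq uO yN h' h).
Qed.

(** All of O is fixed by [fix_O]. Two members of O are joined by at most one arc
    by [far_inj], so the neighbours of O are fixed as well; each arc is then a
    tree with its leaves pinned. *)
Lemma cubic_faithful_aux u f : u \in O -> f \in K -> f u = u ->
  (forall y, y \in nbrs mu u TT -> f y = y) -> f = 1%g.
Proof.
move=> uO fK fu fN; have fO := fix_O uO fK fu fN.
pose Q := \bigcup_(w in O) nbrs mu w TT.
have fQ x : x \in Q -> f x = x.
  case/bigcupP => w wO xN; have xO := nbr_notO wO xN.
  have [z Ez] := far_ex wO xN; have /and3P[zO _ _] := Ez.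
  have h := far_img fK xO Ez; rewrite (fO w wO) (fO z zO) in h.
  apply: (far_inj wO _ xN h Ez).
  by move: xN; rewrite !inE /= -{2}(fO w wO) aK.
pose H := 'C_K(O :|: Q | 'P)%G.
have fH : f \in H.
  by apply/fixP; split => // x; rewrite inE => /orP[/fO|/fQ].
apply/permP => x; rewrite perm1.
have [/fO //|xO] := boolP (x \in O).
have hA := isc xO; have [A0 AU cA clA] := hA; have [r0 c2] := arc xO.
have [a aA aQ] : exists2 a, a \in comp x & a \in Q.
  have /set0Pn[a] : comp x :&: Q != set0.
    apply/negP => /eqP e; have : cut (comp x) O == 0; last by rewrite c2.
    apply/cut0P => a w aA wO; apply/eqP; rewrite -leqn0 leqNgt; apply/negP => aw.
    move/setP/(_ a): e; rewrite [a \in _ :&: _]inE aA in_set0 => /negP; apply.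
    by apply/bigcupP; exists w; rewrite // !inE /= mu_sym.
  by rewrite inE => /andP[]; exists a.
have HK h : h \in H -> h \in K by case/fixP.
have HO h z : h \in H -> z \in O :|: Q -> h z = z by case/fixP => _; apply.
apply: (pinned_rank0 (H := H) cA r0 _ _ (S := comp x :&: Q)) => //.
- by move=> h /HK /aK.
- move=> h hH.
  have aO : a \notin O by have := subsetP AU a aA; rewrite inE.
  have ca := is_comp_eq hA (isc aO) aA (yc a).
  by rewrite ca comp_img ?HK // (HO h a hH) // inE aQ orbT.
- by apply/set0Pn; exists a; rewrite inE aA.
- exact: subsetIl.
- by move=> h z hH; rewrite inE => /andP[_ zQ]; apply: HO; rewrite // inE zQ orbT.
move=> z zA; rewrite inE zA /= => zQ.
have zO : z \notin O by have := subsetP AU z zA; rewrite inE.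
have := d2 zO; rewrite (cut_setC _ O) => <-.
have /eqP -> : cut [set z] O == 0.
  apply/cut0P => z' w; rewrite inE => /eqP -> wO; apply/eqP; rewrite -leqn0 leqNgt.
  apply/negP => zw; case/negP: zQ; apply/bigcupP; exists w; rewrite // !inE /= mu_sym //.
rewrite add0n; have E1 := cut_setC [set z] (comp x).
have -> : cut [set z] (~: O) = cut [set z] (comp x); last by [].
have E2 : ~: O = comp x :|: (~: O :\: comp x) by rewrite -{1}(setID (~: O) (comp x))
  (setIidPr AU).
rewrite E2 cutUr ?disjD //.
suff /eqP -> : cut [set z] (~: O :\: comp x) == 0 by rewrite addn0.
apply/cut0P => z' y; rewrite inE => /eqP ->; rewrite inE => /andP[yA yO]; apply/eqP.
rewrite -leqn0 leqNgt; apply: contraNN yA => h; apply: (clA z) => //.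
by rewrite inE.
Qed.

End Cubic.

Lemma cubic_faithful (K : {group {perm T}}) O :
  (forall f, f \in K -> automorph mu f) -> conn TT -> #|O| = 4 ->
  (forall f x, f \in K -> (f x \in O) = (x \in O)) ->
  (forall u, u \in O -> conn (TT :\ u)) -> (forall u, u \in O -> deg u = 3) ->
  (forall u, u \in O -> #|nbrs mu u TT| = 3) ->
  (forall x, x \notin O -> deg x = 2) ->
  (forall u w, u \in O -> w \in O -> mu u w = 0) ->
  (forall u x y, u \in O -> x \in nbrs mu u TT -> y \in nbrs mu u TT ->
     exists f, [/\ f \in K, f u = u, f x = y, f y = x &
       forall z, z \in nbrs mu u TT -> z != x -> z != y -> f z = z]) ->
  forall u f, u \in O -> f \in K -> f u = u ->
    (forall y, y \in nbrs mu u TT -> f y = y) -> f = 1%g.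
Proof.
move=> aK cT O4 KO cO dO nO d2 Oind symO u f.
apply: (cubic_faithful_aux (comp := component mu (~: O)) aK cT O4 KO cO dO nO d2 Oind symO).
  by move=> y yO; apply: component_is_comp; rewrite // inE.
by move=> y; apply: mem_component.
Qed.

End Arcs.

(** * The extremal groups *)

Section Classify.
Variables (T : finType) (mu : T -> T -> nat).
Hypothesis mu_sym : forall x y, mu x y = mu y x.
Hypothesis mu_irr : forall x, mu x x = 0.
Variables (K : {group {perm T}}) (g : nat).
Hypothesis aK : forall f, f \in K -> automorph mu f.

Local Notation cut := (cut mu).
Local Notation rk := (rk mu).
Local Notation conn := (conn mu).
Local Notation is_comp := (is_comp mu).
Local Notation TT := [set: T].
Local Notation deg x := (cut [set x] TT).

Hypothesis cT : conn TT.
Hypothesis rkT : rk TT = g.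
Hypothesis g2 : 2 <= g.
Hypothesis deg2 : forall x, 2 <= deg x.
Hypothesis br_ind : forall x y, 3 <= deg x -> 3 <= deg y -> mu x y = 0.

(** If the bound is attained at a fixed v, the inequalities in the proof of
    [pinned_bound] are equalities, and [fixed_numeric] says what this means. A
    component outside the orbit of C would raise the total rank above g. The
    automorphism at the end exists because at least two elements of the group
    fix everything outside C. *)
Lemma fixed_eq v C : (forall f, f \in K -> f v = v) -> 3 <= deg v -> 3 <= g ->
  #|K| = bsize g -> is_comp (TT :\ v) C ->
  [/\ #|orbit 'P^* K C| = g,
      forall C', is_comp (TT :\ v) C' -> C' \in orbit 'P^* K C,
      [/\ cut [set v] C = 2, rk C = 0 & #|nbrs mu v C| = 2] \/
      (cut [set v] C = 1 /\ rk C = 1)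
    & exists f, [/\ f \in K, f @: C = C, forall x, x \notin C -> f x = x & f != 1%g]].
Proof.
move=> Kv dv g3 cardK hC; have vT : v \in TT by rewrite inE.
set R := TT :\: C; pose a := cut [set v] C.
have rE := comp_rk mu_sym mu_irr vT cT hC; rewrite rkT -/R in rE.
have pos := comp_cut_gt0 mu_sym vT cT hC.
pose K1 := 'C_K[C | 'P^*]%G; pose L := 'C_K1(R | 'P)%G.
have K1K f : f \in K1 -> f \in K by case/stab_setP.
have LK f : f \in L -> f \in K1 by case/fixP.
have KT f : f \in K -> f @: TT = TT by move=> _; apply: imT.
have r0 : 0 < a + rk C - 1 := comp_rank_gt0 mu_sym mu_irr vT cT hC (fun x _ => deg2 x).
have K1R : #|K1| <= bsize (rk R) * #|L|.
  have cR : conn R by apply: (comp_rest_conn mu_sym vT cT hC).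
  apply: (pinned_bound mu_sym mu_irr cR (S := [set v]) (K := K1)).
  - by move=> f /K1K /aK.
  - by move=> f fK1; apply: (orbit_comp_fixed (K := K) KT).
  - by apply/set0Pn; exists v; rewrite inE.
  - by rewrite sub1set (comp_rest_in vT hC).
  - by move=> f y /K1K fK; rewrite inE => /eqP ->; apply: Kv.
  - by move=> y yR; rewrite inE => yv; rewrite -(deg_rest mu_sym hC).
have Lb : #|L| <= #|nbrs mu v C|`! * bsize (rk C).
  have pC : pinned_at mu C by apply: pinned_bound.
  apply: leq_trans (inside_bound (K := L) (S := set0) mu_sym vT cT hC pC _ _ _ _ _) _.
  - by move=> f /LK /K1K /aK.
  - by move=> f /LK /stab_setP[].
  - by move=> f /LK /K1K /Kv.
  - by move=> f x _; rewrite inE.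
  - by move=> x _ _.
  rewrite leq_mul2l -[X in _ <= X]muln1 leq_mul2l; apply/orP; right; apply/orP; right.
  rewrite -(card_fixT K); apply: subset_leq_card; apply/subsetP => f /fixP[fL fC].
  have /fixP[_ fR] := fL; apply/fixP; split; first exact/K1K/LK.
  by move=> x _; have [/fC //|xC] := boolP (x \in C); apply: fR; rewrite !inE xC.
have orb : #|K| = #|orbit 'P^* K C| * #|K1| by rewrite card_orbit_stab.
have mr := orbit_comp_sum mu_sym mu_irr vT cT hC aK KT Kv; rewrite rkT in mr.
have big : bsize g <= #|orbit 'P^* K C| * (bsize (rk R) * #|L|).
  by rewrite -cardK orb leq_mul2l K1R orbT.
have s0 : rk R = 0 -> 3 <= a.
  move=> R0; have := rest_deg mu_sym mu_irr cT rkT g2 deg2 hC; rewrite -/R R0 leqn0 => /eqP e.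
  by move: dv; rewrite (deg_root mu_sym hC) -/R e.
have gE : g = a + rk C - 1 + rk R by rewrite /a; clear -rE pos; lia.
have aE : a + rk C = (a + rk C - 1).+1 by rewrite /a; clear -pos; lia.
have [r1 mE l2 cases] := fixed_numeric g3 pos r0 gE aE (card_nbrs _ _ _) mr s0 Lb big.
split => //.
- move=> C' hC'; apply: contraT => nC'.
  have hP A : A \in C' |: orbit 'P^* K C -> is_comp (TT :\ v) A.
    rewrite inE => /orP[|hA]; first by rewrite inE => /eqP ->.
    exact: (orbit_is_comp hC aK KT Kv hA).
  have := sum_comp_rk mu_sym mu_irr vT cT hP; rewrite rkT.
  rewrite big_setU1 //= (eq_bigr (fun=> 1)); last first.
    by move=> A hA; have [-> ->] := orbit_comp_rank aK Kv hA.
  have := comp_rank_gt0 mu_sym mu_irr vT cT hC' (fun x _ => deg2 x).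
  by rewrite sum_nat_const muln1 mE; clear; lia.
have /subsetPn[f fL] : ~~ (L \subset [set 1%g]).
  by apply/negP => /subset_leq_card; rewrite cards1 leqNgt l2.
rewrite inE => f1; have fK1 := LK f fL; have [fK fC] := stab_setP _ _ _ fK1.
exists f; split => // x xC; have /fixP[_] := fL; apply; by rewrite !inE xC.
Qed.

Definition banana_shape (v u : T) :=
  [/\ v != u, conn (TT :\ v),
      [/\ deg v = g.+1, deg u = g.+1 & forall x, x != v -> x != u -> deg x = 2],
      #|nbrs mu v TT| = g.+1 &
      forall x y, x \in nbrs mu v TT -> y \in nbrs mu v TT ->
        exists f, [/\ f \in K, f v = v & f x = y]].

Theorem classify : #|K| <= bound g /\ (#|K| = bound g ->
  (3 <= g /\ exists v, [/\ 3 <= deg v, forall f, f \in K -> f v = v & #|K| = bsize g]) \/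
  (g \in [:: 2; 3] /\ exists v u, banana_shape v u)).
Proof.
have [v0 dv0] := deg3_ex mu_sym mu_irr cT rkT g2.
(* Minimality excludes the case a = p = 1 of the numerical bound. *)
pose v := [arg min_(v < v0 | 3 <= deg v) #|orbit 'P K v|].
have [dv vmin] : 3 <= deg v /\ forall x, 3 <= deg x -> #|orbit 'P K v| <= #|orbit 'P K x|.
  by rewrite /v; case: arg_minnP.
set O := orbit 'P K v in vmin *.
have vO : v \in O by apply: orbit_refl.
have [n1|n2] := leqP #|O| 1.
  have Kv f : f \in K -> f v = v.
    move=> fK; have fO : f v \in O by apply/orbit_ptP; exists f.
    have /eqP : #|O :\ v| = 0 by move: n1; rewrite (cardsD1 v) vO; clear; lia.
    rewrite cards_eq0 => /eqP /setP /(_ (f v)).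
    by rewrite !inE fO andbT => /negbFE /eqP.
  have b1 := fixed_bound mu_sym mu_irr aK cT rkT deg2 Kv.
  have b2 := bsize_le_bound g2.
  split; first exact: leq_trans b2.
  move=> E; have E2 : bsize g = bound g.
    by apply/eqP; rewrite eqn_leq b2 -E b1.
  by left; split; [apply: bsize_eq_bound|exists v; split; rewrite // E E2].
have [M [hM OM]] := main_comp mu_sym aK cT rkT g2 n2 dv.
split; first exact: (moving_bound mu_sym mu_irr aK cT rkT g2 deg2 n2 dv vmin hM OM).
move=> E; have OE u : u \in O -> orbit 'P K u = O.
  by move=> uO; apply/orbit_eqP.
have dO u : u \in O -> deg u = deg v by move/(deg_orbit aK).
have main u (uO : u \in O) : exists M, is_comp (TT :\ u) M /\ O :\ u \subset M.
  by rewrite -(OE u uO); apply: (main_comp mu_sym aK cT rkT g2); rewrite ?OE // dO.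
have ncon u : nbrs mu u (TT :\ u) = nbrs mu u TT.
  apply/setP => x; rewrite !inE andbT /=; case: eqP => //= ->.
  by rewrite mu_irr.
have KO f x : f \in K -> (f x \in O) = (x \in O).
  move=> fK; apply/orbit_ptP/orbit_ptP => -[h hK e].
    by exists (h * f^-1)%g; rewrite ?groupM ?groupV // permM -e permK.
  by exists (h * f)%g; rewrite ?groupM // permM -e.
have facts u : u \in O -> exists M, [/\ is_comp (TT :\ u) M, M = TT :\ u,
   cut [set u] M = #|nbrs mu u M| & 
   (forall x y, x \in nbrs mu u M -> y \in nbrs mu u M ->
        exists f, [/\ f \in K, f u = u, f x = y, f y = x &
          forall z, z \in nbrs mu u M -> z != x -> z != y -> f z = z]) /\
   ([/\ rk M = 0, #|O| = 2, cut [set u] M = g.+1 & g \in [:: 2; 3]] \/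
      [/\ rk M = 1, #|O| = 4, cut [set u] M = 3, g = 3 &
        exists f, [/\ f \in K, f u = u, forall x, x \in nbrs mu u M -> f x = x & f != 1%g] ])].
  move=> uO; have [Mu [hMu OMu]] := main u uO; exists Mu.
  have := @moving_eq T mu mu_sym mu_irr K g aK cT rkT g2 deg2 u.
  rewrite OE // dO // => /(_ n2 dv vmin Mu hMu OMu E) [h1 h2 h3 h4].
  by split.
have cutE u : cut [set u] (TT :\ u) = deg u.
  have -> : TT = [set u] :|: (TT :\ u) by rewrite setD1K.
  by rewrite cutUr ?disjoints1 ?inE ?eqxx //= cut11 mu_irr setU1K // !inE eqxx.
have d2 : #|O| * (deg v - 2) = g.*2 - 2 -> forall x, x \notin O -> deg x = 2.
  move=> e x xO; have := deg_notO mu_sym mu_irr aK cT rkT g2 n2 dv; rewrite -/O.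
  rewrite (big_setD1 x) ?inE //= => s.
  have : #|~: O :\ x|.*2 <= \sum_(u in ~: O :\ x) deg u.
    by rewrite -muln2 -sum_nat_const; apply: leq_sum.
  have := cardsD1 x (~: O); rewrite inE xO /=.
  have := deg2 x; have e2 : #|O| * deg v = #|O| * (deg v - 2) + #|O|.*2.
    by rewrite mulnBr muln2 subnK // -muln2 leq_mul2l (ltnW dv) orbT.
  move: s; rewrite e2 e; clear -g2.
  move: (\sum_(u in _) _) (#|_ :\ x|) (#|~: O|) (deg x) (#|O|) => *; lia.
have [M0 [_ M0E cE [_ cases]]] := facts v vO.
case: cases => [[r0 O2 c0 gg]|[r1 O4 c3 g3 [f [fK fv fN f1]]]].
  right; split => //; have [u uO] : exists u, u \in O :\ v.
    by apply/set0Pn; rewrite -card_gt0; move: O2; rewrite (cardsD1 v O) vO; clear; lia.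
  move: uO; rewrite !inE => /andP[uv uO].
  have OE2 : O = [set v; u].
    by apply/esym/eqP; rewrite eqEcard subUset !sub1set vO uO O2 cards2 eq_sym uv.
  have dvE : deg v = g.+1 by rewrite -cutE -M0E.
  exists v, u; split.
  - by rewrite eq_sym.
  - by have [M1 [[_ _ cM _] ME _ _]] := facts v vO; rewrite -ME.
  - split; rewrite ?dO // => x xv xu; apply: d2; rewrite ?OE2 ?inE ?negb_or ?xv //.
    by rewrite -OE2 O2 dvE; clear -g2; lia.
  - by rewrite -ncon -M0E -cE c0.
  move=> x y; rewrite -ncon => xN yN.
  have [M1 [_ ME _ [sym _]]] := facts v vO; rewrite -ME in xN yN.
  by have [f [fK fv fx _ _]] := sym x y xN yN; exists f.
exfalso; have dv3 : deg v = 3 by rewrite -cutE -M0E.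
case/eqP: f1; apply: (cubic_faithful mu_sym mu_irr aK cT O4 KO _ _ _ _ _ _ vO fK fv).
- by move=> u /facts[M1 [[_ _ cM _] ME _ _]]; rewrite -ME.
- by move=> u /dO ->.
- move=> u uO; have [M1 [_ ME cM _]] := facts u uO.
  by rewrite -ncon -ME -cM ME cutE dO.
- by apply: d2; rewrite O4 dv3 g3.
- by move=> u w uO wO; apply: br_ind; rewrite dO.
- move=> u x y uO; rewrite -!ncon => xN yN.
  have [M1 [_ ME _ [sym _]]] := facts u uO; rewrite -ME in xN yN *; exact: sym.
by move=> y; rewrite -ncon -M0E; apply: fN.
Qed.

End Classify.

(** * The incidence multigraph of a graph, and its paths *)

Section Incidence.
Variable G : mgraph.

Definition node : finType := (vertex G + edge G)%type.

Definition mult (x : vertex G) (e : edge G) : nat :=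
  if x \in ends e then (if is_loop e then 2 else 1) else 0.

(** A loop is an edge node with a double connection to its vertex. Hence every
    edge node has degree 2, degrees of vertex nodes are the degrees in G, and
    the rank of the set of all nodes is the Betti number of G. A loop still has
    no flip, because automorphisms permute nodes only. *)
Definition nmu (a b : node) : nat :=
  match a, b with
  | inl x, inr e | inr e, inl x => mult x e
  | _, _ => 0
  end.

Lemma nmu_sym a b : nmu a b = nmu b a. Proof. by case: a; case: b. Qed.
Lemma nmu_irr a : nmu a a = 0. Proof. by case: a. Qed.

Lemma mult_gt0 x e : (0 < mult x e) = (x \in ends e).
Proof. by rewrite /mult; case: (x \in ends e); case: (is_loop e). Qed.

Lemma nmu_xe x e : (0 < nmu (inl x) (inr e)) = (x \in ends e).
Proof. exact: mult_gt0. Qed.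
Lemma nmu_ex x e : (0 < nmu (inr e) (inl x)) = (x \in ends e).
Proof. exact: mult_gt0. Qed.

Lemma sum_mult e : \sum_x mult x e = 2.
Proof.
rewrite -big_mkcond /= sum_nat_const /is_loop.
by have := card_ends e; rewrite !inE => /orP[] /eqP ->.
Qed.

Local Notation cut := (cut nmu).
Local Notation TT := [set: node].
Local Notation deg x := (cut [set x] TT).

Lemma sum_nodes (F : node -> nat) :
  \sum_(a in TT) F a = \sum_x F (inl x) + \sum_e F (inr e).
Proof. by rewrite big_sumType /=; congr (_ + _); apply: eq_bigl => ?; rewrite inE. Qed.

Lemma deg_edge e : deg (inr e) = 2.
Proof. by rewrite cut1l sum_nodes /= sum_mult big1_eq addn0. Qed.

Lemma deg_vertex x : deg (inl x) = degree x.
Proof.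
by rewrite cut1l sum_nodes /= big1_eq add0n /degree [RHS]big_mkcond.
Qed.

Lemma cut_nodes : cut TT TT = (#|edge G|.*2).*2.
Proof.
have E1 : \sum_x \sum_e mult x e = #|edge G|.*2.
  rewrite exchange_big /= (eq_bigr (fun=> 2)); last by move=> e _; apply: sum_mult.
  by rewrite sum_nat_const muln2.
rewrite cut_sum_deg sum_nodes -addnn -{1}E1; congr (_ + _).
  by apply: eq_bigr => x _; rewrite cut1l sum_nodes /= big1_eq.
rewrite (eq_bigr (fun=> 2)); last by move=> e _; apply: deg_edge.
by rewrite sum_nat_const muln2.
Qed.

Lemma card_node : #|TT| = #|vertex G| + #|edge G|.
Proof. by rewrite cardsT card_sum. Qed.

Lemma adj_sym : symmetric (@adj G).
Proof.
by move=> x y; apply/existsP/existsP => -[e /eqP h]; exists e; rewrite h setUC.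
Qed.

Lemma connected_connect : connected G -> forall x y : vertex G, connect (@adj G) x y.
Proof.
move=> cG x y; have sc := sym_connect_sym adj_sym.
have r1 : #|[predI roots (@adj G) & vertex G]| <= 1 by rewrite -[X in _ <= X]cG.
rewrite -(root_connect sc); apply/eqP; apply: (card_le1_eqP r1).
  by apply/andP; split; [apply: (roots_root sc)|].
by apply/andP; split; [apply: (roots_root sc)|].
Qed.

Lemma ends_neq0 (e : edge G) : exists x, x \in ends e.
Proof.
by apply/card_gt0P; have := card_ends e; rewrite !inE => /orP[] /eqP ->.
Qed.

Lemma connected_conn : connected G -> conn nmu TT.
Proof.
move=> cG A a aA _ clA.
have step b c : b \in A -> 0 < nmu b c -> c \in A by move=> bA; apply: clA; rewrite ?inE.
have [x xA] : exists x, inl x \in A.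
  case: a aA => [x|e] aA; first by exists x.
  by have [x xe] := ends_neq0 e; exists x; apply: (step _ _ aA); rewrite nmu_ex.
have vA y : inl y \in A.
  case/connectP: (connected_connect cG x y) => p pth ->; elim: p x xA pth => //= z p IH x xA.
  case/andP=> /existsP[e /eqP he]; apply: IH.
  apply: (step (inr e)); last by rewrite nmu_ex he !inE eqxx orbT.
  by apply: (step (inl x)); rewrite // nmu_xe he !inE eqxx.
apply/subsetP => -[y|e] _; first exact: vA.
by have [y ye] := ends_neq0 e; apply: (step (inl y)); rewrite ?vA // nmu_xe.
Qed.
Definition node_fun (f : {perm vertex G} * {perm edge G}) (a : node) : node :=
  match a with inl x => inl (f.1 x) | inr e => inr (f.2 e) end.

Lemma node_fun_inj f : injective (node_fun f).
Proof. by case=> [x|e] [y|e'] //= [] /perm_inj ->. Qed.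

Definition node_perm f : {perm node} := perm (@node_fun_inj f).

Lemma node_permM : {in [set: {perm vertex G} * {perm edge G}] &,
  {morph node_perm : f h / (f * h)%g >-> (f * h)%g}}.
Proof.
move=> f h _ _; apply/permP => a; rewrite permM !permE.
by case: a => [x|e] /=; rewrite permM.
Qed.

Canonical node_perm_morphism := Morphism node_permM.

Lemma node_perm_inj : injective node_perm.
Proof.
move=> [f1 f2] [h1 h2] /permP e; congr (_, _); apply/permP.
  by move=> x; have := e (inl x); rewrite !permE => -[].
by move=> x; have := e (inr x); rewrite !permE => -[].
Qed.

Definition node_group : {group {perm node}} := (node_perm @* Aut_mgraph_group G)%G.

Lemma node_groupP f : reflect (exists2 h, h \in Aut_mgraph G & f = node_perm h)
  (f \in node_group).
Proof.
apply: (iffP morphimP) => [[h _ hA ->]|[h hA ->]]; first by exists h.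
by exists h; rewrite // inE.
Qed.

Lemma card_node_group : #|node_group| = #|Aut_mgraph G|.
Proof.
by rewrite /= morphimEsub ?subsetT // card_imset //; apply: node_perm_inj.
Qed.

Lemma Aut_ends h : h \in Aut_mgraph G -> forall e, ends (h.2 e) = h.1 @: ends e.
Proof. by rewrite inE => /forallP hA e; rewrite (eqP (hA e)). Qed.

Lemma Aut_mult h x e : h \in Aut_mgraph G -> mult (h.1 x) (h.2 e) = mult x e.
Proof.
move=> hA; rewrite /mult /is_loop (Aut_ends hA) mem_imset ?card_imset //; exact: perm_inj.
Qed.

Lemma node_group_aut f : f \in node_group -> automorph nmu f.
Proof.
case/node_groupP => h hA -> [x|e] [y|e'] /=; rewrite !permE //=; exact: Aut_mult.
Qed.
(** The path visits pv 0, pe 0, pv 1, ..., pe (n - 1), pv n; the set A consists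
    of its edges and its inner vertices. Indexing by natural numbers makes it
    possible to reverse and to relabel paths without casts between ordinals. *)
Record is_path (o : vertex G) (n : nat) (pe : nat -> edge G) (pv : nat -> vertex G)
    (z : vertex G) (A : {set node}) : Prop := IsPath {
  path_gt0 : 0 < n;
  path_start : pv 0 = o;
  path_end : pv n = z;
  path_ends : forall i, i < n -> ends (pe i) = [set pv i; pv i.+1];
  path_edges : forall e, inr e \in A <-> exists2 i, i < n & e = pe i;
  path_verts : forall x, inl x \in A <-> exists2 i, 0 < i < n & x = pv i;
  path_einj : forall i j, i < n -> j < n -> pe i = pe j -> i = j;
  path_vinj : forall i j, 0 < i < n -> 0 < j < n -> pv i = pv j -> i = j
}.

Lemma nonloop_mult (x y : vertex G) (e : edge G) : ends e = [set x; y] -> x != y ->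
  is_loop e = false.
Proof. by move=> he xy; rewrite /is_loop he cards2 xy. Qed.

Lemma degree_ge (x : vertex G) (E : {set edge G}) :
  \sum_(e in E) mult x e <= degree x.
Proof.
rewrite /degree [X in _ <= X]big_mkcond /= [X in _ <= X](bigID (mem E)) /=.
by apply: leq_trans (leq_addr _ _); apply: eq_leq; apply: eq_bigr.
Qed.

(** A third edge at x, or a second contribution of y', would raise the degree to
    3. *)
Lemma degree2_other (x z : vertex G) (y : edge G) : degree x = 2 ->
  ends y = [set z; x] -> z != x ->
  exists y', [/\ y' != y, x \in ends y', is_loop y' = false &
    forall e, x \in ends e -> e = y \/ e = y'].
Proof.
move=> d2 ey zx; have xy : x \in ends y by rewrite ey !inE eqxx orbT.
have ly := nonloop_mult ey zx.
have m e : x \in ends e -> mult x e = if is_loop e then 2 else 1 by rewrite /mult => ->.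
have [y' y'y] : exists y', (y' != y) && (x \in ends y').
  apply/existsP; apply: contraT => /existsPn h.
  suff : degree x = 1 by rewrite d2.
  rewrite /degree (bigD1 y) //= ly big1 // => e /andP[xe ey'].
  by have := h e; rewrite ey' xe.
case/andP: y'y => y'y xy'; exists y'; split => //.
  have := degree_ge x [set y; y']; rewrite big_setU1 ?inE 1?eq_sym //= big_set1 d2.
  by rewrite !m // ly; case: (is_loop y').
move=> e xe; have [->|ey1] := eqVneq e y; [by left|right].
apply/eqP; apply: contraT => ey2.
have := degree_ge x [set e; y; y'].
rewrite [[set _; _; _]]setUC big_setU1 /=; last first.
  by rewrite !inE negb_or ![y' == _]eq_sym ey2 eq_sym y'y.
rewrite big_setU1 /= ?inE // big_set1 d2 !m // ly.
by case: (is_loop e); case: (is_loop y').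
Qed.

Lemma set2_of_mem (e : edge G) o : o \in ends e -> exists x, ends e = [set o; x].
Proof.
move=> oe; have := card_ends e; rewrite !inE => /orP[|] /eqP c.
  by exists o; move/eqP/cards1P: c oe => [z ->]; rewrite inE => /eqP ->; rewrite setUid.
have /cards1P[x hx] : #|ends e :\ o| == 1 by move: c; rewrite (cardsD1 o) oe => -[/eqP].
by exists x; rewrite -(setD1K oe) hx.
Qed.

(** Follow the graph from o through y: while the next vertex lies in A it has
    degree 2 and determines the next edge. Removing the first edge and the first
    vertex keeps A connected, since both sit at its end, so induction
    applies. *)
Lemma path_exists (A : {set node}) (o : vertex G) (y : edge G) :
  conn nmu A -> (forall x e, inl x \in A -> x \in ends e -> inr e \in A) ->
  (forall x, inl x \in A -> degree x = 2) ->
  inl o \notin A -> inr y \in A -> o \in ends y ->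
  exists n pe pv z, [/\ is_path o n pe pv z A, pe 0 = y & inl z \notin A].
Proof.
have [k] := ubnP #|A|; elim: k A o y => // k IH A o y Ak cA clA dA oA yA oy.
have [x ey] := set2_of_mem oy.
have [xA|xA] := boolP (inl x \in A); last first.
  have AE : A = [set inr y].
    apply/eqP; rewrite eqEsubset sub1set yA andbT.
    apply: (cA _ (inr y)) => //; first by rewrite inE.
    move=> a b; rewrite !inE => /eqP -> _ bA; case: b bA => // z zA.
    rewrite nmu_ex ey !inE => /orP[] /eqP zE; rewrite zE in zA.
      by rewrite zA in oA.
    by rewrite zA in xA.
  (* The edge y leaves A at once: the path has length 1 and no inner vertex. *)
  exists 1, (fun=> y), (fun i => if i == 0 then o else x), x; split => //.
  split => //.
  - by case.
  - move=> e; rewrite AE inE; split=> [/eqP[->]|[i _ ->]]; by [exists 0|rewrite eqxx].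
  - by move=> z; rewrite AE inE; split => // -[i]; case: i => [|[]].
  - by move=> [] // [].
  - by move=> [|i] j; rewrite ?ltn0 //; case: i.
have ox : o != x by apply: contraNneq oA => ->.
have [y' [y'y xy' ly' hx]] := degree2_other (dA x xA) ey ox.
pose A' := A :\ inr y :\ inl x.
have y'A' : inr y' \in A'.
  by rewrite !inE /= (clA x) // andbT; apply: contra y'y => /eqP[->].
have inA' a : a \in A' -> a \in A by rewrite !inE => /and3P[].
have xA' : inl x \notin A' by rewrite !inE eqxx.
have yA' : inr y \notin A' by rewrite !inE eqxx andbF.
have A'E a : a \in A -> a != inr y -> a != inl x -> a \in A'.
  by move=> h1 h2 h3; rewrite !inE h1 h2 h3.
have adjx b : 0 < nmu (inl x) b -> b = inr y \/ b = inr y'.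
  by case: b => // e; rewrite nmu_xe => /hx[->|->]; [left|right].
have adjy b : 0 < nmu (inr y) b -> b = inl o \/ b = inl x.
  by case: b => // e; rewrite nmu_ex ey !inE => /orP[] /eqP ->; [left|right].
(* If B contains y', adding y and x to the part of B in A' gives a closed subset
   of A; otherwise that part is itself closed in A. *)
have cA' : conn nmu A'.
  move=> B z zB zA' clB; apply/subsetP => a aA'.
  have [y'B|y'B] := boolP (inr y' \in B).
    pose B1 := (B :&: A') :|: [set inr y; inl x].
    have : A \subset B1.
      apply: (cA _ z); [by rewrite !in_setU in_setI zB zA'|exact: inA'|].
      move=> b c; rewrite !in_setU !in_setI !in_set1 => bB bA cA0 bc.
      have [->|cy] := eqVneq c (inr y); first by rewrite orbT.
      have [->|cx] := eqVneq c (inl x); first by rewrite !orbT.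
      have cA'0 := A'E c cA0 cy cx; rewrite cA'0 andbT /=; apply/orP; left.
      case/orP: bB => [/andP[bB bA']|/orP[] /eqP bE]; first exact: (clB b).
        by rewrite bE in bc; case: (adjy _ bc) => cE;
          [rewrite -cE cA0 in oA|rewrite cE eqxx in cx].
      by rewrite bE in bc; case: (adjx _ bc) => cE; [rewrite cE eqxx in cy|rewrite cE].
    move/subsetP/(_ a (inA' a aA')); rewrite in_setU in_setI aA' andbT => /orP[//|].
    rewrite !inE => /orP[] /eqP aE; first by rewrite aE (negbTE yA') in aA'.
    by rewrite aE (negbTE xA') in aA'.
  have : A \subset B :&: A'.
    apply: (cA _ z); [by rewrite in_setI zB|exact: inA'|].
    move=> b c; rewrite !in_setI => /andP[bB bA'] bA cA0 bc.
    suff cA'0 : c \in A' by rewrite cA'0 andbT; apply: (clB b).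
    apply: A'E => //; apply/eqP => cE; rewrite cE nmu_sym in bc.
      case: (adjy _ bc) => bE; first by rewrite -bE bA in oA.
      by rewrite bE (negbTE xA') in bA'.
    case: (adjx _ bc) => bE; first by rewrite bE (negbTE yA') in bA'.
    by rewrite -bE bB in y'B.
  by move/subsetP/(_ _ xA); rewrite in_setI (negbTE xA') andbF.
have [||||||n [pe [pv [z [hp pe0 zA']]]]] := IH A' x y' _ cA'.
- have : #|A'| < #|A|; last by lia.
  by apply: proper_card; apply/properP; split; [apply/subsetP/inA'|exists (inl x)].
- move=> x' e x'A' x'e; apply: A'E => //; first exact: clA (inA' _ x'A') x'e.
  apply/eqP => -[eE]; rewrite eE ey !inE in x'e; case/orP: x'e => /eqP x'E.
    by rewrite -x'E (inA' _ x'A') in oA.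
  by rewrite x'E (negbTE xA') in x'A'.
- by move=> x' /inA'; apply: dA.
- exact: xA'.
- exact: y'A'.
- exact: xy'.
have [n0 p0 pn pends pedg pver peinj pvinj] := hp.
have zx : z != x.
  apply/eqP => zx; have := pends n.-1; rewrite prednK // leqnn pn zx => /(_ isT) en.
  have xe : x \in ends (pe n.-1) by rewrite en !inE eqxx orbT.
  have pA : inr (pe n.-1) \in A' by apply/pedg; exists n.-1; rewrite // prednK.
  case: (hx _ xe) => eE; first by rewrite eE (negbTE yA') in pA.
  have : n.-1 = 0 by apply: peinj; rewrite ?prednK // eE pe0.
  move=> n1; rewrite n1 p0 setUid in en; rewrite /is_loop -pe0 en cards1 in ly'.
  by [].
exists n.+1, (fun i => if i is j.+1 then pe j else y),
  (fun i => if i is j.+1 then pv j else o), z; split => //; last first.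
  by apply: contra zA' => zA; apply: A'E => //; apply: contra zx => /eqP[->].
split => //.
- by case=> [|i] hi; [rewrite ey p0|apply: pends].
- move=> e; split.
    move=> eA; have [->|ne] := eqVneq e y; first by exists 0.
    have : inr e \in A' by apply: A'E => //; apply: contra ne => /eqP[->].
    by case/pedg => i hi ->; exists i.+1.
  case=> -[|i] hi -> //; apply: inA'; apply/pedg; by exists i.
- move=> w; split.
    move=> wA; have [->|ne] := eqVneq w x; first by exists 1; rewrite ?p0 // ltnS n0.
    have : inl w \in A' by apply: A'E => //; apply: contra ne => /eqP[->].
    by case/pver => i /andP[i0 hi] ->; exists i.+1; rewrite ?ltnS.
  case=> -[|[|i]] // /andP[_ hi] ->; first by rewrite p0.
  by apply: inA'; apply/pver; exists i.+1.
- have yn i : i < n -> pe i <> y.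
    by move=> hi e; case/negP: yA'; apply/pedg; exists i.
  by case=> [|i] [|j] hi hj // e; [case: (yn j)|case: (yn i)|congr _.+1; apply: peinj].
have xn i : i.+1 < n -> pv i.+1 <> x.
  by move=> hi e; case/negP: xA'; apply/pver; exists i.+1.
case=> [|[|i]] [|[|j]] // hi hj e; rewrite ?p0 in e.
- by case: (xn j).
- by case: (xn i).
by congr _.+1; apply: pvinj.
Qed.

Lemma path_aut h o n pe pv z A : h \in Aut_mgraph G -> is_path o n pe pv z A ->
  is_path (h.1 o) n (fun i => h.2 (pe i)) (fun i => h.1 (pv i)) (h.1 z)
    (node_perm h @: A).
Proof.
move=> hA [n0 p0 pn pends pedg pver peinj pvinj]; split; rewrite ?p0 ?pn //.
- by move=> i hi; rewrite (Aut_ends hA) pends // imsetU !imset_set1.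
- move=> e; split=> [/imsetP[[x|e'] eA]|[i hi ->]]; rewrite ?permE //=.
    by case=> ->; have /pedg[i hi ->] := eA; exists i.
  by apply/imsetP; exists (inr (pe i)); rewrite ?permE //; apply/pedg; exists i.
- move=> x; split=> [/imsetP[[x'|e'] eA]|[i hi ->]]; rewrite ?permE //=.
    by case=> ->; have /pver[i hi ->] := eA; exists i.
  by apply/imsetP; exists (inl (pv i)); rewrite ?permE //; apply/pver; exists i.
- by move=> i j hi hj /perm_inj; apply: peinj.
by move=> i j hi hj /perm_inj; apply: pvinj.
Qed.
(** An automorphism that fixes a vertex of degree 2 and one of its edges fixes
    the other edge. *)
Lemma path_fix h o n pe pv z A : h \in Aut_mgraph G -> is_path o n pe pv z A ->
  (forall x, inl x \in A -> degree x = 2) -> h.1 o = o -> h.2 (pe 0) = pe 0 ->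
  forall a, a \in A -> node_perm h a = a.
Proof.
move=> hA [n0 p0 pn pends pedg pver peinj pvinj] dA ho he.
have H i : i < n -> h.1 (pv i) = pv i /\ h.2 (pe i) = pe i.
  elim: i => [|i IH] hi; first by rewrite p0.
  have [hv hpe] := IH (ltnW hi); have ei := pends i (ltnW hi).
  have hv1 : h.1 (pv i.+1) = pv i.+1.
    have := Aut_ends hA (pe i); rewrite hpe ei imsetU !imset_set1 hv.
    have [e1|ne] := eqVneq (pv i.+1) (pv i); first by rewrite e1 hv.
    move/setP/(_ (pv i.+1)); rewrite !inE eqxx orbT (negbTE ne) => /esym /eqP //.
  split => //; have d2 : degree (pv i.+1) = 2 by apply: dA; apply/pver; exists i.+1.
  have in1 : pv i.+1 \in ends (pe i) by rewrite ei !inE eqxx orbT.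
  have in2 : pv i.+1 \in ends (pe i.+1) by rewrite pends // !inE eqxx.
  have in3 : pv i.+1 \in ends (h.2 (pe i.+1)) by rewrite (Aut_ends hA) -{1}hv1 imset_f.
  have m x e : x \in ends e -> 0 < mult x e by rewrite mult_gt0.
  have n1 : pe i.+1 != pe i by apply/eqP => /peinj; rewrite hi (ltnW hi) => /(_ isT isT); lia.
  have n2 : h.2 (pe i.+1) != pe i by rewrite -hpe (inj_eq perm_inj).
  apply/eqP; apply: contraT => n3.
  have := degree_ge (pv i.+1) [set pe i.+1; pe i; h.2 (pe i.+1)].
  rewrite [[set _; _; _]]setUC big_setU1 /=; last by rewrite !inE negb_or n3 n2.
  rewrite big_setU1 /= ?inE // big_set1 d2.
  have := m _ _ in1; have := m _ _ in2; have := m _ _ in3.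
  move: (mult _ (h.2 _)) (mult _ (pe i)) (mult _ (pe i.+1)); clear => a b c.
  by case: a b c => [|a] [|b] [|c] // _ _ _; rewrite !addSn !addnS.
move=> [x|e] aA; rewrite permE /=.
  by have /pver[i /andP[_ hi] ->] := aA; rewrite (H i hi).1.
by have /pedg[i hi ->] := aA; rewrite (H i hi).2.
Qed.

End Incidence.

(** * Subdivisions given by paths *)

Section Param.
Variables (V E : finType) (s t : E -> V) (n : E -> nat).
Hypothesis n0 : forall e, 0 < n e.

(** A description of G as a subdivision: phi places the old vertices, pe e and
    pv e list the edges and vertices along the path that replaces e. It is
    equivalent to an isomorphism from [subdiv s t n], by [iso_of_param] and
    [param_of_iso]. *)
Record param (G : mgraph) (phi : V -> vertex G) (pe : E -> nat -> edge G)
    (pv : E -> nat -> vertex G) : Prop := Param {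
  param_start : forall e, pv e 0 = phi (s e);
  param_end : forall e, pv e (n e) = phi (t e);
  param_ends : forall e i, i < n e -> ends (pe e i) = [set pv e i; pv e i.+1];
  param_esurj : forall d, exists e i, i < n e /\ d = pe e i;
  param_einj : forall e i e' i', i < n e -> i' < n e' -> pe e i = pe e' i' ->
     e = e' /\ i = i';
  param_vsurj : forall x, (exists v, x = phi v) \/
     exists e i, 0 < i < n e /\ x = pv e i;
  param_phi_inj : injective phi;
  param_vinj : forall e i e' i', 0 < i < n e -> 0 < i' < n e' ->
     pv e i = pv e' i' -> e = e' /\ i = i';
  param_disj : forall v e i, 0 < i < n e -> phi v <> pv e i
}.

Local Notation SV := (V + {e : E & 'I_(n e).-1})%type.
Local Notation SE := {e : E & 'I_(n e)}.

Section FromParam.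
Variables (G : mgraph) (phi : V -> vertex G) (pe : E -> nat -> edge G)
    (pv : E -> nat -> vertex G).
Hypothesis P : param phi pe pv.

Definition param_V (x : SV) : vertex G :=
  match x with inl v => phi v | inr p => pv (tag p) (tagged p).+1 end.
Definition param_E (p : SE) : edge G := pe (tag p) (tagged p).

Let ltn1 e (i : 'I_(n e).-1) : 0 < i.+1 < n e.
Proof. by have := ltn_ord i; have := n0 e; lia. Qed.

Lemma param_V_inj : injective param_V.
Proof.
move=> [v|[e i]] [v'|[e' i']] //=.
- by move/(param_phi_inj P) ->.
- by move=> h; case: (param_disj P (ltn1 i') h).
- by move=> h; case: (param_disj P (ltn1 i) (esym h)).
move=> h; have [ee ii] := param_vinj P (ltn1 i) (ltn1 i') h.
by subst e'; congr (inr (Tagged _ _)); apply: val_inj; case: ii.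
Qed.

Lemma param_E_inj : injective param_E.
Proof.
move=> [e i] [e' i'] h; have [ee ii] := param_einj P (ltn_ord i) (ltn_ord i') h.
by rewrite /= in ee ii; subst e'; congr (Tagged _ _); apply: val_inj.
Qed.

Lemma param_V_surj x : exists a, x = param_V a.
Proof.
case: (param_vsurj P x) => [[v ->]|[e [i [/andP[i0 hi] ->]]]]; first by exists (inl v).
have h : i.-1 < (n e).-1 by lia.
by exists (inr (Tagged (fun e => 'I_(n e).-1) (Ordinal h))); rewrite /= prednK.
Qed.

Lemma param_E_surj d : exists a, d = param_E a.
Proof.
have [e [i [hi ->]]] := param_esurj P d.
by exists (Tagged (fun e => 'I_(n e)) (Ordinal hi)).
Qed.

Lemma param_subdiv_vertex e k : k <= n e -> param_V (subdiv_vertex s t n e k) = pv e k.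
Proof.
case: k => [|j] hj /=; first by rewrite (param_start P).
case: insubP => [i _ ij|] /=; first by rewrite ij.
rewrite -leqNgt => h; rewrite -(param_end P); congr (pv _ _).
by have := n0 e; lia.
Qed.

Lemma param_subdiv_ends (p : edge (subdiv s t n)) :
  param_V @: ends p = ends (param_E p).
Proof.
case: p => e i.
have -> : @ends (subdiv s t n) (existT _ e i) =
  [set subdiv_vertex s t n e i; subdiv_vertex s t n e i.+1] by [].
rewrite imsetU !imset_set1 (param_subdiv_vertex (ltnW (ltn_ord i))).
by rewrite (param_subdiv_vertex (ltn_ord i)) /param_E (param_ends P).
Qed.

End FromParam.

Lemma inj_surj_bij (A B : finType) (f : A -> B) : injective f ->
  (forall y, exists x, y = f x) -> bijective f.
Proof.
move=> fi fs; apply: inj_card_bij => //.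
rewrite -(card_codom fi); apply: subset_leq_card; apply/subsetP => y _.
by have [x ->] := fs y; apply: codom_f.
Qed.

(** Both descriptions are isomorphisms from the same subdivision; compose one
    with the inverse of the other. *)
Lemma param_aut (G : mgraph) phi pe pv phi' pe' pv' :
  @param G phi pe pv -> @param G phi' pe' pv' ->
  exists2 f, f \in Aut_mgraph G &
    (forall v, f.1 (phi v) = phi' v) /\
    (forall e i, i < n e -> f.2 (pe e i) = pe' e i).
Proof.
move=> P P'.
have [hV VK KV] := inj_surj_bij (param_V_inj P) (param_V_surj P).
have [hE EK KE] := inj_surj_bij (param_E_inj P) (param_E_surj P).
have fVi : injective (param_V phi' pv' \o hV).
  by apply: inj_comp (param_V_inj P') (can_inj KV).
have fEi : injective (param_E pe' \o hE).
  by apply: inj_comp (param_E_inj P') (can_inj KE).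
exists (perm fVi, perm fEi).
  rewrite inE; apply/forallP => d /=; apply/eqP.
  rewrite permE /= -(param_subdiv_ends P') -{1}[d]KE -(param_subdiv_ends P) -imset_comp.
  by apply: eq_imset => x; rewrite /= permE /= VK.
split=> [v|e i hi] /=; first by rewrite permE /= -[phi v]/(param_V phi pv (inl v)) VK.
by rewrite permE /= -[pe e i]/(param_E pe (Tagged (fun e => 'I_(n e)) (Ordinal hi))) EK.
Qed.

Lemma iso_of_param (G : mgraph) phi pe pv :
  @param G phi pe pv -> isomorphic G (subdiv s t n).
Proof.
move=> P.
have [hV VK KV] := inj_surj_bij (param_V_inj P) (param_V_surj P).
have [hE EK KE] := inj_surj_bij (param_E_inj P) (param_E_surj P).
(* The isomorphism goes from G to the subdivision, against the direction of the
   parametrisation. *)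
exists hV, hE; split; [by exists (param_V phi pv)|by exists (param_E pe)|].
move=> d; rewrite -{1}[d]KE -(param_subdiv_ends P) -imset_comp.
by rewrite (eq_imset (g := id)) ?imset_id // => x /=; rewrite VK.
Qed.

Lemma param_of_iso (G : mgraph) : isomorphic G (subdiv s t n) ->
  exists phi pe pv, @param G phi pe pv.
Proof.
case=> fV [fE [[hV VK KV] [hE EK KE] hends]].
pose T0 e : SE := Tagged (fun e => 'I_(n e)) (Ordinal (n0 e)).
pose te e i : SE := if insub i : option 'I_(n e) is Some k
   then Tagged (fun e => 'I_(n e)) k else T0 e.
have teE e i (hi : i < n e) : te e i = Tagged (fun e => 'I_(n e)) (Ordinal hi).
  by rewrite /te insubT.
have svE e i (h : i < (n e).-1) : subdiv_vertex s t n e i.+1 =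
    inr (Tagged (fun e => 'I_(n e).-1) (Ordinal h)).
  by rewrite /= insubT.
exists (fun v => hV (inl v)), (fun e i => hE (te e i)),
  (fun e i => hV (subdiv_vertex s t n e i)).
have hVi := can_inj KV; have hEi := can_inj KE.
split => //.
- move=> e; congr hV; rewrite -[n e]prednK //= insubF //=.
  by rewrite ltnn.
- move=> e i hi; apply: (imset_inj (can_inj VK)).
  rewrite hends KE teE imsetU !imset_set1 !KV //.
- move=> d; have := EK d; case: (fE d) => e i <-; exists e, i; split=> //.
  congr hE; rewrite teE; congr (Tagged _ _); exact: val_inj.
- move=> e i e' i' hi hi' /hEi; rewrite !teE.
  by move/(congr1 (fun p : SE => (tag p, val (tagged p)))) => [-> ->].
- move=> x; have := VK x; case: (fV x) => [v <-|[e k] <-]; [by left; exists v|right].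
  exists e, k.+1; split; first by have := ltn_ord k; have := n0 e; lia.
  by rewrite (svE _ _ (ltn_ord k)); congr (hV (inr (Tagged _ _))); apply: val_inj.
- by move=> v v' /hVi [].
- move=> e [|i] e' [|i'] // hi hi' /hVi.
  have hi1 : i < (n e).-1 by lia.
  have hi1' : i' < (n e').-1 by lia.
  rewrite !svE; move/(congr1 (fun p : SV => if p is inr q then Some (tag q, val (tagged q))
    else None)).
  by move=> [-> ->].
move=> v e [|i] // hi /hVi; have hi1 : i < (n e).-1 by lia.
by rewrite svE.
Qed.
Section Relabel.
Variables (sV : V -> V) (sE : E -> E) (b : E -> bool).
Hypotheses (sVi : injective sV) (sEi : injective sE).
Hypothesis sEn : forall e, n (sE e) = n e.
Hypothesis sEb : forall e, if b e then s (sE e) = sV (t e) /\ t (sE e) = sV (s e)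
                           else s (sE e) = sV (s e) /\ t (sE e) = sV (t e).

Definition relabel_pe G (pe : E -> nat -> edge G) e i :=
  pe (sE e) (if b e then (n e).-1 - i else i).
Definition relabel_pv G (pv : E -> nat -> vertex G) e i :=
  pv (sE e) (if b e then n e - i else i).

(** Permute the paths by sE, reversing those selected by b. This is a
    description again as soon as the lengths agree and the ends are matched by
    sV. *)
Lemma relabel_param (G : mgraph) phi pe pv : @param G phi pe pv ->
  @param G (phi \o sV) (relabel_pe pe) (relabel_pv pv).
Proof.
move=> P; have [gV VK KV] := injF_bij sVi; have [gE EK KE] := injF_bij sEi.
have rev_lt e i : i < n e -> (if b e then (n e).-1 - i else i) < n (sE e).
  by rewrite sEn; case: (b e); lia.
have rev_in e i : 0 < i < n e -> 0 < (if b e then n e - i else i) < n (sE e).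
  by rewrite sEn; case: (b e); lia.
rewrite /relabel_pe /relabel_pv; split => /=.
- move=> e; have := sEb e; case: (b e) => -[h1 h2]; rewrite ?subn0.
    by rewrite -sEn (param_end P) h2.
  by rewrite (param_start P) h1.
- move=> e; have := sEb e; case: (b e) => -[h1 h2]; rewrite ?subnn.
    by rewrite (param_start P) h1.
  by rewrite -sEn (param_end P) h2.
- move=> e i hi; have := rev_lt e i hi; case: (b e) => h; rewrite (param_ends P) //.
  rewrite setUC; congr [set pv _ _; pv _ _]; lia.
- move=> d; have [e [i [hi ->]]] := param_esurj P d.
  exists (gE e), (if b (gE e) then (n e).-1 - i else i).
  have ne : n (gE e) = n e by rewrite -sEn KE.
  rewrite KE ne; case: (b _); split => //; first by lia.
  by congr (pe _ _); lia.
- move=> e i e' i' hi hi' /(param_einj P (rev_lt _ _ hi) (rev_lt _ _ hi'))[/sEi ee].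
  by subst e'; case: (b e); split => //; lia.
- move=> x; case: (param_vsurj P x) => [[v ->]|[e [i [hi ->]]]].
    by left; exists (gV v); rewrite /= KV.
  right; exists (gE e), (if b (gE e) then n e - i else i).
  have ne : n (gE e) = n e by rewrite -sEn KE.
  rewrite KE ne; case: (b _); split => //; first by lia.
  by congr (pv _ _); lia.
- exact: inj_comp (param_phi_inj P) sVi.
- move=> e i e' i' hi hi' /(param_vinj P (rev_in _ _ hi) (rev_in _ _ hi'))[/sEi ee].
  by subst e'; case: (b e); split => //; lia.
by move=> v e i hi; apply: (param_disj P); apply: rev_in.
Qed.

End Relabel.

(** Distinct relabellings X of one description give distinct automorphisms. The
    reversal of a path is visible in its first edge only if its length is at
    least 2, which is why single edges do not count. *)
Lemma aut_lower (G : mgraph) (X : finType) (sV : X -> V -> V) (sE : X -> E -> E)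
    (b : X -> E -> bool) phi pe pv :
  @param G phi pe pv ->
  (forall x, injective (sV x)) -> (forall x, injective (sE x)) ->
  (forall x e, n (sE x e) = n e) ->
  (forall x e, if b x e then s (sE x e) = sV x (t e) /\ t (sE x e) = sV x (s e)
               else s (sE x e) = sV x (s e) /\ t (sE x e) = sV x (t e)) ->
  (forall x x', sE x =1 sE x' -> sV x =1 sV x' ->
     (forall e, 1 < n e -> b x e = b x' e) -> x = x') ->
  #|X| <= #|Aut_mgraph G|.
Proof.
move=> P sVi sEi sEn sEb Xinj.
have ex x : exists f, f \in Aut_mgraph G /\
    (forall v, f.1 (phi v) = phi (sV x v)) /\
    (forall e i, i < n e -> f.2 (pe e i) = relabel_pe (sE x) (b x) pe e i).
  have [f fA [fV fE]] := param_aut P (relabel_param (sVi x) (sEi x) (sEn x) (sEb x) P).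
  by exists f.
have [F FP] := fin_all_exists ex.
have Fi : injective F.
  move=> x x' Fx; have [_ [fV fE]] := FP x; have [_ [fV' fE']] := FP x'.
  rewrite -Fx in fV' fE'.
  have H e : sE x e = sE x' e /\ (if b x e then (n e).-1 - 0 else 0) = (if b x' e then (n
    e).-1 - 0 else 0).
    have h := fE e 0 (n0 e); rewrite fE' // in h; rewrite /relabel_pe in h.
    have [||-> ->] // := param_einj P _ _ h; rewrite sEn; case: (b _ _); have := n0 e; lia.
  apply: Xinj => [e|v|e ne]; first exact: (H e).1.
    by apply: (param_phi_inj P); rewrite -fV -fV'.
  by have := (H e).2; case: (b x e); case: (b x' e) => //; lia.
rewrite -(card_imset predT Fi); apply: subset_leq_card.
by apply/subsetP => _ /imsetP[x _ ->]; case: (FP x).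
Qed.

End Param.
(** * Many automorphisms on the listed graphs *)

Lemma aut_bouquet_ge g G : subdivided_bouquet g G -> 2 ^ g * g`! <= #|Aut_mgraph G|.
Proof.
case=> n n2 [n0 [s [t [ste iso]]]].
have [phi [pe [pv P]]] := param_of_iso n0 iso.
have <- : #|(({perm 'I_g} * {ffun 'I_g -> bool})%type : finType)| = 2 ^ g * g`!.
  by rewrite card_prod card_Sn card_ffun card_bool card_ord mulnC.
apply: (aut_lower n0 (X := ({perm 'I_g} * {ffun 'I_g -> bool})%type) (sV := fun _ => id)
  (sE := fun x => x.1) (b := fun x => x.2) P) => //.
- by move=> _; apply: inj_id.
- by move=> x; apply: perm_inj.
- by move=> x e; case: (x.2 e); case: (s _); case: (t _); case: (s _); case: (t _).
move=> [x1 x2] [y1 y2] /= h1 _ h2; congr (_, _); first exact/permP.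
by apply/ffunP => e; apply: h2.
Qed.

Lemma set2_bool (a b : bool) : [set false; true] = [set a; b] -> b = ~~ a.
Proof.
by move/setP => h; move: (h true) (h false); rewrite !inE; clear; case: a; case: b.
Qed.

(** The permutation of the edges and the exchange of the two vertices are free;
    the orientations s and t being arbitrary, they determine which paths are to
    be reversed. *)
Lemma aut_banana_ge g G : subdivided_banana g G -> (g.+1)`!.*2 <= #|Aut_mgraph G|.
Proof.
case=> n n1 [n0 [s [t [ste iso]]]].
have [phi [pe [pv P]]] := param_of_iso n0 iso.
have <- : #|(({perm 'I_g.+1} * bool)%type : finType)| = (g.+1)`!.*2.
  by rewrite card_prod card_Sn card_bool muln2.
have st e : t e = ~~ s e by apply: set2_bool; apply: ste.
apply: (aut_lower n0 (X := ({perm 'I_g.+1} * bool)%type) (sV := fun x v => v (+) x.2)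
  (sE := fun x => x.1) (b := fun x e => s (x.1 e) != s e (+) x.2) P) => //.
- by move=> x u v /addIb.
- by move=> x; apply: perm_inj.
- by move=> x e; rewrite !st; case: (s _); case: (s _); case: x.2.
move=> [x1 x2] [y1 y2] /= h1 h2 _; congr (_, _); first exact/permP.
by have := h2 false.
Qed.

Lemma set2_opt (T : finType) (i : T) a b : [set None; Some i] = [set a; b] ->
  (a = None /\ b = Some i) \/ (a = Some i /\ b = None).
Proof.
move/setP => h; have := h None; have := h (Some i); rewrite !inE !eqxx.
have := h a; have := h b; rewrite !inE !eqxx orbT orTb => /orP[] /eqP -> /orP[] /eqP ->.
- by rewrite /= => /esym.
- by right.
- by left.
by rewrite eqxx.
Qed.

Lemma set1_opt (T : finType) (i : T) a b : [set Some i; Some i] = [set a; b] ->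
  a = Some i /\ b = Some i.
Proof.
rewrite setUid => /setP h; split; apply/eqP.
  by have := h a; rewrite !inE eqxx => ->.
by have := h b; rewrite !inE eqxx orbT => ->.
Qed.

(** The loops can be reversed freely, the reversal of a bridge only corrects its
    orientation. *)
Lemma aut_lollipop_ge g G : subdivided_lollipop g G -> 2 ^ g * g`! <= #|Aut_mgraph G|.
Proof.
case=> l [b [l2 b1 [n0 [s [t [ste iso]]]]]].
have [phi [pe [pv P]]] := param_of_iso n0 iso.
have <- : #|(({perm 'I_g} * {ffun 'I_g -> bool})%type : finType)| = 2 ^ g * g`!.
  by rewrite card_prod card_Sn card_ffun card_bool card_ord mulnC.
pose sV (x : {perm 'I_g} * {ffun 'I_g -> bool}) (v : option 'I_g) := omap x.1 v.
pose sE (x : {perm 'I_g} * {ffun 'I_g -> bool}) (e : 'I_g + 'I_g) : 'I_g + 'I_g :=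
  match e with inl i => inl (x.1 i) | inr i => inr (x.1 i) end.
pose fl (x : {perm 'I_g} * {ffun 'I_g -> bool}) (e : 'I_g + 'I_g) :=
  match e with inl i => s (inl (x.1 i)) != sV x (s (inl i)) | inr i => x.2 i end.
apply: (aut_lower n0 (sV := sV) (sE := sE) (b := fl) P) => //.
- by move=> x [u|] [v|] //= [] /perm_inj ->.
- by move=> x [i|i] [j|j] //= [] /perm_inj ->.
- by move=> x [i|i].
- move=> x [i|i] /=.
    have := set2_opt (ste (inl i)); have := set2_opt (ste (inl (x.1 i))).
    by case=> -[-> ->] [] [-> ->] /=; rewrite ?eqxx.
  have [-> ->] := set1_opt (ste (inr i)); have [-> ->] := set1_opt (ste (inr (x.1 i))).
  by case: (x.2 i).
move=> [x1 x2] [y1 y2] /= _ h1 h2; congr (_, _).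
  by apply/permP => i; have /= [] := h1 (Some i).
by apply/ffunP => i; apply: (h2 (inr i)).
Qed.

(** * Recognising the listed graphs *)

Section Assemble.
Variables (G : mgraph) (V E : finType) (s t : E -> V) (n : E -> nat).
Variables (phi : V -> vertex G) (pe : E -> nat -> edge G) (pv : E -> nat -> vertex G).
Variable A : E -> {set node G}.
Hypothesis pathA : forall e, is_path (phi (s e)) (n e) (pe e) (pv e) (phi (t e)) (A e).
Hypothesis phi_inj : injective phi.
Hypothesis Adisj : forall e e' a, a \in A e -> a \in A e' -> e = e'.
Hypothesis phiA : forall v e, inl (phi v) \notin A e.
Hypothesis cover : forall a : node G, (exists v, a = inl (phi v)) \/ exists e, a \in A e.

(** The paths must fill the complement of the image of phi. *)
Lemma assemble : param s t n phi pe pv.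
Proof.
have inE' e i : i < n e -> inr (pe e i) \in A e.
  by move=> hi; apply/(path_edges (pathA e)); exists i.
have inV' e i : 0 < i < n e -> inl (pv e i) \in A e.
  by move=> hi; apply/(path_verts (pathA e)); exists i.
split.
- by move=> e; apply: path_start (pathA e).
- by move=> e; apply: path_end (pathA e).
- by move=> e i hi; apply: path_ends (pathA e) i hi.
- move=> d; case: (cover (inr d)) => [[v]//|[e de]].
  by have /(path_edges (pathA e))[i hi ->] := de; exists e, i.
- move=> e i e' i' hi hi' h; have ee : e = e'.
    by apply: (@Adisj e e' (inr (pe e i))); [apply: inE'|rewrite h; apply: inE'].
  by subst e'; split => //; apply: path_einj (pathA e) _ _ hi hi' h.
- move=> x; case: (cover (inl x)) => [[v [->]]|[e xe]]; first by left; exists v.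
  by have /(path_verts (pathA e))[i hi ->] := xe; right; exists e, i.
- exact: phi_inj.
- move=> e i e' i' hi hi' h; have ee : e = e'.
    by apply: (@Adisj e e' (inl (pv e i))); [apply: inV'|rewrite h; apply: inV'].
  by subst e'; split => //; apply: path_vinj (pathA e) _ _ hi hi' h.
by move=> v e i hi h; case/negP: (phiA v e); rewrite h; apply: inV'.
Qed.

End Assemble.

Section Graph.
Variables (G : mgraph) (g : nat).
Hypothesis g2 : 2 <= g.
Hypothesis G_connected : connected G.
Hypothesis G_leafless : leafless G.
Hypothesis G_betti : betti G = Posz g.

Local Notation cut := (cut (@nmu G)).
Local Notation rk := (rk (@nmu G)).
Local Notation conn := (conn (@nmu G)).
Local Notation is_comp := (is_comp (@nmu G)).
Local Notation TT := [set: node G].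
Local Notation deg x := (cut [set x] TT).
Local Notation K := (node_group G).

Let sy := @nmu_sym G.
Let ir := @nmu_irr G.

Lemma betti_card : #|edge G| + 1 = #|vertex G| + g.
Proof. by move: G_betti; rewrite /betti G_connected; lia. Qed.

Lemma node_conn : conn TT. Proof. exact: connected_conn. Qed.

Lemma node_rk : rk TT = g.
Proof. by rewrite /rk cut_nodes card_node doubleK; have := betti_card; lia. Qed.

Lemma degree_ge2 (x : vertex G) : 2 <= degree x.
Proof.
have := G_leafless x; case E : (degree x) => [|[|k]] // _.
have m0 e : mult x e = 0.
  apply/eqP; rewrite -leqn0 -E; apply: leq_trans (degree_ge x [set e]); by rewrite big_set1.
have sub : TT \subset [set inl x].
  apply: (node_conn (x := inl x)); rewrite ?inE // => a b; rewrite !inE => /eqP -> _ _.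
  by case: b => // e /=; rewrite m0.
have : #|TT| <= 1 by rewrite -(cards1 (inl x : node G)); apply: subset_leq_card.
rewrite card_node => h; have : 0 < #|vertex G| by apply/card_gt0P; exists x.
by have := betti_card; lia.
Qed.

Lemma node_deg2 a : 2 <= deg a.
Proof. by case: a => [x|e]; rewrite ?deg_edge // deg_vertex degree_ge2. Qed.

Lemma deg3_vertex a : 3 <= deg a -> exists x, a = inl x.
Proof. by case: a => [x _|e]; [exists x|rewrite deg_edge]. Qed.

Lemma branch_indep a b : 3 <= deg a -> 3 <= deg b -> nmu a b = 0.
Proof. by move=> /deg3_vertex[x ->] /deg3_vertex[y ->]. Qed.

(** If each F b is at least 2 and the total excess over 2 is k, then an element
    with excess at least k carries all of it. *)
Lemma sum_tight (C : {set node G}) (F : node G -> nat) k a : a \in C ->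
  (forall b, 2 <= F b) -> \sum_(b in C) F b = #|C|.*2 + k -> 2 + k <= F a ->
  F a = 2 + k /\ forall b, b \in C -> b != a -> F b = 2.
Proof.
move=> aC rank_count sumF Fa.
have ge (Q : {set node G}) : #|Q|.*2 <= \sum_(b in Q) F b.
  by rewrite -muln2 -sum_nat_const; apply: leq_sum.
have cC := cardsD1 a C; rewrite aC in cC.
have sa : F a + \sum_(b in C :\ a) F b = #|C|.*2 + k by rewrite -(big_setD1 a aC).
have gCa := ge (C :\ a); split.
  by move: sa cC gCa Fa; clear; move: (\sum_(i in _) _) => S; lia.
move=> b bC ba; have bCa : b \in C :\ a by rewrite !inE ba.
have gCab := ge (C :\ a :\ b); have cCb := cardsD1 b (C :\ a); rewrite bCa in cCb.
have sb : \sum_(d in C :\ a) F d = F b + \sum_(d in C :\ a :\ b) F d.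
  by rewrite -(big_setD1 b bCa).
have Fb := rank_count b; rewrite sb in sa.
by move: sa cC cCb gCab Fa Fb; clear; move: (\sum_(i in _) _) => S; lia.
Qed.
(** A path touches its complement only at its two ends. *)
Lemma path_boundary (o : vertex G) n pe pv z (A : {set node G}) d x : is_path o n pe pv z A ->
  inr d \in A -> x \in ends d -> inl x \notin A ->
  (x = o /\ d = pe 0) \/ (x = z /\ d = pe n.-1).
Proof.
move=> [n0 p0 pn pends pedg pver peinj pvinj] /pedg[i hi ->].
rewrite pends // !inE => /orP[] /eqP -> xA.
  case: i hi xA => [|i] hi xA; first by left; rewrite p0.
  by case/negP: xA; apply/pver; exists i.+1.
have [ni|ni] := ltnP i.+1 n; first by case/negP: xA; apply/pver; exists i.+1.
have nE : n = i.+1 by lia.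
by right; rewrite -pn nE.
Qed.

Lemma path_last (o : vertex G) n pe pv z (A : {set node G}) : is_path o n pe pv z A ->
  inr (pe n.-1) \in A /\ z \in ends (pe n.-1).
Proof.
move=> [n0 p0 pn pends pedg pver peinj pvinj]; split.
  by apply/pedg; exists n.-1; rewrite ?prednK.
by rewrite pends ?prednK // pn !inE eqxx orbT.
Qed.

(** The path of [path_exists] ends at O because a component is closed under
    adjacency in the complement of O. *)
Lemma comp_path (O B : {set node G}) (o : vertex G) y : (forall e, inr e \notin O) ->
  is_comp (~: O) B -> inr y \in B -> inl o \in O -> o \in ends y ->
  (forall x, inl x \in B -> degree x = 2) ->
  exists n pe pv z, [/\ is_path o n pe pv z B, pe 0 = y & inl z \in O].
Proof.
move=> Oe [B0 BU cB clB] yB oO oy dB.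
have eB e x : inl x \in B -> x \in ends e -> inr e \in B.
  move=> xB xe; apply: (clB (inl x)) => //; rewrite ?nmu_xe ?inE ?Oe //.
  by have := subsetP BU _ xB; rewrite inE.
have oB : inl o \notin B by apply/negP => /(subsetP BU); rewrite inE oO.
have [n [pe [pv [z [hp pe0 zB]]]]] := path_exists cB (fun x e => @eB e x) dB oB yB oy.
exists n, pe, pv, z; split => //.
have [lA lz] := path_last hp; apply: contraNT zB => zO.
by apply: (clB (inr (pe n.-1))); rewrite ?nmu_ex ?inE // Oe.
Qed.

Lemma setTD1C (v : node G) : TT :\ v = ~: [set v].
Proof. by apply/setP => a; rewrite !inE andbT. Qed.

Lemma deg_sum_comp (v : node G) C : is_comp (TT :\ v) C ->
  \sum_(a in C) deg a + 2 = #|C|.*2 + (rk C).*2 + cut [set v] C.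
Proof.
move=> hC; have vT : v \in TT by rewrite inE.
have [C0 _ cC _] := hC; have := rkE sy ir C0 cC.
have -> : \sum_(a in C) deg a = cut C C + cut [set v] C.
  have -> : cut C C = \sum_(a in C) cut [set a] C.
    by rewrite {1}/cut; apply: eq_bigr => a _; rewrite cut1l.
  rewrite [cut [set v] C]cut1l -big_split; apply: eq_bigr => a aC /=.
  exact: (deg_comp sy vT hC).
by move: (cut C C) (cut [set v] C); lia.
Qed.
Section Fixed.
Variables (v0 : vertex G) (C : {set node G}).
Let v : node G := inl v0.
Hypothesis hC : is_comp (TT :\ v) C.
Hypothesis Kv : forall f, f \in K -> f v = v.
Hypothesis orbC : #|orbit 'P^* K C| = g.
Hypothesis allC : forall C', is_comp (TT :\ v) C' -> C' \in orbit 'P^* K C.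

Let vT : v \in TT. Proof. by rewrite inE. Qed.
Let vC : v \notin C. Proof. exact: comp_notin hC. Qed.

(** Transporting one component C by automorphisms h i makes all path lengths
    agree without further argument. *)
Lemma orbit_enum : exists h : 'I_g -> {perm vertex G} * {perm edge G},
  [/\ forall i, h i \in Aut_mgraph G, forall i, (h i).1 v0 = v0,
      forall i j a, a \in node_perm (h i) @: C -> a \in node_perm (h j) @: C -> i = j
    & forall a, a != v -> exists i, a \in node_perm (h i) @: C].
Proof.
pose S i := enum_val (cast_ord (esym orbC) i).
have Sorb i : S i \in orbit 'P^* K C by apply: enum_valP.
have Sinj : injective S by move=> i j /enum_val_inj /cast_ord_inj.
have ex i : exists h, h \in Aut_mgraph G /\ S i = node_perm h @: C.
  by have /orbit_setP[f /node_groupP[h hA ->] ->] := Sorb i; exists h.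
have [h hP] := fin_all_exists ex; exists h.
have aK f : f \in K -> automorph (@nmu G) f by apply: node_group_aut.
have KT f : f \in K -> f @: TT = TT by move=> _; apply: imT.
have compS i : is_comp (TT :\ v) (S i).
  exact: (orbit_is_comp hC aK KT Kv (Sorb i)).
have hA i : h i \in Aut_mgraph G by case: (hP i).
have SE i : S i = node_perm (h i) @: C by case: (hP i).
split => //.
- move=> i; have : node_perm (h i) \in K by apply/node_groupP; exists (h i).
  by move=> /Kv; rewrite permE => -[].
- by move=> i j a; rewrite -!SE => ai aj; apply: Sinj;
  apply: is_comp_eq (compS i) (compS j) ai aj.
move=> a av; have aT : a \in TT :\ v by rewrite !inE av.
have [C' hC' aC'] := is_comp_ex sy aT.
have : C' \in orbit 'P^* K C by apply: allC.
move=> C'o; exists (cast_ord orbC (enum_rank_in C'o C')).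
by rewrite -SE /S cast_ordK enum_rankK_in.
Qed.

(** All nodes of C have degree 2, so C is a path from v to v. It has at least
    two edges because v has two distinct neighbours in C. *)
Lemma bouquet_shape : cut [set v] C = 2 -> rk C = 0 -> #|nbrs (@nmu G) v C| = 2 ->
  subdivided_bouquet g G.
Proof.
move=> c2 r0 n2; have [C0 CU cC clC] := hC.
have dC a : a \in C -> deg a = 2.
  move=> aC; have := deg_sum_comp hC; rewrite c2 r0 addn0 => /eqP; rewrite eqn_add2r => /eqP s.
  have [] // := sum_tight (k := 0) aC node_deg2 _ _; first by rewrite addn0.
  exact: node_deg2.
have /set0Pn[a] : nbrs (@nmu G) v C != set0 by rewrite -card_gt0 n2.
rewrite inE; case: a => [x|y]; rewrite ?andbF // nmu_xe => /andP[yC vy].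
have hC' : is_comp (~: [set v]) C by rewrite -setTD1C.
have dCv x : inl x \in C -> degree x = 2 by move=> xC; rewrite -deg_vertex dC.
have Oe e : inr e \notin [set v] by rewrite inE.
have [n [pe [pv [z [hp pe0 zO]]]]] := comp_path Oe hC' yC (set11 v) vy dCv.
move: zO; rewrite inE => /eqP [zv]; rewrite zv in hp.
have n1 : 1 < n.
  rewrite ltnNge; apply/negP => n1; have n1' : n = 1 by have := path_gt0 hp; lia.
  suff : #|nbrs (@nmu G) v C| <= 1 by rewrite n2.
  rewrite -(cards1 (inr y : node G)); apply: subset_leq_card; apply/subsetP => -[x|d];
    rewrite !inE ?andbF //.
  move=> /andP[/(path_edges hp)[i hi ->] _]; have -> : i = 0 by lia.
  by rewrite pe0.
have [h [hA hv hdisj hcov]] := orbit_enum.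
exists n => //; split; first by move=> _; apply: path_gt0 hp.
exists (fun=> tt), (fun=> tt); split => //.
have P : param (fun=> tt) (fun=> tt) (fun _ : 'I_g => n) (fun=> v0)
   (fun i k => (h i).2 (pe k)) (fun i k => (h i).1 (pv k)).
  apply: (assemble (A := fun i => node_perm (h i) @: C)).
  - by move=> i; have := path_aut (hA i) hp; rewrite hv.
  - by move=> [] [].
  - exact: hdisj.
  - move=> _ i; apply: contra vC => /imsetP[a aC E].
    suff -> : v = a by [].
    by apply: (@perm_inj _ (node_perm (h i))); rewrite -E permE /= hv.
  move=> a; have [->|av] := eqVneq a v; first by left; exists tt.
  by right; apply: hcov.
by apply: (iso_of_param _ P) => _; apply: ltnW.
Qed.

Hypothesis move_C : exists f, [/\ f \in K, f @: C = C, forall a, a \notin C -> f a = a & f !=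
  1%g].

(** The total excess of degrees in C is 1, so C has one vertex w of degree 3.
    The only edge from v into C starts a path B; it cannot return to v and ends
    at w. Another edge at w starts a path A; it cannot reach v and returns to w.
    The degree of w is now used up and C is exhausted. If A were a single loop,
    any automorphism preserving C and fixing v would fix all of C. *)
Lemma lollipop_comp : cut [set v] C = 1 -> rk C = 1 ->
  exists w0 B A b pe1 pv1 l pe2 pv2,
   [/\ is_path v0 b pe1 pv1 w0 B, is_path w0 l pe2 pv2 w0 A, 1 < l,
     C = inl w0 |: (A :|: B) & [/\ [disjoint A & B], inl w0 \notin A & inl w0 \notin B]].
Proof.
move=> c1 r1; have [C0 CU cC clC] := hC.
have sumC := deg_sum_comp hC; rewrite c1 r1 in sumC.
have sumC1 : \sum_(a in C) deg a = #|C|.*2 + 1 by lia.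
have [a /andP[aC da]] : exists a, (a \in C) && (3 <= deg a).
  apply/existsP; apply: contraT => /existsPn H.
  have : \sum_(a in C) deg a <= #|C| * 2.
    rewrite -sum_nat_const; apply: leq_sum => a aC.
    by have := H a; rewrite aC /= -leqNgt.
  by rewrite sumC1; lia.
have [w0 wE] := deg3_vertex da; rewrite wE {a wE} in aC da.
pose w : node G := inl w0; have wC : w \in C by [].
have [dw dC] := sum_tight wC node_deg2 sumC1 da.
have wv : w0 != v0 by apply: contraNneq vC => E; rewrite /v -E.
have dwE : degree w0 = 3 by rewrite -deg_vertex dw.
have /set0Pn[a] : nbrs (@nmu G) v C != set0 by apply: nbrs_neq0; rewrite c1.
rewrite inE; case: a => [x|y]; rewrite ?andbF // nmu_xe => /andP[yC vy].
have vuniq d : inr d \in C -> v0 \in ends d -> d = y.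
  move=> dC' vd; apply/eqP; apply: contraT => dy.
  have dy' : inr d != inr y :> node G by apply: contra dy => /eqP[->].
  have := cut_ge2 (@nmu G) (set11 v) dC' yC dy'; rewrite (cutC sy) c1 /=.
  have := mult_gt0 v0 d; have := mult_gt0 v0 y; rewrite vd vy /=.
  by move: (mult v0 d) (mult v0 y); clear; case=> [|m] [|m'] //; rewrite addSn addnS.
have multy : mult v0 y = 1.
  have := leq_cut (@nmu G) (subxx [set v]) (_ : [set inr y : node G] \subset C).
  rewrite sub1set yC cut11 c1 => /(_ isT) /= h.
  by apply/eqP; rewrite eqn_leq h mult_gt0.
pose O : {set node G} := [set v; w].
have Oe e : inr e \notin O by rewrite !inE.
have OV a : a \in TT :\ v -> a != w -> a \in ~: O by rewrite !inE negb_or andbT => ->.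
have OU : ~: O \subset TT :\ v by apply/subsetP => a; rewrite !inE negb_or andbT => /andP[].
have subC B d : is_comp (~: O) B -> inr d \in B -> inr d \in C -> B \subset C.
  move=> [_ BU cB _] dB dC'; apply: (cB _ (inr d)) => // a b aC' aB bB ab.
  by apply: (clC a) => //; apply: (subsetP OU); apply: (subsetP BU).
have wB B : is_comp (~: O) B -> w \notin B.
  by move=> [_ BU _ _]; apply/negP => /(subsetP BU); rewrite !inE eqxx orbT.
have degB B d : is_comp (~: O) B -> inr d \in B -> inr d \in C ->
    forall x, inl x \in B -> degree x = 2.
  move=> hB dB dC' x xB; rewrite -deg_vertex; apply: dC.
    exact: (subsetP (subC B d hB dB dC')).
  by apply: contraNneq (wB B hB) => <-.
have yU : inr y \in ~: O by rewrite inE Oe.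
have [B hB yB] := is_comp_ex sy yU.
have BC := subC B y hB yB yC; have dB := degB B y hB yB yC.
have vO : v \in O by rewrite !inE eqxx.
have wO : w \in O by rewrite !inE eqxx orbT.
have [b [pe1 [pv1 [z [hp1 pe10 zO]]]]] := comp_path Oe hB yB vO vy dB.
have zw : z = w0.
  move: zO; rewrite !inE => /orP[] /eqP[] // zv; exfalso; rewrite zv in hp1.
  have [lA lz] := path_last hp1; have ly := vuniq _ (subsetP BC _ lA) lz.
  have b1 : b.-1 = 0.
    by apply: (path_einj hp1); rewrite ?ly ?pe10 ?prednK ?(path_gt0 hp1).
  have bE : b = 1 by have := path_gt0 hp1; move: b1; clear; case: (b) => // -[].
  have := path_ends hp1 (path_gt0 hp1); rewrite pe10 (path_start hp1).
  have := path_end hp1; rewrite bE => -> ey.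
  by move: multy; rewrite /mult vy /is_loop ey setUid cards1.
rewrite {z zO}zw in hp1.
have [d1B wd1] := path_last hp1; set d1 := pe1 b.-1 in d1B wd1.
have wuniqB d : inr d \in B -> w0 \in ends d -> d = d1.
  move=> dB' wd; have [[E _]|[_ ->]] // := path_boundary hp1 dB' wd (wB B hB).
  by rewrite E eqxx in wv.
have multd1 : mult w0 d1 = 1.
  have be : b.-1 < b by rewrite prednK // (path_gt0 hp1).
  have := path_ends hp1 be; rewrite prednK ?(path_gt0 hp1) // (path_end hp1) => ed.
  rewrite /mult wd1 (nonloop_mult ed) //.
  case E : b.-1 => [|k]; first by rewrite (path_start hp1) eq_sym.
  apply: contraNneq (wB B hB) => E0; rewrite /w -E0; apply/(path_verts hp1); exists k.+1 => //.
  by rewrite -E be E.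
have [y2 /andP[y2d1 wy2]] : exists d, (d != d1) && (w0 \in ends d).
  apply/existsP; apply: contraT => /existsPn H.
  suff : degree w0 = 1 by rewrite dwE.
  move: multd1; rewrite /degree (bigD1 d1) //= big1 ?addn0; first by rewrite /mult wd1.
  by move=> d /andP[wd nd]; have := H d; rewrite nd wd.
have y2B : inr y2 \notin B by apply: contraNN y2d1 => /wuniqB ->.
have y2U : inr y2 \in ~: O by rewrite inE Oe.
have [A hA y2A] := is_comp_ex sy y2U.
have y2C : inr y2 \in C.
  by apply: (clC w) => //; [apply: (subsetP CU)|rewrite !inE|rewrite nmu_xe].
have AC := subC A y2 hA y2A y2C; have dA := degB A y2 hA y2A y2C.
have ABd : [disjoint A & B].
  apply/pred0P => a; apply/negP => /andP[aA aB]; case/negP: y2B.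
  by rewrite -(is_comp_eq hA hB aA aB).
have [l [pe2 [pv2 [z2 [hp2 pe20 z2O]]]]] := comp_path Oe hA y2A wO wy2 dA.
have zw2 : z2 = w0.
  move: z2O; rewrite !inE => /orP[] /eqP[] // zv; exfalso; rewrite zv in hp2.
  have [lA lz] := path_last hp2; have ly := vuniq _ (subsetP AC _ lA) lz.
  by rewrite ly in lA; move/pred0P: ABd => /(_ (inr y)); rewrite /= lA yB.
rewrite {z2 z2O}zw2 in hp2.
have wcov d : w0 \in ends d -> inr d \in A :|: B.
  move=> wd; rewrite inE; apply: contraT; rewrite negb_or => /andP[dA' dB'].
  have [l2A wl2] := path_last hp2; set d2 := pe2 l.-1 in l2A wl2.
  have n1 : d1 \notin [set y2; d2].
    rewrite !inE eq_sym negb_or y2d1; apply/eqP => E.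
    by move/pred0P: ABd => /(_ (inr d1)); rewrite /= {1}E l2A d1B.
  have n2 : d \notin [set d1; y2; d2].
    rewrite !inE !negb_or -andbA; apply/and3P; split; apply/eqP => E.
    - by rewrite E d1B in dB'.
    - by rewrite E y2A in dA'.
    by rewrite E l2A in dA'.
  (* The edges d, d1 and the one or two ends of A at w0 exceed the degree 3 of
     w0. *)
  have n2' : d \notin d1 |: [set y2; d2] by move: n2; rewrite !inE !negb_or -andbA.
  have := degree_ge w0 (d |: (d1 |: [set y2; d2])).
  rewrite big_setU1 //= big_setU1 //= dwE multd1.
  suff : 2 <= \sum_(e in [set y2; d2]) mult w0 e.
    have := mult_gt0 w0 d; rewrite wd; move: (mult w0 d) (\sum_(e in _) _) => m S.
    by clear; case: m S => [|m] [|[|S]] // _ _; rewrite !addSn !addnS.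
  have [E|ne] := eqVneq y2 d2.
    rewrite -E setUid big_set1; have l1 : l.-1 = 0.
      by apply: (path_einj hp2); rewrite ?prednK ?(path_gt0 hp2) // -/d2 -E pe20.
    have lE : l = 1 by have := path_gt0 hp2; move: l1; clear; case: (l) => // -[].
    have := path_ends hp2 (path_gt0 hp2); rewrite pe20 (path_start hp2).
    have := path_end hp2; rewrite lE => -> ey.
    by rewrite /mult wy2 /is_loop ey setUid cards1.
  rewrite big_setU1 ?inE //= big_set1; have := mult_gt0 w0 y2; have := mult_gt0 w0 d2.
  by rewrite wy2 wl2 => h2 h1; apply: (leq_add h1 h2).
have CE : C = w |: (A :|: B).
  apply/eqP; rewrite eqEsubset; apply/andP; split; last by rewrite !subUset sub1set wC AC BC.
  apply: (cC _ (inr y)) => //; first by rewrite !inE yB !orbT.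
  move=> a c aX _ cC' ac; have cU := subsetP CU c cC'.
  have [->|cw] := eqVneq c w; first by rewrite !inE eqxx.
  have cO := OV c cU cw; rewrite in_setU1 (negbTE cw) /=.
  move: aX; rewrite in_setU1 => /orP[/eqP aw|].
    rewrite aw in ac; case: c ac cC' cU cw cO => // d; rewrite nmu_xe => wd _ _ _ _;
      exact: wcov.
  rewrite !in_setU => /orP[aA|aB]; apply/orP; [left|right].
    have [_ AU _ clA] := hA; apply: (clA a) => //; exact: (subsetP AU).
  have [_ BU _ clB] := hB; apply: (clB a) => //; exact: (subsetP BU).
exists w0, B, A, b, pe1, pv1, l, pe2, pv2; split => //; last by rewrite !wB.
rewrite ltnNge; apply/negP => l1; have lE : l = 1.
  by have := path_gt0 hp2; move: l1; clear; case: (l) => // -[].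
have AE : A = [set inr y2].
  apply/setP => -[x|d]; rewrite inE.
    by apply/negP => /(path_verts hp2)[i]; rewrite lE; case: i => [|[]].
  apply/idP/eqP => [/(path_edges hp2)[i]|[->] //].
  by rewrite lE; case: i => // _ ->; rewrite pe20.
have [f [fK fC fnC f1]] := move_C; have /node_groupP[h hA' fE] := fK.
have af := node_group_aut fK.
have hv0 : h.1 v0 = v0 by have := fnC v vC; rewrite fE permE => -[].
have fCin a : a \in C -> f a \in C by move=> aC'; rewrite -fC imset_f.
have hy : h.2 y = y.
  apply: vuniq; first by have := fCin _ yC; rewrite fE permE.
  by rewrite (Aut_ends hA') -hv0 imset_f.
have fw : f w = w.
  apply/eqP; apply: contraT => ne; have := dC _ (fCin w wC) ne.
  have aK f' : f' \in K -> automorph (@nmu G) f' by apply: node_group_aut.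
  by rewrite (deg_aut aK w fK) dw.
have fB a : a \in B -> f a = a.
  by move=> aB; rewrite fE; apply: (path_fix hA' hp1 dB hv0 _ aB); rewrite pe10.
have fy2 : f (inr y2) = inr y2.
  have := fCin _ y2C; rewrite CE AE !inE => /orP[/eqP E|/orP[/eqP //|E]].
    by rewrite fE permE in E.
  have := fB _ E => /perm_inj E2; by rewrite E2 (negbTE y2B) in E.
case/eqP: f1; apply/permP => a; rewrite perm1.
have [aC'|/fnC //] := boolP (a \in C); move: aC'; rewrite CE AE !inE.
by case/orP => [/eqP -> //|/orP[/eqP -> //|/fB]].
Qed.

(** Each h i carries the two paths of C to those of another component. *)
Lemma lollipop_shape : cut [set v] C = 1 -> rk C = 1 -> subdivided_lollipop g G.
Proof.
move=> c1 r1.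
have [w0 [B [A [b [pe1 [pv1 [l [pe2 [pv2 [hp1 hp2 l2 CE [ABd wA wB]]]]]]]]]]] :=
  lollipop_comp c1 r1.
have [h [hA hv hdisj hcov]] := orbit_enum.
have wC : inl w0 \in C by rewrite CE !inE eqxx.
have AC : A \subset C by rewrite CE; apply/subsetP => a aA; rewrite !inE aA orbT.
have BC : B \subset C by rewrite CE; apply/subsetP => a aB; rewrite !inE aB !orbT.
pose phi (x : option 'I_g) := if x is Some i then (h i).1 w0 else v0.
pose s (e : 'I_g + 'I_g) : option 'I_g := match e with inl _ => None | inr i => Some i end.
pose t (e : 'I_g + 'I_g) : option 'I_g := match e with inl i | inr i => Some i end.
pose n (e : 'I_g + 'I_g) := match e with inl _ => b | inr _ => l end.
pose pe (e : 'I_g + 'I_g) k := match e with inl i => (h i).2 (pe1 k) | inr i => (h i).2 (pe2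
  k) end.
pose pv (e : 'I_g + 'I_g) k := match e with inl i => (h i).1 (pv1 k) | inr i => (h i).1 (pv2
  k) end.
pose X (e : 'I_g + 'I_g) := match e with inl i => node_perm (h i) @: B
                                       | inr i => node_perm (h i) @: A end.
have hw i : node_perm (h i) (inl w0) = inl ((h i).1 w0) by rewrite permE.
have hv' i : node_perm (h i) v = v by rewrite permE /= hv.
have vnC i : v \notin node_perm (h i) @: C.
  by rewrite -(hv' i) mem_imset //; apply: perm_inj.
have XC e a : a \in X e -> a \in node_perm (h (match e with inl i | inr i => i end)) @: C.
  by case: e => i /=; apply: subsetP; apply: imsetS.
have hwC i : inl ((h i).1 w0) \in node_perm (h i) @: C by rewrite -hw imset_f.
have P : param s t n phi pe pv.
  apply: (assemble (A := X)).
  - by case=> i /=; [have := path_aut (hA i) hp1; rewrite hv|have := path_aut (hA i) hp2].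
  - move=> [i|] [j|] //= E.
    + by congr Some; apply: (hdisj i j _ (hwC i)); rewrite E.
    + by have := vnC i; rewrite /v -E hwC.
    by have := vnC j; rewrite /v E hwC.
  - have AB i x : node_perm (h i) x \in X (inl i) -> node_perm (h i) x \in X (inr i) -> False.
      rewrite /X !mem_imset; try exact: perm_inj.
      by move=> xB xA; move/pred0P: ABd => /(_ x); rewrite /= xA xB.
    move=> e e' a ae ae'; have E := hdisj _ _ a (XC e a ae) (XC e' a ae').
    have [x _ xE] := imsetP (XC e a ae); case: e ae E xE => i ae E xE;
      case: e' ae' E => j ae' /= E; rewrite -E in ae' *; rewrite xE in ae ae' => //.
      by case: (AB i x).
    by case: (AB i x).
  - move=> [i|] e /=.
      apply/negP => ie; have E := hdisj _ _ _ (hwC i) (XC e _ ie).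
      move: ie; rewrite -hw E; case: e {E} => j /=; rewrite mem_imset; try exact: perm_inj.
        by apply/negP.
      by apply/negP.
    by apply/negP => /XC; apply/negP.
  move=> a; have [->|av] := eqVneq a v; first by left; exists None.
  have [i] := hcov a av; rewrite CE imsetU1 imsetU !inE hw => /orP[/eqP ->|/orP[aA|aB]].
  - by left; exists (Some i).
  - by right; exists (inr i).
  by right; exists (inl i).
exists l, b; split => //; first exact: path_gt0 hp1.
split; first by case=> i; [apply: path_gt0 hp1|apply: path_gt0 hp2].
exists s, t; split; first by case=> i.
by apply: (iso_of_param _ P); case=> i /=; [apply: path_gt0 hp1|apply: path_gt0 hp2].
Qed.

End Fixed.

Lemma fixed_shape (v : node G) : 3 <= g -> 3 <= deg v ->
  (forall f, f \in K -> f v = v) -> #|K| = bsize g ->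
  subdivided_bouquet g G \/ subdivided_lollipop g G.
Proof.
move=> g3 dv Kv cK; have [v0 vE] := deg3_vertex dv; subst v.
have /set0Pn[a av] : TT :\ (inl v0 : node G) != set0.
  apply/negP => /eqP /setP E; have : deg (inl v0) = 0; last by move=> e; rewrite e in dv.
  rewrite cut1l sum_nodes /= big1_eq big1 // => e _.
  by have := E (inr e); rewrite !inE.
have [C hC aC] := is_comp_ex sy av.
have aK f : f \in K -> automorph (@nmu G) f by apply: node_group_aut.
have [orbC allC cases mv] := fixed_eq sy ir aK node_conn node_rk g2 node_deg2 Kv dv g3 cK hC.
case: cases => [[c2 r0 n2]|[c1 r1]].
  by left; apply: (bouquet_shape hC Kv orbC allC c2 r0 n2).
by right; apply: (lollipop_shape hC Kv orbC allC mv c1 r1).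
Qed.
(** Let B be the path that leaves v through one neighbour. It ends at u, as
    otherwise v would cut it off. The automorphisms fixing v carry it to the
    paths through the other neighbours; these use up the degrees of v and u, so
    they fill the graph. *)
Lemma banana_of_shape (v u : node G) : banana_shape (@nmu G) K g v u -> subdivided_banana g G.
Proof.
move=> [vu cv [dv du dO] cN trans].
have [v0 vE] : exists x, v = inl x by apply: deg3_vertex; rewrite dv.
have [u0 uE] : exists x, u = inl x by apply: deg3_vertex; rewrite du.
subst v u; set v : node G := inl v0 in vu cv dv dO cN trans;
  set u : node G := inl u0 in vu du dO.
have uv0 : u0 != v0 by apply: contraNneq vu => E; rewrite /u E.
pose O : {set node G} := [set v; u].
have Oe e : inr e \notin O by rewrite !inE.
have vO : v \in O by rewrite !inE eqxx.
have uO : u \in O by rewrite !inE eqxx orbT.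
have nbrE a : a \in nbrs (@nmu G) v TT -> exists2 e, a = inr e & v0 \in ends e.
  by rewrite inE; case: a => [x|e]; rewrite ?andbF // nmu_xe => /andP[_ h]; exists e.
pose S i := enum_val (cast_ord (esym cN) i).
have SN i : S i \in nbrs (@nmu G) v TT by apply: enum_valP.
have Sinj : injective S by move=> i j /enum_val_inj /cast_ord_inj.
have [y y0E vy] := nbrE _ (SN ord0).
have ex i : exists h, [/\ h \in Aut_mgraph G, h.1 v0 = v0 & S i = inr (h.2 y)].
  have [f [fK fv fy]] := trans _ _ (SN ord0) (SN i).
  have /node_groupP[h hA fE] := fK; exists h; split => //.
    by move: fv; rewrite fE permE => -[].
  by rewrite -fy y0E fE permE.
have [h hP] := fin_all_exists ex.
have hA i : h i \in Aut_mgraph G by case: (hP i).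
have hv i : (h i).1 v0 = v0 by case: (hP i).
have hK i : node_perm (h i) \in K by apply/node_groupP; exists (h i).
have aK f : f \in K -> automorph (@nmu G) f by apply: node_group_aut.
have hu i : (h i).1 u0 = u0.
  apply/eqP; apply: contraT => ne.
  have := deg_aut aK u (hK i); rewrite permE /= du => E.
  have : deg (inl ((h i).1 u0)) = 2.
    apply: dO; last by apply: contra ne => /eqP[->].
    apply/eqP => -[E']; rewrite -[in RHS](hv i) in E'; move/perm_inj: E' => E'.
    by rewrite E' eqxx in uv0.
  by rewrite E; move: g2; clear; case: (g) => [|[]].
have yU : inr y \in ~: O by rewrite inE Oe.
have [B hB yB] := is_comp_ex sy yU; have [_ BU cB clB] := hB.
have dB x : inl x \in B -> degree x = 2.
  move=> xB; have := subsetP BU _ xB; rewrite !inE negb_or => /andP[xv xu].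
  by rewrite -deg_vertex dO.
have [n [pe [pv [z [hp pe0 zO]]]]] := comp_path Oe hB yB vO vy dB.
have uB : u \notin B by apply/negP => /(subsetP BU); rewrite inE uO.
have vB : v \notin B by apply/negP => /(subsetP BU); rewrite inE vO.
have zu : z = u0.
  move: zO; rewrite !inE => /orP[] /eqP[] // zv; exfalso; rewrite zv in hp.
  have : TT :\ v \subset B.
    apply: (cv _ (inr y)); rewrite ?inE // => a c aB _; rewrite !inE andbT => cv0 ac.
    have [cu|cu] := eqVneq c u; last first.
      by apply: (clB a) => //; [apply: (subsetP BU)|rewrite !inE negb_or cv0].
    exfalso; rewrite cu in ac; case: a aB ac => // d dB'; rewrite nmu_ex => ud.
    by have [[E _]|[E _]] := path_boundary hp dB' ud uB; rewrite E eqxx in uv0.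
  by move/subsetP/(_ u); rewrite !inE andbT eq_sym vu (negbTE uB) => /(_ isT).
rewrite {z zO}zu in hp.
have hpi i : is_path v0 n (fun k => (h i).2 (pe k)) (fun k => (h i).1 (pv k)) u0 (node_perm
  (h i) @: B).
  by have := path_aut (hA i) hp; rewrite hv hu.
pose A i := node_perm (h i) @: B.
have compA i : is_comp (~: O) (A i).
  have := is_comp_aut (aK _ (hK i)) hB; congr (is_comp _ _).
  apply/eqP; rewrite eqEcard card_imset ?leqnn ?andbT; last exact: perm_inj.
  apply/subsetP => _ /imsetP[a aO ->]; move: aO; rewrite !inE !negb_or.
  have e1 : node_perm (h i) v = v by rewrite permE /= hv.
  have e2 : node_perm (h i) u = u by rewrite permE /= hu.
  by rewrite -{2}e1 -{2}e2 !(inj_eq perm_inj).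
have vA i : v \notin A i by have [_ AU _ _] := compA i; apply/negP => /(subsetP AU);
  rewrite inE vO.
have uA i : u \notin A i by have [_ AU _ _] := compA i; apply/negP => /(subsetP AU);
  rewrite inE uO.
have yA i : inr ((h i).2 y) \in A i by apply/imsetP; exists (inr y); rewrite ?permE.
have Adisj i j a : a \in A i -> a \in A j -> i = j.
  move=> ai aj; have E := is_comp_eq (compA i) (compA j) ai aj.
  have vyj : v0 \in ends ((h j).2 y) by rewrite (Aut_ends (hA j)) -{1}(hv j) imset_f.
  have yj : inr ((h j).2 y) \in A i by rewrite E.
  have [[_ e]|[e _]] := path_boundary (hpi i) yj vyj (vA i); last by rewrite e eqxx in uv0.
  by apply: Sinj; have [_ _ ->] := hP i; have [_ _ ->] := hP j; rewrite e pe0.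
have ucov d : u0 \in ends d -> exists i, inr d \in A i.
  move=> ud; apply/existsP; apply: contraT => /existsPn nd.
  pose L i := (h i).2 (pe n.-1).
  have LA i : inr (L i) \in A i /\ u0 \in ends (L i) by apply: path_last (hpi i).
  have Linj : injective L.
    by move=> i j E; apply: (Adisj i j (inr (L i))); [case: (LA i)|rewrite E; case: (LA j)].
  have dL : d \notin L @: setT.
    by apply/negP => /imsetP[i _ E]; have := nd i; rewrite E; case: (LA i) => ->.
  have := degree_ge u0 (d |: L @: setT); rewrite -deg_vertex du big_setU1 //=.
  have : #|L @: setT| <= \sum_(e in L @: setT) mult u0 e.
    rewrite -sum1_card; apply: leq_sum => _ /imsetP[i _ ->]; rewrite mult_gt0; exact: (LA i).2.
  rewrite card_imset // cardsT card_ord; have := mult_gt0 u0 d; rewrite ud.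
  move: (mult u0 d) (\sum_(e in _) _) => m M; clear; case: m => // m _ h1 h2.
  by have := leq_trans h1 (leq_trans (leq_addl m M) h2); rewrite ltnn.
have vcov d : v0 \in ends d -> exists i, inr d \in A i.
  move=> vd; have dN : inr d \in nbrs (@nmu G) v TT by rewrite inE nmu_xe vd inE.
  have [i E2] : exists i, S i = inr d.
    by exists (cast_ord cN (enum_rank_in dN (inr d))); rewrite /S cast_ordK enum_rankK_in.
  by exists i; have [_ _ E] := hP i; rewrite -E2 E yA.
have cover a : a \in O \/ exists i, a \in A i.
  pose X := O :|: \bigcup_i A i.
  have : TT \subset X.
    apply: (node_conn (x := v)); rewrite ?inE ?eqxx // => c d; rewrite in_setU => cX _ _ cd;
      rewrite in_setU.
    have inX e : (exists i, e \in A i) -> (e \in O) || (e \in \bigcup_i A i).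
      by case=> i ei; apply/orP; right; apply/bigcupP; exists i.
    case/orP: cX => [|/bigcupP[i _ ci]].
      rewrite in_set2 => /orP[] /eqP cE; rewrite cE in cd; case: d cd => // d;
        rewrite nmu_xe => h0;
        apply: inX; [exact: vcov|exact: ucov].
    have [//|dO'] := boolP (d \in O); apply/orP; right; apply/bigcupP; exists i => //.
    have [_ AU _ clA] := compA i; apply: (clA c) => //; first exact: (subsetP AU).
    by rewrite inE.
  move/subsetP/(_ a); rewrite inE => /(_ isT); rewrite in_setU => /orP[aO|/bigcupP[i _ ai]].
    by left.
  by right; exists i.
exists n; first exact: path_gt0 hp.
split; first by move=> _; apply: path_gt0 hp.
exists (fun=> false), (fun=> true); split => //.
have P : param (fun=> false) (fun=> true) (fun _ : 'I_g.+1 => n)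
   (fun c : bool => if c then u0 else v0)
   (fun i k => (h i).2 (pe k)) (fun i k => (h i).1 (pv k)).
  apply: (assemble (A := A)).
  - exact: hpi.
  - by move=> [] [] // E; rewrite E eqxx in uv0.
  - exact: Adisj.
  - by move=> [] i; [apply: uA|apply: vA].
  move=> a; case: (cover a) => [|h0]; last by right.
  by rewrite !inE => /orP[] /eqP ->; left; [exists false|exists true].
by apply: (iso_of_param _ P) => _; apply: path_gt0 hp.
Qed.

End Graph.

Theorem proposition2 (G : mgraph) (g : nat) (g_ge2 : 2 <= g)
    (G_connected : connected G) (G_leafless : leafless G)
    (G_betti : betti G = Posz g) :
  let bound := if 3 <= g then 2 ^ g * g`! else 12 in
  #|Aut_mgraph G| <= bound /\
  (#|Aut_mgraph G| = bound <->
   [\/ g \in [:: 2; 3] /\ subdivided_banana g G,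
       3 <= g /\ subdivided_bouquet g G
     | 3 <= g /\ subdivided_lollipop g G]).
Proof.
have aK f : f \in node_group G -> automorph (@nmu G) f by apply: node_group_aut.
have [le eq] := classify (@nmu_sym G) (@nmu_irr G) aK (node_conn G_connected)
  (node_rk g_ge2 G_connected G_betti) g_ge2
  (node_deg2 g_ge2 G_connected G_leafless G_betti) (@branch_indep G).
rewrite card_node_group in le eq; split; first exact: le.
have conv : bound g <= #|Aut_mgraph G| -> #|Aut_mgraph G| = bound g.
  by move=> h; apply/eqP; rewrite eqn_leq le h.
split.
  case/eq=> [[g3 [v [dv Kv cK]]]|[gg [v [u shape]]]].
    rewrite -card_node_group in cK.
    have [h|h] := fixed_shape g_ge2 G_connected G_leafless G_betti g3 dv Kv cK.
      by constructor 2.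
    by constructor 3.
  by constructor 1; split => //; apply: (banana_of_shape g_ge2 G_connected G_betti shape).
case=> [[gg h]|[g3 h]|[g3 h]]; apply: conv.
- apply: leq_trans (aut_banana_ge h).
  by move: gg; rewrite !inE => /orP[] /eqP ->.
- by rewrite boundE //; apply: aut_bouquet_ge.
by rewrite boundE //; apply: aut_lollipop_ge.
Qed.
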